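(* Let $(M,d)$ be a compact metric space and let $f:M\to M$ be a homeomorphism satisfying the Anosov Closing property. Let $\mu$ be an ergodic $f$-invariant Borel probability measure on $M$, and let $A:M\to M(d,\mathbb{R})$ be an $\alpha$-H\''older continuous map for some $\alpha>0$. Then there exists a sequence of periodic points $(p_k)_{k\in\mathbb{N}}$ of $f$ such that \[ \gamma_i(A,p_k)\xrightarrow{k\to+\infty}\gamma_i(A,\mu)\qquad\text{for every } i=1,\dots,d. \]
   Context: $M(d,\mathbb{R})$ is the set of real $d\times d$ matrices (not necessarily invertible), with the operator norm $\|B\|=\sup\{\|Bv\|/\|v\|: v\neq 0\}$. $A$ is $\alpha$-H\''older if there is $C_2>0$ with $\|A(x)-A(y)\|\le C_2 d(x,y)^\alpha$ for all $x,y\in M$. The cocycle is $A^n(x)=A(f^{n-1}(x))\cdots A(f(x))A(x)$ for $n>0$ and $A^0(x)=\mathrm{Id}$ (a ''semi-invertible'' cocycle: $f$ is invertible but the matrices need not be). $f$ satisfies the Anosov Closing property if there exist $C_1,\varepsilon_0,\theta>0$ such that whenever $z\in M$ and $n\ge1$ satisfy $d(f^n(z),z)<\varepsilon_0$, there is a point $p\in M$ with $f^n(p)=p$ and $d(f^j(z),f^j(p))\le C_1e^{-\theta\min\{j,n-j\}}d(f^n(z),z)$ for all $j=0,1,\dots,n$. By the semi-invertible multiplicative ergodic theorem (Froyland–Lloyd–Quas), for $\mu$-a.e. $x$ there are numbers $\lambda_1>\dots>\lambda_l\ge-\infty$ (independent of $x$) and a splitting $\mathbb{R}^d=E^1_x\oplus\dots\oplus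 E^l_x$ with constant dimensions, $A(x)E^i_x\subseteq E^i_{f(x)}$ (equality if $\lambda_i>-\infty$), and $\lim_{n\to+\infty}\frac1n\log\|A^n(x)v\|=\lambda_i$ for nonzero $v\in E^i_x$; these are the Lyapunov exponents of $(f,A)$ with respect to $\mu$. $\gamma_1(A,\mu)\ge\dots\ge\gamma_d(A,\mu)$ denote these exponents repeated according to the dimensions of $E^i_x$ (values in $[-\infty,\infty)$). For a periodic point $p$, $\gamma_1(A,p)\ge\dots\ge\gamma_d(A,p)$ denote the Lyapunov exponents with multiplicity of $(f,A)$ with respect to the invariant probability measure equidistributed on the orbit of $p$ (equivalently, determined by the moduli of eigenvalues of $A^n(p)$, $n$ the period, with $\log 0=-\infty$). Convergence is in $[-\infty,\infty)$ (so if $\gamma_i(A,\mu)=-\infty$ it means $\gamma_i(A,p_k)\to-\infty$). *)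

(* Defs.v *)
From HB Require Import structures.
From mathcomp Require Import all_boot all_order all_algebra.
From mathcomp Require Import all_classical all_reals all_analysis.
Set Implicit Arguments. Unset Strict Implicit. Unset Printing Implicit Defensive.
Import Order.TTheory GRing.Theory Num.Theory.
Import numFieldNormedType.Exports.
Local Open Scope classical_set_scope.
Local Open Scope ring_scope.

Section Defs.
Variable R : realType.

Definition is_metric (M : pointedType) (dist : M -> M -> R) : Prop :=
  [/\ (forall x y, 0 <= dist x y),
      (forall x y, dist x y = 0 <-> x = y),
      (forall x y, dist x y = dist y x) &
      (forall x y z, dist x z <= dist x y + dist y z)].

Definition mopen (M : pointedType) (dist : M -> M -> R) : set (set M) :=
  [set U | forall x, U x -> exists2 e : R, 0 < e & forall y, dist x y < e -> U y].

Definition mcompact (M : pointedType) (dist : M -> M -> R) : Prop :=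
  forall (I : Type) (U : I -> set M),
    (forall i, mopen dist (U i)) -> (forall x, exists i, U i x) ->
    exists (n : nat) (g : 'I_n -> I), forall x, exists j, U (g j) x.

Definition mcontinuous (M : pointedType) (dist : M -> M -> R) (f : M -> M) : Prop :=
  forall x (e : R), 0 < e -> exists2 delta : R, 0 < delta &
    forall y, dist x y < delta -> dist (f x) (f y) < e.

Definition homeomorphism (M : pointedType) (dist : M -> M -> R) (f : M -> M) : Prop :=
  exists g : M -> M, [/\ cancel f g, cancel g f, mcontinuous dist f & mcontinuous dist g].

Definition anosov_closing (M : pointedType) (dist : M -> M -> R) (f : M -> M) : Prop :=
  exists (C1 eps0 theta : R), [/\ 0 < C1, 0 < eps0, 0 < theta &
    forall (z : M) (n : nat), (1 <= n)%N -> dist (iter n f z) z < eps0 ->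
      exists p : M, iter n f p = p /\
        forall j : nat, (j <= n)%N ->
          dist (iter j f z) (iter j f p)
            <= C1 * expR (- theta * (minn j (n - j))%:R) * dist (iter n f z) z].

Definition vnorm (d : nat) (v : 'cV[R]_d) : R := Num.sqrt (\sum_i (v i 0) ^+ 2).

Definition opnorm (d : nat) (B : 'M[R]_d) : R :=
  sup [set vnorm (B *m v) / vnorm v | v in [set v : 'cV[R]_d | v != 0]].

Definition holder (M : pointedType) (dist : M -> M -> R) (d : nat) (A : M -> 'M[R]_d)
    (alpha : R) : Prop :=
  exists2 C2 : R, 0 < C2 & forall x y, opnorm (A x - A y) <= C2 * (dist x y) `^ alpha.

Fixpoint cocycle (M : pointedType) (f : M -> M) (d : nat) (A : M -> 'M[R]_d) (n : nat) (x : M)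
  : 'M[R]_d :=
  match n with
  | 0 => 1%:M
  | n'.+1 => A (iter n' f x) *m cocycle f A n' x
  end.

Definition elog (r : R) : \bar R := if r == 0 then -oo%E else (ln r)%:E.

(** ** Lyapunov exponents (semi-invertible Oseledets splitting, Froyland-Lloyd-Quas).
   [lyap_spectrum nu gamma] : gamma is the list gamma_1 >= ... >= gamma_d of
   Lyapunov exponents of (f, A) w.r.t. nu, repeated with multiplicity.
   Subspaces of R^d are represented as row spaces of d x d matrices; a row vector
   v is identified with the column vector v^T. *)
Definition lyap_spectrum (M : pointedType) (dist : M -> M -> R) (f : M -> M) (d : nat)
    (A : M -> 'M[R]_d)
    (nu : {measure set (g_sigma_algebraType (mopen dist)) -> \bar R})
    (gamma : 'I_d -> \bar R) : Prop :=
  exists (l : nat) (lam : 'I_l -> \bar R) (m : 'I_l -> nat) (E : M -> 'I_l -> 'M[R]_d),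
  [/\ (forall i j : 'I_l, (i < j)%N -> (lam j < lam i)%E),
      (forall i, (0 < m i)%N),
      (\sum_(i < l) m i)%N = d,
      (forall (i : 'I_l) (k : 'I_d),
          (\sum_(j < l | (j < i)%N) m j <= k < \sum_(j < l | (j <= i)%N) m j)%N ->
          gamma k = lam i) &
      {ae nu, forall x : g_sigma_algebraType (mopen dist),
        [/\ (forall i, \rank (E x i) = m i) /\ mxdirect (\sum_(i < l) E x i),
            (\sum_(i < l) E x i == 1%:M)%MS,
            (forall i, (E x i *m (A x)^T <= E (f x) i)%MS),
            (forall i, lam i != -oo%E -> (E x i *m (A x)^T == E (f x) i)%MS) &
            (forall i (v : 'rV[R]_d), v != 0 -> (v <= E x i)%MS ->
               (fun n : nat => ((n%:R)^-1)%:E * elog (vnorm (cocycle f A n x *m v^T)))%E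
                 @ \oo --> lam i)]}].

Definition orbit_measure (M : pointedType) (dist : M -> M -> R) (f : M -> M) (p : M) (n : nat)
  : {measure set (g_sigma_algebraType (mopen dist)) -> \bar R} :=
  mscale ((n%:R)^-1)%:nng
    (msum (fun j => (@dirac _ (g_sigma_algebraType (mopen dist)) (iter j f p) R : {measure set (g_sigma_algebraType (mopen dist)) -> \bar R})) n).

Definition invariant_measure (M : pointedType) (dist : M -> M -> R) (f : M -> M)
    (mu : {measure set (g_sigma_algebraType (mopen dist)) -> \bar R}) : Prop :=
  forall S : set (g_sigma_algebraType (mopen dist)), measurable S -> mu (f @^-1` S) = mu S.

Definition ergodic_measure (M : pointedType) (dist : M -> M -> R) (f : M -> M)
    (mu : {measure set (g_sigma_algebraType (mopen dist)) -> \bar R}) : Prop :=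
  forall S : set (g_sigma_algebraType (mopen dist)), measurable S -> f @^-1` S = S ->
    mu S = 0%E \/ mu S = 1%E.

End Defs.

(* Main.v *)
(** Since the matrices need not be invertible and the given splitting need not be measurable, only
    the slow subspaces [{v | A^n(x) v = O(e^(s n))}] are used. For [s < t] separating the exponents
    into [k] large and [d - k] small ones, such a subspace is the kernel of a frame [U_x] with [k]
    orthonormal rows, [A] acts on it with rate at most [s], and the quotient maps
    [U_(f^n x) A^n(x) U_x^T] expand with rate at least [t]. The expansion rests on a lower bound for
    the growth of the maximal [r]-dimensional volumes: if it failed, a subadditive dichotomy would
    make these volumes decay too fast on almost every orbit, and a limit of slow vectors would give a
    vector contradicting the exponents.

    By Poincare recurrence and a maximal inequality there are orbit segments [z, ..., f^n z] that
    return close to [z], along which these estimates hold with errors subexponential in the distance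
    to the ends of the segment. The closing property shadows such a segment by a periodic orbit, and
    the shadowing error decays exponentially away from the ends. So cones around the fast quotient,
    with adapted norms, are invariant under the period matrix of the periodic point, which therefore
    has [k] exponents above [t] and [d - k] below [s], up to a small error. Doing this simultaneously
    for finitely many separating intervals around the [gamma_i] gives the convergence. The Lyapunov
    spectrum of a periodic orbit comes from the kernels of the factors of the characteristic
    polynomial of the period matrix, grouped by the modulus of their complex roots. *)

Require Import Defs.
From HB Require Import structures.
From mathcomp Require Import all_boot all_order all_algebra.
From mathcomp Require Import all_classical all_reals all_analysis.
From mathcomp Require Import ring lra zify.
From mathcomp Require Import complex measurable_realfun.
Import Order.TTheory GRing.Theory Num.Theory.
Import numFieldNormedType.Exports.
Set Implicit Arguments. Unset Strict Implicit. Unset Printing Implicit Defensive.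
Local Open Scope classical_set_scope.
Local Open Scope ring_scope.

(** * Euclidean norm and orthonormal frames *)

Section EuclideanNorm.
Variable R : realType.

Lemma vnorm_ge0 d (v : 'cV[R]_d) : 0 <= vnorm v.
Proof. exact: sqrtr_ge0. Qed.

Lemma sqr_vnorm d (v : 'cV[R]_d) : vnorm v ^+ 2 = (v^T *m v) 0 0.
Proof.
rewrite sqr_sqrtr ?sumr_ge0 // => [|i _]; last exact: sqr_ge0.
by rewrite mxE; apply: eq_bigr => i _; rewrite mxE expr2.
Qed.

Lemma vnorm0 d : vnorm (0 : 'cV[R]_d) = 0.
Proof. by rewrite /vnorm big1 ?sqrtr0 // => i _; rewrite mxE expr0n. Qed.

Lemma vnorm_eq0 d (v : 'cV[R]_d) : vnorm v = 0 -> v = 0.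
Proof.
move=> /eqP; rewrite sqrtr_eq0 => h.
have /eqP : \sum_i v i 0 ^+ 2 = 0.
  by apply/eqP; rewrite eq_le h sumr_ge0 // => i _; exact: sqr_ge0.
rewrite psumr_eq0 => [/allP hv|i _]; last exact: sqr_ge0.
apply/matrixP => i j; rewrite ord1 mxE; apply/eqP.
by have := hv i (mem_index_enum i); rewrite sqrf_eq0.
Qed.

Lemma vnorm_gt0 d (v : 'cV[R]_d) : v != 0 -> 0 < vnorm v.
Proof.
move=> v0; rewrite lt_neqAle vnorm_ge0 andbT eq_sym.
by apply: contra v0 => /eqP/vnorm_eq0 ->.
Qed.

Lemma vdotC d (u v : 'cV[R]_d) : (u^T *m v) 0 0 = (v^T *m u) 0 0.
Proof. by rewrite -[u^T *m v]trmxK [LHS]mxE trmx_mul trmxK. Qed.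

Lemma vnormZ d (a : R) (v : 'cV[R]_d) : vnorm (a *: v) = `|a| * vnorm v.
Proof.
apply/eqP; rewrite -(eqrXn2 (n := 2)) ?vnorm_ge0 ?mulr_ge0 ?vnorm_ge0 //.
rewrite exprMn !sqr_vnorm real_normK ?num_real //.
by rewrite -scalemxAr mxE vdotC -scalemxAr mxE mulrA expr2.
Qed.

Lemma vnormN d (v : 'cV[R]_d) : vnorm (- v) = vnorm v.
Proof. by rewrite -scaleN1r vnormZ normrN1 mul1r. Qed.

Lemma sqr_vnormD d (u v : 'cV[R]_d) :
  vnorm (u + v) ^+ 2 = vnorm u ^+ 2 + 2 * (u^T *m v) 0 0 + vnorm v ^+ 2.
Proof.
rewrite !sqr_vnorm [(u + v)^T]linearD /= mulmxDl !mulmxDr.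
have E (a b : 'M[R]_1) : (a + b) 0 0 = a 0 0 + b 0 0 by rewrite mxE.
by rewrite !E (vdotC v u); ring.
Qed.

Lemma cauchy_schwarz d (u v : 'cV[R]_d) : (u^T *m v) 0 0 <= vnorm u * vnorm v.
Proof.
have [->|v0] := eqVneq v 0; first by rewrite mulmx0 mxE vnorm0 mulr0.
have vp := vnorm_gt0 v0; set D := (u^T *m v) 0 0.
have [D0|Dp] := leP D 0.
  by apply: (le_trans D0); rewrite mulr_ge0 ?vnorm_ge0.
have := sqr_ge0 (vnorm (vnorm v ^+ 2 *: u + (- D) *: v)).
rewrite sqr_vnormD !vnormZ -scalemxAr.
have -> : (- D *: ((vnorm v ^+ 2 *: u)^T *m v)) 0 0 = - D * (vnorm v ^+ 2 * D).
  by rewrite [in LHS]mxE vdotC -scalemxAr [in LHS]mxE vdotC.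
rewrite !exprMn !real_normK ?num_real // => h.
rewrite -(ler_pXn2r (n := 2)) ?nnegrE ?mulr_ge0 ?vnorm_ge0 ?(ltW Dp) //.
rewrite exprMn -(ler_pM2l (exprn_gt0 2 vp)); nra.
Qed.

Lemma ler_vnormD d (u v : 'cV[R]_d) : vnorm (u + v) <= vnorm u + vnorm v.
Proof.
rewrite -(ler_pXn2r (n := 2)) ?nnegrE ?addr_ge0 ?vnorm_ge0 //.
by rewrite sqr_vnormD; have := cauchy_schwarz u v; nra.
Qed.

Lemma ler_vnormB d (u v : 'cV[R]_d) : vnorm (u - v) <= vnorm u + vnorm v.
Proof. by rewrite -(vnormN v); exact: ler_vnormD. Qed.

Lemma ler_vnorm_sum d I (r : seq I) (P : pred I) (F : I -> 'cV[R]_d) :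
  vnorm (\sum_(i <- r | P i) F i) <= \sum_(i <- r | P i) vnorm (F i).
Proof.
elim/big_ind2 : _ => //; first by rewrite vnorm0.
by move=> x a y b hx hy; apply: (le_trans (ler_vnormD _ _)); apply: lerD.
Qed.

Lemma ler_coord_vnorm d (v : 'cV[R]_d) i : `|v i 0| <= vnorm v.
Proof.
rewrite -sqrtr_sqr; apply: ler_wsqrtr.
by rewrite (bigD1 i) //= lerDl sumr_ge0 // => j _; exact: sqr_ge0.
Qed.

Definition mxn m n (B : 'M[R]_(m, n)) : R := \sum_i \sum_j `|B i j|.

Lemma mxn_ge0 m n (B : 'M[R]_(m, n)) : 0 <= mxn B.
Proof. by apply: sumr_ge0 => i _; apply: sumr_ge0 => j _. Qed.


Lemma vnorm_mxn m n (B : 'M[R]_(m, n)) v : vnorm (B *m v) <= mxn B * vnorm v.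
Proof.
have -> : B *m v = \sum_i \sum_j (B i j * v j 0) *: delta_mx i 0.
  apply/matrixP => k l; rewrite ord1 mxE summxE [RHS](bigD1 k) //= [X in _ + X]big1 ?addr0 => [|i ik].
    rewrite summxE; apply: eq_bigr => j _.
    by rewrite [in RHS]mxE mxE !eqxx mulr1.
  rewrite summxE big1 // => j _.
  by rewrite mxE mxE eq_sym (negPf ik) mulr0.
apply: (le_trans (ler_vnorm_sum _ _ _)); rewrite /mxn mulr_suml.
apply: ler_sum => i _; apply: (le_trans (ler_vnorm_sum _ _ _)); rewrite mulr_suml.
apply: ler_sum => j _; rewrite vnormZ normrM -mulrA ler_wpM2l //.
have -> : vnorm (delta_mx i 0 : 'cV[R]_m) = 1.
  rewrite /vnorm (bigD1 i) //= big1 ?addr0 => [|k ki].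
    by rewrite !mxE !eqxx expr1n sqrtr1.
  by rewrite !mxE (negPf ki) expr0n.
by rewrite mulr1 ler_coord_vnorm.
Qed.

Lemma ler_entry_vnorm m n (B : 'M[R]_(m, n)) (c : R) :
  (forall v, vnorm (B *m v) <= c * vnorm v) -> forall i j, `|B i j| <= c.
Proof.
move=> h i j; have := h (delta_mx j 0); rewrite -colE.
have -> : vnorm (delta_mx j 0 : 'cV[R]_n) = 1.
  rewrite /vnorm (bigD1 j) //= big1 ?addr0 => [|k kj].
    by rewrite !mxE !eqxx expr1n sqrtr1.
  by rewrite !mxE (negPf kj) expr0n.
by rewrite mulr1; apply: le_trans; have := ler_coord_vnorm (col j B) i; rewrite mxE.
Qed.

Lemma vnorm_orth d r (X : 'M[R]_(d, r)) v : X^T *m X = 1%:M -> vnorm (X *m v) = vnorm v.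
Proof.
move=> h; apply/eqP; rewrite -(eqrXn2 (n := 2)) ?vnorm_ge0 //.
by rewrite !sqr_vnorm trmx_mul -mulmxA (mulmxA X^T) h mul1mx.
Qed.

Lemma vnorm_orth_tr d r (X : 'M[R]_(d, r)) v :
  X^T *m X = 1%:M -> vnorm v ^+ 2 = vnorm (X^T *m v) ^+ 2 + vnorm (v - X *m (X^T *m v)) ^+ 2.
Proof.
move=> h; set w := v - _.
have Xw : X^T *m w = 0 by rewrite mulmxBr !mulmxA h mul1mx subrr.
have hv : v = X *m (X^T *m v) + w by rewrite addrC subrK.
rewrite {1}hv sqr_vnormD vnorm_orth // [(X *m _)^T]trmx_mul -mulmxA Xw mulmx0.
by rewrite [X in 2 * X]mxE mulr0 addr0.
Qed.

Lemma vnorm_tr_le d r (X : 'M[R]_(d, r)) v : X^T *m X = 1%:M -> vnorm (X^T *m v) <= vnorm v.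
Proof.
move=> h; rewrite -(ler_pXn2r (n := 2)) ?nnegrE ?vnorm_ge0 //.
by rewrite (vnorm_orth_tr v h) lerDl sqr_ge0.
Qed.

Lemma vnorm_cotr_le d r (X : 'M[R]_(d, r)) v :
  X^T *m X = 1%:M -> vnorm (v - X *m (X^T *m v)) <= vnorm v.
Proof.
move=> h; rewrite -(ler_pXn2r (n := 2)) ?nnegrE ?vnorm_ge0 //.
by rewrite (vnorm_orth_tr v h) lerDr sqr_ge0.
Qed.

End EuclideanNorm.

Section Orthonormal.
Variable R : realType.

Lemma ker_vector p r (N : 'M[R]_(p, r)) : (p < r)%N -> exists2 v : 'cV[R]_r, v != 0 & N *m v = 0.
Proof.
move=> pr; have : kermx N^T != 0.
  by rewrite kermx_eq0 /row_free mxrank_tr; apply/eqP => h; have := rank_leq_row N; rewrite h leqNgt pr.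
case/rowV0Pn => v /sub_kermxP vN v0; exists v^T; first by rewrite trmx_eq0.
by rewrite -[N]trmxK -trmx_mul vN trmx0.
Qed.

Lemma ker_unit p r (N : 'M[R]_(p, r)) : (p < r)%N ->
  exists2 v : 'cV[R]_r, vnorm v = 1 & N *m v = 0.
Proof.
move=> pr; have [v v0 Nv] := ker_vector N pr; have vp := vnorm_gt0 v0.
exists ((vnorm v)^-1 *: v); last by rewrite -scalemxAr Nv scaler0.
by rewrite vnormZ ger0_norm ?invr_ge0 ?vnorm_ge0 // mulVf // gt_eqF.
Qed.

Lemma sqr_vnorm_mx d (v : 'cV[R]_d) : v^T *m v = (vnorm v ^+ 2)%:M.
Proof. by rewrite [LHS]mx11_scalar sqr_vnorm. Qed.

Lemma ker_orth m r (M : 'M[R]_(m, r)) j : (m + j <= r)%N ->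
  exists2 Y : 'M[R]_(r, j), Y^T *m Y = 1%:M & M *m Y = 0.
Proof.
elim: j => [|j IH] h; first by exists 0; [apply/matrixP => -[] | rewrite mulmx0].
have [|Y YY MY] := IH; first by rewrite (leq_trans _ h) // leq_add2l.
have [|y y1 /eqP] := @ker_unit _ _ (col_mx M Y^T); first by rewrite -addnS.
rewrite mul_col_mx col_mx_eq0 => /andP[/eqP My /eqP Yy].
have MyY : M *m row_mx y Y = 0 by rewrite mul_mx_row My MY row_mx0.
suff yY : (row_mx y Y)^T *m row_mx y Y = 1%:M by exists (row_mx y Y).
rewrite tr_row_mx mul_col_row YY Yy sqr_vnorm_mx y1 expr1n.
by rewrite -[y^T *m Y]trmxK trmx_mul trmxK Yy trmx0 -scalar_mx_block.
Qed.

Lemma orth_compl r s (X : 'M[R]_(r + s, r)) : X^T *m X = 1%:M ->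
  exists N : 'M[R]_(r + s, s),
    [/\ N^T *m N = 1%:M, X^T *m N = 0, N^T *m X = 0 & X *m X^T + N *m N^T = 1%:M].
Proof.
move=> XX; have [N NN XN] := ker_orth (j := s) X^T (leqnn _).
have NX : N^T *m X = 0 by rewrite -[LHS]trmxK trmx_mul trmxK XN trmx0.
exists N; split=> //.
have h : (row_mx X N)^T *m row_mx X N = 1%:M.
  by rewrite tr_row_mx mul_col_row XX XN NX NN -scalar_mx_block.
by move/mulmx1C: h; rewrite tr_row_mx mul_row_col.
Qed.

Lemma qr_decomp d r (Y : 'M[R]_(d, r)) : (r <= d)%N ->
  exists Z T, Z^T *m Z = 1%:M :> 'M[R]_r /\ Y = Z *m T.
Proof.
move=> /subnKC; move: (d - r)%N => s ds; subst d.
have [N NN YN] := ker_orth (j := s) Y^T (leqnn _).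
have [Z ZZ NZ] := @ker_orth _ _ N^T r (eq_leq (addnC s r)).
exists Z, (Z^T *m Y); split=> //.
have h : (row_mx Z N)^T *m row_mx Z N = 1%:M.
  rewrite tr_row_mx mul_col_row ZZ NZ NN.
  by rewrite -[Z^T *m N]trmxK trmx_mul trmxK NZ trmx0 -scalar_mx_block.
move/mulmx1C: h; rewrite tr_row_mx mul_row_col => h.
rewrite -{1}[Y]mul1mx -h mulmxDl -!mulmxA.
by rewrite -[N^T *m Y]trmxK trmx_mul trmxK YN trmx0 mulmx0 addr0.
Qed.

End Orthonormal.

(** * Volumes of parallelepipeds *)

Section Volume.
Variable R : realType.

Lemma bernoulli_unbounded (x K : R) : 1 < x -> exists n : nat, K < x ^+ n.
Proof.
move=> x1; have h0 : 0 < x - 1 by rewrite subr_gt0.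
have B n : 1 + (x - 1) *+ n <= x ^+ n.
  elim: n => [|n IH]; first by rewrite mulr0n addr0 expr0.
  rewrite exprS mulrSr; apply: (le_trans _ (ler_wpM2l _ IH)); last by lra.
  have : 0 <= (x - 1) * ((x - 1) *+ n) by rewrite mulr_ge0 ?mulrn_wge0 ?ltW.
  by move: ((x - 1) *+ n) => y; nra.
exists (Num.bound (`|K| / (x - 1))); apply: lt_le_trans (B _).
have := archi_boundP (divr_ge0 (normr_ge0 K) (ltW h0)).
rewrite ltr_pdivrMr ?mulr_natl => [h|//].
by apply: (le_lt_trans (ler_norm K)); lra.
Qed.

Lemma det_le_fact r (C : 'M[R]_r) : (forall i j, `|C i j| <= 1) -> `|\det C| <= (r`!)%:R.
Proof.
move=> h; apply: (le_trans (ler_norm_sum _ _ _)).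
rewrite -[X in _ <= X%:R](perm.card_Sn r) -sum1_card natr_sum; apply: ler_sum => s _.
rewrite normrM normrX normrN1 expr1n mul1r normr_prod.
by apply: prodr_ile1 => i _; rewrite normr_ge0 h.
Qed.

(* The powers of a contraction have bounded entries, hence bounded determinants. *)
Lemma det_contraction r (C : 'M[R]_r) : (forall v, vnorm (C *m v) <= vnorm v) -> `|\det C| <= 1.
Proof.
move=> h; rewrite leNgt; apply/negP => /(bernoulli_unbounded (r`!)%:R)[n].
have -> : `|\det C| ^+ n = `|\det (iter n (mulmx C) 1%:M)|.
  by elim: n => [|n IH] /=; rewrite ?det1 ?normr1 // det_mulmx normrM -IH exprS.
apply/negP; rewrite -leNgt; apply: det_le_fact.
apply: ler_entry_vnorm => v; rewrite mul1r.
elim: n => [|n IH] /=; first by rewrite mul1mx.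
by rewrite -mulmxA; apply: le_trans (h _) IH.
Qed.

Lemma det_le_expr r (C : 'M[R]_r) (b : R) : 0 <= b ->
  (forall v, vnorm (C *m v) <= b * vnorm v) -> `|\det C| <= b ^+ r.
Proof.
rewrite le_eqVlt => /predU1P[<-|b0] h.
  have -> : C = 0.
    apply/matrixP => i j; apply/eqP; rewrite mxE -normr_eq0 eq_le normr_ge0 andbT.
    exact: ler_entry_vnorm.
  by case: r {C h} => [|r]; rewrite ?det0 ?normr0 ?exprn_ge0 // det_mx00 normr1 expr0.
have -> : C = b *: (b^-1 *: C) by rewrite scalerA divff ?gt_eqF // scale1r.
rewrite detZ normrM normrX (gtr0_norm b0) ler_piMr ?exprn_ge0 ?(ltW b0) //.
apply: det_contraction => v; rewrite -scalemxAl vnormZ gtr0_norm ?invr_gt0 //.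
by rewrite ler_pdivrMl.
Qed.

Lemma det_ge_expr r (C : 'M[R]_r) (b : R) : 0 < b ->
  (forall v, b * vnorm v <= vnorm (C *m v)) -> b ^+ r <= `|\det C|.
Proof.
move=> b0 h; have uC : C \in unitmx.
  rewrite -unitmx_tr -row_free_unit -kermx_eq0.
  apply/negPn/negP => /rowV0Pn[v /sub_kermxP vN v0].
  have := h v^T; rewrite -[C]trmxK -trmx_mul vN trmx0 vnorm0.
  by rewrite leNgt mulr_gt0 // vnorm_gt0 // trmx_eq0.
have := @det_le_expr _ (invmx C) b^-1; rewrite invr_ge0 ltW // => /(_ isT).
rewrite det_inv normfV exprVn lef_pV2 ?posrE ?exprn_gt0 //; first apply.
  by move=> v; have := h (invmx C *m v); rewrite mulKVmx // ler_pdivlMl.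
by rewrite normr_gt0 -unitfE -unitmxE.
Qed.

Definition vol d r (Y : 'M[R]_(d, r)) : R := Num.sqrt (\det (Y^T *m Y)).

Lemma vol_ge0 d r (Y : 'M[R]_(d, r)) : 0 <= vol Y.
Proof. exact: sqrtr_ge0. Qed.

Lemma vol_qr d r (Z : 'M[R]_(d, r)) T : Z^T *m Z = 1%:M -> vol (Z *m T) = `|\det T|.
Proof.
move=> ZZ; rewrite /vol trmx_mul -mulmxA (mulmxA Z^T) ZZ mul1mx det_mulmx det_tr.
by rewrite -expr2 sqrtr_sqr.
Qed.

Lemma vol_orth d r (Z : 'M[R]_(d, r)) : Z^T *m Z = 1%:M -> vol Z = 1.
Proof. by move=> ZZ; rewrite -[Z]mulmx1 vol_qr // det1 normr1. Qed.

Lemma vol_mulr d r (Y : 'M[R]_(d, r)) T : (r <= d)%N -> vol (Y *m T) = vol Y * `|\det T|.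
Proof.
by move=> /(qr_decomp Y)[Z [T' [ZZ ->]]]; rewrite -mulmxA !vol_qr // det_mulmx normrM.
Qed.

Lemma gram_det_ge0 d r (Y : 'M[R]_(d, r)) : (r <= d)%N -> 0 <= \det (Y^T *m Y).
Proof.
move=> /(qr_decomp Y)[Z [T [ZZ ->]]].
by rewrite trmx_mul -mulmxA (mulmxA Z^T) ZZ mul1mx det_mulmx det_tr -expr2 sqr_ge0.
Qed.

Lemma vol_col d (y : 'cV[R]_d) : vol y = vnorm y.
Proof. by rewrite /vol sqr_vnorm_mx det_scalar1 sqrtr_sqr ger0_norm ?vnorm_ge0. Qed.

Lemma vol_le m d r (B : 'M[R]_(m, d)) (Y : 'M[R]_(d, r)) (b : R) :
  (r <= d)%N -> (r <= m)%N -> 0 <= b ->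
  (forall v, vnorm (B *m v) <= b * vnorm v) -> vol (B *m Y) <= b ^+ r * vol Y.
Proof.
move=> rd rm b0 h; have [Z [T [ZZ ->]]] := qr_decomp Y rd.
have [Z' [T' [ZZ' E]]] := qr_decomp (B *m Z) rm.
rewrite mulmxA E -mulmxA !vol_qr // det_mulmx normrM ler_wpM2r //.
apply: det_le_expr => // v.
have -> : T' = Z'^T *m (B *m Z) by rewrite E mulmxA ZZ' mul1mx.
rewrite -!mulmxA; apply: le_trans (vnorm_tr_le _ ZZ') _.
by apply: le_trans (h _) _; rewrite vnorm_orth.
Qed.

Lemma det_le_vol d r (F W : 'M[R]_(d, r)) : (r <= d)%N -> F^T *m F = 1%:M ->
  `|\det (F^T *m W)| <= vol W.
Proof.
move=> rd FF; have [Z [T [ZZ ->]]] := qr_decomp W rd.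
rewrite mulmxA det_mulmx normrM vol_qr // ler_piMl //.
apply: det_contraction => v; rewrite -mulmxA.
by apply: le_trans (vnorm_tr_le _ FF) _; rewrite vnorm_orth.
Qed.

Lemma vol_orthcat d a b (Y1 : 'M[R]_(d, a)) (Y2 : 'M[R]_(d, b)) :
  (a <= d)%N -> Y1^T *m Y2 = 0 -> vol (row_mx Y1 Y2) = vol Y1 * vol Y2.
Proof.
move=> ad h; rewrite /vol tr_row_mx mul_col_row h det_lblock sqrtrM //.
exact: gram_det_ge0.
Qed.

Lemma vol_fischer d a b (Y1 : 'M[R]_(d, a)) (Y2 : 'M[R]_(d, b)) :
  (a + b <= d)%N -> vol (row_mx Y1 Y2) <= vol Y1 * vol Y2.
Proof.
move=> abd; have ad := leq_trans (leq_addr _ _) abd; have bd := leq_trans (leq_addl _ _) abd.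
have [Z [T [ZZ ->]]] := qr_decomp Y2 bd.
pose W := Y1 - Z *m (Z^T *m Y1).
have -> : row_mx Y1 (Z *m T) = row_mx W Z *m block_mx 1%:M 0 (Z^T *m Y1) T.
  by rewrite mul_row_block !mulmx1 mulmx0 add0r /W subrK.
rewrite vol_mulr // det_lblock det1 mul1r.
have WZ : W^T *m Z = 0.
  by rewrite -[LHS]trmxK trmx_mul trmxK mulmxBr !mulmxA ZZ mul1mx subrr trmx0.
rewrite vol_orthcat // (vol_orth ZZ) mulr1 vol_qr // ler_wpM2r //.
have -> : W = (1%:M - Z *m Z^T) *m Y1 by rewrite mulmxBl mul1mx -mulmxA.
have := @vol_le _ _ _ (1%:M - Z *m Z^T) Y1 1 ad ad ler01.
rewrite expr1n mul1r; apply => v; rewrite mulmxBl mul1mx mul1r -mulmxA.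
exact: vnorm_cotr_le.
Qed.

(* [U] vanishes on the columns of [Y], so it only sees the component of [X] transverse to them. *)
Lemma vol_transverse d a b (U : 'M[R]_(a, d)) (X : 'M[R]_(d, a)) (Y : 'M[R]_(d, b)) :
  (a + b <= d)%N -> U *m U^T = 1%:M -> U *m Y = 0 ->
  `|\det (U *m X)| * vol Y <= vol (row_mx X Y).
Proof.
move=> abd UU UY; have bd := leq_trans (leq_addl _ _) abd.
have [Z [T [ZZ YE]]] := qr_decomp Y bd; rewrite YE in UY *.
rewrite (vol_qr _ ZZ).
have [->|T0] := eqVneq (\det T) 0; first by rewrite normr0 mulr0 vol_ge0.
have uT : T \in unitmx by rewrite unitmxE unitfE.
have UZ : U *m Z = 0 by rewrite -(mulmxK uT (U *m Z)) -(mulmxA U) UY mul0mx.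
have := @det_le_vol _ _ (row_mx U^T Z) (row_mx X (Z *m T)) abd.
rewrite !tr_row_mx !trmxK !mul_col_row UU UZ ZZ mulmxA UZ mul0mx mulmxA ZZ mul1mx.
rewrite -[Z^T *m U^T]trmxK trmx_mul !trmxK UZ trmx0 det_lblock normrM; apply.
by rewrite -scalar_mx_block.
Qed.

Lemma orth_cat_unit k (y : 'cV[R]_k.+1) : vnorm y = 1 ->
  exists2 N : 'M[R]_(k.+1, k), N^T *m N = 1%:M & `|\det (row_mx y N : 'M[R]_(1 + k))| = 1.
Proof.
move=> y1; have yy : y^T *m y = 1%:M by rewrite sqr_vnorm_mx y1 expr1n.
have [N [NN yN Ny _]] := @orth_compl R 1 k y yy.
exists N => //; set O := row_mx _ _.
have OO : O^T *m O = 1%:M.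
  by rewrite tr_row_mx mul_col_row yy yN Ny NN -scalar_mx_block.
have := congr1 (fun B => \det B) OO; rewrite det_mulmx det_tr det1 -expr2 => h.
by apply/eqP; rewrite -(eqrXn2 (n := 2)) // expr1n real_normK ?num_real // h.
Qed.

Lemma vol_peel d k (Y : 'M[R]_(d, k.+1)) (y : 'cV[R]_k.+1) : (k < d)%N -> vnorm y = 1 ->
  exists2 N : 'M[R]_(k.+1, k), N^T *m N = 1%:M & vol Y <= vnorm (Y *m y) * vol (Y *m N).
Proof.
move=> kd /orth_cat_unit[N NN detO]; exists N => //.
rewrite -[vol Y]mulr1 -{1}detO -(vol_mulr (d := d) (r := 1 + k)) //.
rewrite mul_mx_row -vol_col; exact: vol_fischer.
Qed.

Lemma vol_min_stretch m k (B : 'M[R]_(m, k.+1)) (b : R) (y : 'cV[R]_k.+1) : (k < m)%N -> 0 <= b ->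
  (forall v, vnorm (B *m v) <= b * vnorm v) -> vnorm y = 1 -> vol B <= vnorm (B *m y) * b ^+ k.
Proof.
move=> km b0 h y1; have [N NN hN] := vol_peel B km y1.
apply: (le_trans hN); rewrite ler_wpM2l ?vnorm_ge0 //.
have := vol_le (b := b) N (leqnSn k) (ltnW km) b0 h.
by rewrite (vol_orth NN) mulr1.
Qed.

Lemma vol_min_stretch_scale m j (B : 'M[R]_(m, j)) (b : R) (w : 'cV[R]_j) : (j <= m)%N -> 0 <= b ->
  (forall v, vnorm (B *m v) <= b * vnorm v) -> vol B * b * vnorm w <= vnorm (B *m w) * b ^+ j.
Proof.
move=> jm b0 h; have [->|w0] := eqVneq w 0; first by rewrite mulmx0 !vnorm0 mulr0 mul0r.
case: j B w w0 jm h => [|j] B w w0 jm h; first by case/negP: w0; apply/eqP; exact: flatmx0.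
have wp := vnorm_gt0 w0.
have := vol_min_stretch (y := (vnorm w)^-1 *: w) jm b0 h.
rewrite -scalemxAr !vnormZ ger0_norm ?invr_ge0 ?vnorm_ge0 // mulVf ?gt_eqF // => /(_ erefl).
move=> /(ler_wpM2r (mulr_ge0 b0 (ltW wp))); rewrite mulrA => /le_trans; apply.
by rewrite exprSr le_eqVlt; apply/orP; left; apply/eqP; field; rewrite gt_eqF.
Qed.

Definition Nvol r m d (B : 'M[R]_(m, d)) : R :=
  sup [set vol (B *m X) | X in [set X : 'M[R]_(d, r) | X^T *m X = 1%:M]].

Section Nvol.
Variables (r d : nat).
Hypothesis rd : (r <= d)%N.
Implicit Types (A B : 'M[R]_d) (X : 'M[R]_(d, r)).

Lemma orth_exists : exists X : 'M[R]_(d, r), X^T *m X = 1%:M.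
Proof. by have [X XX _] := @ker_orth R 0 d 0 r rd; exists X. Qed.

Lemma has_sup_Nvol B : has_sup [set vol (B *m X) | X in [set X : 'M[R]_(d, r) | X^T *m X = 1%:M]].
Proof.
split; first by have [X XX] := orth_exists; exists (vol (B *m X)), X.
exists (mxn B ^+ r) => _ [X XX <-].
have := vol_le X rd rd (mxn_ge0 B) (vnorm_mxn B).
by rewrite (vol_orth XX) mulr1.
Qed.

Lemma vol_le_Nvol B X : X^T *m X = 1%:M -> vol (B *m X) <= Nvol r B.
Proof. by move=> XX; apply: sup_upper_bound (has_sup_Nvol B) _ _; exists X. Qed.

Lemma Nvol_ge0 B : 0 <= Nvol r B.
Proof.
have [X XX] := orth_exists.
exact: le_trans (vol_ge0 _) (vol_le_Nvol B XX).
Qed.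

Lemma vol_mul_le_Nvol B X : vol (B *m X) <= Nvol r B * vol X.
Proof.
have [Z [T [ZZ ->]]] := qr_decomp X rd.
by rewrite mulmxA vol_mulr // vol_qr // ler_wpM2r // vol_le_Nvol.
Qed.

Lemma Nvol_le B c : (forall X : 'M[R]_(d, r), X^T *m X = 1%:M -> vol (B *m X) <= c) -> Nvol r B <= c.
Proof.
move=> h; apply: ge_sup; first by have [] := has_sup_Nvol B.
by move=> _ [X XX <-]; exact: h.
Qed.

Lemma Nvol_adherent B c : c < Nvol r B -> exists2 X : 'M[R]_(d, r), X^T *m X = 1%:M & c < vol (B *m X).
Proof.
move=> h; have e0 : 0 < Nvol r B - c by rewrite subr_gt0.
have [_ [X XX <-]] := sup_adherent e0 (has_sup_Nvol B).
by rewrite subKr; exists X.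
Qed.

Lemma Nvol_mul A B : Nvol r (A *m B) <= Nvol r A * Nvol r B.
Proof.
apply: Nvol_le => X XX; rewrite -mulmxA; apply: (le_trans (vol_mul_le_Nvol _ _)).
by rewrite ler_wpM2l ?Nvol_ge0 // vol_le_Nvol.
Qed.

Lemma Nvol1 : Nvol r (1%:M : 'M[R]_d) <= 1.
Proof. by apply: Nvol_le => X XX; rewrite mul1mx vol_orth. Qed.

Lemma Nvol_expr B b : 0 <= b -> (forall v, vnorm (B *m v) <= b * vnorm v) -> Nvol r B <= b ^+ r.
Proof.
move=> b0 h; apply: Nvol_le => X XX.
by have := vol_le X rd rd b0 h; rewrite (vol_orth XX) mulr1.
Qed.

End Nvol.

Lemma Nvol0 d (B : 'M[R]_d) : Nvol 0 B = 1.
Proof.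
have v1 (X : 'M[R]_(d, 0)) : vol (B *m X) = 1 by rewrite /vol det_mx00 sqrtr1.
apply/eqP; rewrite eq_le; apply/andP; split; first by apply: Nvol_le => // X _; rewrite v1.
have [X XX] := orth_exists (leq0n d).
by rewrite -(v1 X); exact: vol_le_Nvol.
Qed.

(* Only a bound on the kernel of [i] linear forms is needed for the [i]-th factor:
   an [r.+1]-dimensional space always meets the kernel of [r] forms. *)
Lemma Nvol_flag d r (B : 'M[R]_d) (c : nat -> R) : (r <= d)%N ->
  (forall i, (i < r)%N -> 0 <= c i /\
    exists U : 'M[R]_(i, d), forall b, U *m b = 0 -> vnorm (B *m b) <= c i * vnorm b) ->
  Nvol r B <= \prod_(i < r) c i.
Proof.
elim: r => [|r IH] rd h; first by rewrite Nvol0 big_ord0.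
apply: Nvol_le => // X XX; rewrite big_ord_recr /= mulrC.
have [c0 [U hU]] := h r (ltnSn r).
have [y y1 Uy] := @ker_unit _ _ _ (U *m X) (ltnSn r).
have [N NN hN] := vol_peel (B *m X) rd y1.
apply: (le_trans hN); apply: ler_pM; rewrite ?vnorm_ge0 ?vol_ge0 //.
  rewrite -mulmxA; have := hU (X *m y); rewrite mulmxA => /(_ Uy).
  by rewrite (vnorm_orth _ XX) y1 mulr1.
rewrite -mulmxA; apply: le_trans (IH (ltnW rd) _) => [|i ir]; last exact: h (leqW ir).
apply: vol_le_Nvol; first exact: ltnW.
by rewrite trmx_mul -mulmxA (mulmxA X^T) XX mul1mx.
Qed.

Lemma vol_le_stretch_Nvol d k (B : 'M[R]_d) (Z : 'M[R]_(d, k.+1)) (y : 'cV[R]_k.+1) :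
  (k < d)%N -> Z^T *m Z = 1%:M -> vnorm y = 1 ->
  vol (B *m Z) <= vnorm (B *m Z *m y) * Nvol k B.
Proof.
move=> kd ZZ y1; have [N NN hN] := vol_peel (B *m Z) kd y1.
apply: (le_trans hN); rewrite ler_wpM2l ?vnorm_ge0 // -mulmxA.
apply: vol_le_Nvol; first exact: ltnW.
by rewrite trmx_mul -mulmxA (mulmxA Z^T) ZZ mul1mx.
Qed.

Lemma vol_restrict_kernel d a b (U : 'M[R]_(a, d)) (B : 'M[R]_d) (X : 'M[R]_(d, b + a)) :
  (b + a <= d)%N -> X^T *m X = 1%:M ->
  exists Z : 'M[R]_(d, b),
    [/\ Z^T *m Z = 1%:M, U *m Z = 0 & vol (B *m X) <= vol (B *m Z) * Nvol a B].
Proof.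
move=> bad XX.
have [Y YY UY] := @ker_orth _ _ _ (U *m X) b (eq_leq (addnC a b)).
have [N [NN YN NY _]] := orth_compl YY.
exists (X *m Y); split; first by rewrite trmx_mul -mulmxA (mulmxA X^T) XX mul1mx.
  by rewrite mulmxA.
have OO : (row_mx Y N)^T *m row_mx Y N = 1%:M.
  by rewrite tr_row_mx mul_col_row YY YN NY NN -scalar_mx_block.
have detO : `|\det (row_mx Y N)| = 1.
  have := congr1 (fun B => \det B) OO; rewrite det_mulmx det_tr det1 -expr2 => h.
  by apply/eqP; rewrite -(eqrXn2 (n := 2)) // expr1n real_normK ?num_real // h.
rewrite -[vol (B *m X)]mulr1 -detO -vol_mulr // mul_mx_row.
apply: (le_trans (vol_fischer _ _ bad)); rewrite -!mulmxA ler_wpM2l ?vol_ge0 //.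
apply: vol_le_Nvol; first exact: leq_trans (leq_addl _ _) bad.
by rewrite trmx_mul -mulmxA (mulmxA X^T) XX mul1mx.
Qed.

End Volume.

(** * Recurrence and the maximal inequality *)

Section Covering.
Variable R : realType.

(* Greedy selection of disjoint blocks, from left to right. *)
Lemma covering_count (b e : nat -> bool) (eta : R) (L : nat) : 0 <= eta ->
  (forall i, e i -> exists n, [/\ (0 < n)%N, (n <= L)%N &
     eta * n%:R <= (\sum_(i <= u < i + n) b u)%:R]) ->
  forall T i, eta * (\sum_(i <= u < i + T) e u)%:R <= (\sum_(i <= u < i + T + L) b u)%:R.
Proof.
move=> eta0 h T; elim/ltn_ind: T => -[|T] IH i.
  by rewrite addn0 big_geq // mulr0.
case ei: (e i); last first.
  rewrite -addSnnS big_ltn ?ltn_addr // ei add0n.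
  apply: (le_trans (IH T (ltnSn T) i.+1)); rewrite ler_nat.
  by rewrite [X in (_ <= X)%N]big_ltn ?leq_addl // ?ltn_addr // !addSn ltnS -addnA leq_addr.
have [n [n0 nL hn]] := h i ei.
have le1 m k : (\sum_(m <= u < m + k) e u <= k)%N.
  by rewrite -[X in (_ <= X)%N](addKn m) -[X in (_ <= X)%N]muln1 -sum_nat_const_nat leq_sum // => u _; case: (e u).
have [nT|Tn] := leqP n T.+1; last first.
  apply: (@le_trans _ _ (eta * n%:R)).
    by rewrite ler_wpM2l // ler_nat (leq_trans (le1 _ _)) // ltnW.
  apply: (le_trans hn); rewrite ler_nat -addnA (@big_cat_nat _ _ _ (i + n)%N i (i + (T.+1 + L))%N) ?leq_addr //=.
  by rewrite leq_add2l (leq_trans nL) // leq_addl.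
have h1 := IH (T.+1 - n)%N _ (i + n)%N.
rewrite -addnA subnKC // in h1.
rewrite (@big_cat_nat _ _ _ (i + n)%N) ?leq_addr ?leq_add2l //= natrD mulrDr.
have -> : (\sum_(i <= u < i + T.+1 + L) b u = \sum_(i <= u < i + n) b u
    + \sum_(i + n <= u < i + T.+1 + L) b u)%N.
  by rewrite -big_cat_nat //; lia.
rewrite natrD.
apply: lerD; last by apply: h1; rewrite ltn_subrL n0.
by apply: le_trans hn; rewrite ler_wpM2l // ler_nat.
Qed.

End Covering.

Section Ergodic.
Context {disp : measure_display} {T : measurableType disp} {R : realType}.
Variables (mu : {measure set T -> \bar R}) (f : T -> T).
Hypothesis mu1 : mu setT = 1%E.
Hypothesis mf : forall S, measurable S -> measurable (f @^-1` S).
Hypothesis fmu : forall S, measurable S -> mu (f @^-1` S) = mu S.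

Lemma preimage_iterS n (S : set T) : iter n.+1 f @^-1` S = f @^-1` (iter n f @^-1` S).
Proof. by apply/seteqP; split => x /=; rewrite -iterS iterSr. Qed.

Lemma measurable_preimage_iter n S : measurable S -> measurable (iter n f @^-1` S).
Proof. by move=> mS; elim: n => [//|n IH]; rewrite preimage_iterS; exact: mf. Qed.

Lemma measure_preimage_iter n S : measurable S -> mu (iter n f @^-1` S) = mu S.
Proof.
move=> mS; elim: n => [//|n IH].
by rewrite preimage_iterS fmu //; exact: measurable_preimage_iter.
Qed.

Lemma mu_fin (S : set T) : measurable S -> mu S \is a fin_num.
Proof.
move=> mS; rewrite ge0_fin_numE //; apply: (@le_lt_trans _ _ (mu setT)); last by rewrite mu1 ltry.
by apply: le_measure; rewrite ?inE.
Qed.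

Lemma ae_iter (P : T -> Prop) : {ae mu, forall x, P x} ->
  {ae mu, forall x, forall n, P (iter n f x)}.
Proof.
move=> [S [mS S0 PS]].
apply/ae_foralln => n; exists (iter n f @^-1` S); split.
- exact: measurable_preimage_iter.
- exact: etrans (measure_preimage_iter n mS) S0.
- by move=> x /= h; exact: PS.
Qed.

Theorem poincare_recurrence S : measurable S ->
  {ae mu, forall x, S x -> forall N, exists2 n, (N <= n)%N & S (iter n f x)}.
Proof.
move=> mS.
pose Y N := \bigcup_(n in [set n | (N <= n)%N]) (iter n f @^-1` S).
have mY N : measurable (Y N).
  by apply: bigcup_measurable => n _; exact: measurable_preimage_iter.
have fY N : f @^-1` Y N = Y N.+1.
  apply/seteqP; split => x [n /= nN Sn].
    by exists n.+1 => //; rewrite /= -iterS iterSr.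
  by case: n nN Sn => // n nN; rewrite /= -iterS iterSr => Sn; exists n.
have Ysub N : Y N `<=` Y 0%N by move=> x [n _ Sn]; exists n.
have muY N : mu (Y N) = mu (Y 0%N) by elim: N => // N <-; rewrite -fY fmu.
have D0 N : mu (Y 0%N `\` Y N) = 0%E.
  rewrite measureD // ?setIidr //; last by rewrite -ge0_fin_numE // mu_fin.
  transitivity (mu (Y 0%N) - mu (Y 0%N))%E; first by congr (_ - _)%E; exact: muY.
  exact: subee (mu_fin (mY 0%N)).
have : {ae mu, forall x, forall N, ~ (Y 0%N `\` Y N) x}.
  apply/ae_foralln => N; exists (Y 0%N `\` Y N); split => //; first exact: measurableD.
  by move=> x /= /contrapT.
apply: filterS => x h Sx N.
have [n /= nN Sn] : Y N x by apply: contrapT => hN; apply: (h N); split => //; exists 0%N.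
by exists n.
Qed.

Definition visits (B : set T) n x : nat := (\sum_(0 <= i < n) (iter i f x \in B))%N.

Lemma visits_shift (B : set T) n i x :
  visits B n (iter i f x) = (\sum_(i <= u < i + n) (iter u f x \in B))%N.
Proof.
rewrite /visits -{2}(add0n i) -(addnC n) big_addn addnK.
by apply: eq_bigr => u _; rewrite -iterD.
Qed.

Definition often (B : set T) (eta : R) L : set T :=
  [set x | exists n, [/\ (0 < n)%N, (n <= L)%N & eta * n%:R <= (visits B n x)%:R]].

Lemma measurable_visits B n (c : R) : measurable B ->
  measurable [set x | c <= (visits B n x)%:R].
Proof.
move=> mB.
have mv : measurable_fun setT (fun x => (visits B n x)%:R : R).
  have -> : (fun x => (visits B n x)%:R : R) =
      (fun x => \sum_(0 <= i < n) \1_(iter i f @^-1` B) x).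
    by apply/funext => x; rewrite /visits natr_sum; apply: eq_bigr => i _; rewrite indicE.
  by apply: measurable_sum => i; apply: measurable_indic; exact: measurable_preimage_iter.
have -> : [set x | c <= (visits B n x)%:R] = setT `&` (fun x => (visits B n x)%:R) @^-1` `[c, +oo[.
  by rewrite setTI; apply/seteqP; split => x /=; rewrite in_itv /= andbT.
by apply: mv => //; exact: measurable_itv.
Qed.

Lemma measurable_often B eta L : measurable B -> measurable (often B eta L).
Proof.
move=> mB; have -> : often B eta L = \bigcup_(n in [set n | (0 < n)%N /\ (n <= L)%N])
    [set x | eta * n%:R <= (visits B n x)%:R].
  by apply/seteqP; split => x; [move=> [n [n0 nL h]]; exists n | move=> [n [n0 nL] h]; exists n].
by apply: bigcup_measurable => n _; exact: measurable_visits.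
Qed.

Lemma integral_visits B n : measurable B ->
  (\int[mu]_x (visits B n x)%:R%:E = n%:R%:E * mu B)%E.
Proof.
move=> mB.
have -> : (fun x => (visits B n x)%:R%:E : \bar R) =
    (fun x => \sum_(0 <= i < n) (\1_(iter i f @^-1` B) x)%:E)%E.
  apply/funext => x; rewrite sumEFin; congr EFin; rewrite /visits natr_sum.
  by apply: eq_bigr => i _; rewrite indicE.
have mI i : measurable (iter i f @^-1` B) by exact: measurable_preimage_iter.
rewrite ge0_integral_sum //; last first.
  by move=> i; apply/measurable_EFinP; exact: measurable_indic.
under eq_bigr => i _ do rewrite integral_indic // setIT measure_preimage_iter //.
have -> : (\sum_(0 <= i < n) mu B = \sum_(0 <= i < n) (fine (mu B))%:E)%E.
  by under [RHS]eq_bigr do rewrite fineK ?mu_fin //.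
rewrite sumEFin -[in RHS](fineK (mu_fin mB)) -EFinM; congr EFin.
by rewrite big_const_nat subn0 iter_addr addr0 mulr_natl.
Qed.

Theorem maximal_inequality B (eta : R) L : measurable B -> 0 < eta ->
  eta * fine (mu (often B eta L)) <= fine (mu B).
Proof.
move=> mB eta0; set E := often _ _ _; have mE : measurable E by exact: measurable_often.
have key N x : eta * (visits E N x)%:R <= (visits B (N + L) x)%:R.
  have := @covering_count R (fun u => iter u f x \in B) (fun u => iter u f x \in E) eta L (ltW eta0) _ N 0%N.
  rewrite !add0n; apply => i; rewrite inE => -[n [n0 nL hn]]; exists n; split => //.
  by move: hn; rewrite visits_shift.
have ineq N : eta * (N%:R * fine (mu E)) <= (N + L)%:R * fine (mu B).
  rewrite -lee_fin EFinM [(N%:R * _)%:E]EFinM [((N+L)%:R * _)%:E]EFinM.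
  rewrite !fineK ?mu_fin // -!integral_visits //.
  have mv S n : measurable S -> measurable_fun setT (fun x => (visits S n x)%:R%:E : \bar R).
    move=> mS; apply/measurable_EFinP.
    have -> : (fun x => (visits S n x)%:R : R) =
        (fun x => \sum_(0 <= i < n) \1_(iter i f @^-1` S) x).
      by apply/funext => x; rewrite /visits natr_sum; apply: eq_bigr => i _; rewrite indicE.
    by apply: measurable_sum => i; apply: measurable_indic; exact: measurable_preimage_iter.
  rewrite -ge0_integralZl_EFin //; [|exact: mv|exact: ltW].
  apply: ge0_le_integral => //.
  - by move=> x _; rewrite -EFinM lee_fin mulr_ge0 // ltW.
  - by apply: measurable_funeM; exact: mv.
  - exact: mv.
  - by move=> x _; rewrite -EFinM lee_fin.
set a := fine (mu E) in ineq *; set b := fine (mu B) in ineq *.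
have b0 : 0 <= b by exact: fine_ge0.
rewrite leNgt; apply/negP => ba.
have c0 : 0 < eta * a - b by rewrite subr_gt0.
have := archi_boundP (divr_ge0 (mulr_ge0 (ler0n R L) b0) (ltW c0)).
set N := Num.bound _; rewrite ltr_pdivrMr // => hN.
by have := ineq N; rewrite natrD; nra.
Qed.

Lemma ae_rarely (B : nat -> set T) (eta : R) : 0 < eta ->
  (forall q, measurable (B q)) -> (forall q, B q.+1 `<=` B q) ->
  {ae mu, forall x, exists q, ~ B q x} ->
  {ae mu, forall x, exists q, forall n, (0 < n)%N -> (visits (B q) n x)%:R < eta * n%:R}.
Proof.
move=> eta0 mB dB hB.
pose E q := \bigcup_L often (B q) eta L.
have mE q : measurable (E q) by apply: bigcup_measurable => L _; exact: measurable_often.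
have muB0 : mu (\bigcap_q B q) = 0%E.
  have [S [mS S0 hS]] := hB; apply/eqP; rewrite -measure_le0 -S0.
  apply: le_measure; rewrite ?inE //; first exact: bigcap_measurable.
  by move=> x h; apply: hS => -[q]; apply; exact: h.
have muE q : (mu (E q) <= (eta^-1 * fine (mu (B q)))%:E)%E.
  have cv : mu \o (fun L => often (B q) eta L) @ \oo --> mu (E q).
    apply: nondecreasing_cvg_mu => [L||].
    - exact: measurable_often.
    - exact: mE.
    - move=> L1 L2 L12; apply/subsetPset => x [n [n0 nL h]]; exists n; split => //.
      exact: leq_trans nL L12.
  apply: (cvge_le _ cv); apply: nearW => L; rewrite /= -(fineK (mu_fin (measurable_often eta L (mB q)))) lee_fin.
  by rewrite -ler_pdivrMl ?invr_gt0 // invrK maximal_inequality.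
have cvB : mu \o B @ \oo --> mu (\bigcap_q B q).
  apply: nonincreasing_cvg_mu => //; first by rewrite -ge0_fin_numE // mu_fin.
    exact: bigcap_measurable.
  move=> m n mn; apply/subsetPset; elim: n mn => [|n IH]; first by rewrite leqn0 => /eqP ->.
  rewrite leq_eqVlt => /predU1P[-> //|]; rewrite ltnS => /IH; exact: subset_trans.
exists (\bigcap_q E q); split; first exact: bigcap_measurable.
  apply/eqP; rewrite -measure_le0; apply/lee_addgt0Pr => e e0; rewrite add0e.
  have : \forall q \near \oo, (mu (B q) < (e * eta)%:E)%E.
    rewrite muB0 in cvB; apply: (cvB [set y | (y < (e * eta)%:E)%E]).
    apply: open_nbhs_nbhs; split; first exact: open_ereal_lt_ereal.
    by rewrite /= lte_fin mulr_gt0.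
  move=> [q _ /(_ q (leqnn q)) hq].
  apply: (@le_trans _ _ (mu (E q))).
    by apply: le_measure; rewrite ?inE //; [exact: bigcap_measurable | exact: bigcap_inf].
  apply: (le_trans (muE q)); rewrite lee_fin ler_pdivrMl // mulrC.
  by rewrite -lee_fin fineK ?mu_fin // ltW.
move=> x /= h q _; apply: contrapT => hq; apply: h; exists q => n n0.
rewrite ltNge; apply/negP => hn; apply: hq; exists n => //; exists n; split => //.
Qed.

End Ergodic.

(** * Subadditive sequences over an ergodic map *)

Section Subadditive.
Context {disp : measure_display} {T : measurableType disp} {R : realType}.
Variables (mu : {measure set T -> \bar R}) (f : T -> T).
Hypothesis mu1 : mu setT = 1%E.
Hypothesis mf : forall S, measurable S -> measurable (f @^-1` S).
Hypothesis fmu : forall S, measurable S -> mu (f @^-1` S) = mu S.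

Variables (g : nat -> T -> R) (C : R).
Hypothesis g_ge0 : forall n x, 0 <= g n x.
Hypothesis g0_le1 : forall x, g 0 x <= 1.
Hypothesis g1_le : forall x, g 1 x <= C.
Hypothesis gD : forall n m x, g (n + m) x <= g m (iter n f x) * g n x.

Lemma visitsD (B : set T) n m x :
  visits f B (n + m) x = (visits f B n x + visits f B m (iter n f x))%N.
Proof.
rewrite visits_shift /visits (big_cat_nat (n := n)) ?leq_addr //=.
Qed.

(* Outside [B] the orbit advances by a good block of length at most [q]; inside [B] by a single step,
   at the price of a factor [C]. *)
Lemma katznelson_weiss_chain (B : set T) (c D : R) q : C <= expR c * D -> 1 <= D ->
  (forall x, ~ B x -> exists n, [/\ (0 < n)%N, (n <= q)%N & g n x <= expR (c * n%:R)]) ->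
  forall n x, g n x <= expR (c * n%:R) * D ^+ (visits f B n x + q).
Proof.
move=> CD D1 hB n; have D0 : 0 < D by apply: lt_le_trans D1.
pose C1 := expR c * D; have g1 x : g 1 x <= C1 by apply: le_trans CD.
have gpow n' x : g n' x <= C1 ^+ n'.
  elim: n' x => [|k IH] x; first by rewrite expr0.
  by rewrite -addn1; apply: (le_trans (gD _ _ _)); rewrite addn1 exprS; exact: ler_pM.
elim/ltn_ind: n => n IH x.
case: n IH => [|n] IH.
  rewrite mulr0 expR0 mul1r /visits big_geq // add0n (le_trans (g0_le1 x)) //.
  exact: exprn_ege1.
have [Bx|nBx] := pselect (B x).
  rewrite -add1n; apply: (le_trans (gD 1 n x)); rewrite mulrC.
  have -> : visits f B (1 + n) x = (1 + visits f B n (iter 1 f x))%N.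
    by rewrite visitsD {1}/visits big_nat1 /= mem_set.
  have -> : expR (c * (1 + n)%:R) * D ^+ (1 + visits f B n (iter 1 f x) + q) =
      C1 * (expR (c * n%:R) * D ^+ (visits f B n (iter 1 f x) + q)).
    by rewrite natrD mulrDr mulr1 expRD -addnA exprD expr1 /C1; ring.
  by apply: ler_pM => //; exact: IH.
have [m [m0 mq hm]] := hB x nBx.
have [mn|nm] := leqP m n.+1; last first.
  apply: (le_trans (gpow _ _)); rewrite /C1 exprMn [in c * _]mulrC expRM_natl.
  rewrite ler_wpM2l ?exprn_ge0 ?expR_ge0 //; apply: ler_weXn2l => //.
  by rewrite (leq_trans _ (leq_addl _ _)) // (leq_trans _ mq) // ltnW.
rewrite -(subnKC mn); apply: (le_trans (gD _ _ _)); rewrite mulrC visitsD.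
apply: (@le_trans _ _ (expR (c * m%:R) * (expR (c * (n.+1 - m)%:R) *
    D ^+ (visits f B (n.+1 - m) (iter m f x) + q)))).
  by apply: ler_pM => //; apply: IH; rewrite ltn_subrL m0.
rewrite mulrA -expRD -mulrDr -natrD ler_wpM2l ?expR_ge0 //.
by apply: ler_weXn2l => //; rewrite leq_add2r leq_addl.
Qed.

Hypothesis mg : forall n c, measurable [set x | g n x <= c].

Lemma subadditive_ae_upper (c c' : R) : c < c' ->
  {ae mu, forall x, exists2 n, (0 < n)%N & g n x <= expR (c * n%:R)} ->
  {ae mu, forall x, exists K, forall n, g n x <= K * expR (c' * n%:R)}.
Proof.
move=> cc' hZ.
pose D := Num.max C (expR c) * expR (- c).
have CD : C <= expR c * D by rewrite /D mulrCA -expRD subrr expR0 mulr1 le_max lexx.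
have D1 : 1 <= D.
  have -> : 1 = expR c * expR (- c) :> R by rewrite -expRD subrr expR0.
  by rewrite ler_wpM2r ?expR_ge0 // le_max lexx orbT.
have D0 : 0 < D by apply: lt_le_trans D1.
have lnD : 0 <= ln D by rewrite ln_ge0.
pose eta := (c' - c) / (ln D + 1).
have eta0 : 0 < eta by rewrite divr_gt0 ?subr_gt0 // ltr_wpDl.
have heta : ln D * eta <= c' - c.
  rewrite /eta mulrCA ler_piMr ?subr_ge0 ?(ltW cc') //.
  by rewrite ler_pdivrMr ?ltr_wpDl // mul1r lerDl.
pose B q := [set x | forall n, (0 < n)%N -> (n <= q)%N -> ~ (g n x <= expR (c * n%:R))].
have mB q : measurable (B q).
  have -> : B q = ~` \bigcup_(n in [set n | (0 < n)%N /\ (n <= q)%N]) [set x | g n x <= expR (c * n%:R)].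
    apply/seteqP; split => x.
      by move=> Bx [n /= [n0 nq]]; exact: Bx.
    by move=> h n n0 nq gn; apply: h; exists n.
  by apply: measurableC; apply: bigcup_measurable => n _; exact: mg.
have dB q : B q.+1 `<=` B q by move=> x Bx n n0 nq; apply: Bx => //; exact: leqW.
have aeB : {ae mu, forall x, exists q, ~ B q x}.
  by apply: filterS hZ => x [n n0 gn]; exists n => Bx; exact: (Bx n n0 (leqnn n)).
have := ae_rarely mu1 mf fmu eta0 mB dB aeB.
apply: filterS => x [q hq]; exists (D ^+ q) => n.
have hB y : ~ B q y -> exists n, [/\ (0 < n)%N, (n <= q)%N & g n y <= expR (c * n%:R)].
  by move=> h; apply: contrapT => h'; apply: h => m m0 mq gm; apply: h'; exists m.
have chain := katznelson_weiss_chain CD D1 hB n x.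
apply: (le_trans chain); rewrite exprD mulrA [D ^+ q * _]mulrC ler_wpM2r ?exprn_ge0 ?(ltW D0) //.
rewrite -[D ^+ visits _ _ _ _]lnK ?posrE ?exprn_gt0 // -expRD ler_expR lnXn //.
have hv : (visits f (B q) n x)%:R <= eta * n%:R.
  by case: n {chain} => [|n]; [rewrite /visits big_geq // mulr0 | apply: ltW; exact: hq].
rewrite -mulr_natr; have h1 : ln D * (visits f (B q) n x)%:R <= ln D * (eta * n%:R) by rewrite ler_wpM2l.
have h2 : (ln D * eta) * n%:R <= (c' - c) * n%:R by rewrite ler_wpM2r.
by rewrite mulrA in h1; rewrite mulrBl in h2; lra.
Qed.

Hypothesis ergodic : forall S, measurable S -> f @^-1` S = S -> mu S = 0%E \/ mu S = 1%E.

Lemma ergodic_ae_visit (S : set T) : measurable S -> mu S <> 0%E ->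
  {ae mu, forall x, exists n, S (iter n f x)}.
Proof.
move=> mS S0.
pose Y N := \bigcup_(n in [set n | (N <= n)%N]) (iter n f @^-1` S).
have mY N : measurable (Y N).
  by apply: bigcup_measurable => n _; exact: measurable_preimage_iter.
pose Z := \bigcap_N Y N.
have mZ : measurable Z by exact: bigcap_measurable.
have fZ : f @^-1` Z = Z.
  apply/seteqP; split => x h N _.
    by have [n /= nN Sn] := h N I; exists n.+1; [exact: leqW | rewrite /= -iterS iterSr].
  by have [[//|n] /= nN Sn] := h N.+1 I; exists n => //; rewrite /= -iterSr iterS.
have SZ : mu S = mu (S `&` Z).
  have [E [mE E0 hE]] := poincare_recurrence mu1 mf fmu mS.
  have hS : S `<=` (S `&` Z) `|` E.
    move=> x Sx; have [Ex|nEx] := pselect (E x); [by right | left; split => // N _].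
    apply: contrapT => h; apply: nEx; apply: hE => /(_ Sx N)[n nN Sn].
    by apply: h; exists n.
  apply/eqP; rewrite eq_le; apply/andP; split; last first.
    by apply: le_measure; rewrite ?inE //; exact: measurableI.
  apply: (@le_trans _ _ (mu ((S `&` Z) `|` E))).
    by apply: le_measure; rewrite ?inE //; apply: measurableU => //; exact: measurableI.
  apply: (le_trans (@measureU2 _ _ _ mu _ _ (measurableI _ _ mS mZ) mE)).
  by rewrite [X in (_ + X)%E](_ : _ = 0%E) ?adde0.
have [Z0|Z1] := ergodic mZ fZ.
  have : (mu S <= mu Z)%E.
    by rewrite SZ; apply: le_measure; rewrite ?inE //; exact: measurableI.
  by rewrite Z0 => h; exfalso; apply: S0; apply/eqP; rewrite eq_le h measure_ge0.
exists (~` Z); split; first exact: measurableC.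
  have h : (mu setT = mu Z + mu (~` Z))%E.
    by rewrite -(setUCr Z); exact: measureU mZ (measurableC mZ) (setICr Z).
  have key (a : \bar R) : (1 = 1 + a)%E -> a \is a fin_num -> a = 0%E.
    by case: a => [r| |] // /eqP; rewrite -EFinD eqe => /eqP e _; congr EFin; lra.
  by apply: key (mu_fin mu1 (measurableC mZ)); rewrite -{1}mu1 h Z1.
by move=> x /= h Zx; apply: h; have [n _ Sn] := Zx 0%N I; exists n.
Qed.

Theorem subadditive_dichotomy (c c' : R) : c < c' ->
  {ae mu, forall x, exists K, forall n, g n x <= K * expR (c' * n%:R)} \/
  {ae mu, forall x, exists N, forall n, (N <= n)%N -> expR (c * n%:R) < g n x}.
Proof.
move=> cc'.
pose Z := \bigcap_N \bigcup_(n in [set n | (N <= n)%N]) [set x | g n x <= expR (c * n%:R)].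
have mZ : measurable Z.
  by apply: bigcapT_measurable => N; apply: bigcup_measurable => n _; exact: mg.
have [Z0|Z0] := pselect (mu Z = 0%E); [right|left].
  exists Z; split => // x /= h N _; apply: contrapT => hN; apply: h; exists N => n nN.
  by rewrite ltNge; apply/negP => gn; apply: hN; exists n.
pose c1 := (c + c') / 2; have [cc1 c1c'] : c < c1 /\ c1 < c' by rewrite /c1; lra.
apply: (@subadditive_ae_upper c1 c') => //.
apply: filterS (ergodic_ae_visit mZ Z0) => x [j hj].
pose P := g j x * expR (- c1 * j%:R).
have P0 : 0 <= P by rewrite mulr_ge0 ?expR_ge0.
have d0 : 0 < c1 - c by rewrite subr_gt0.
have := archi_boundP (divr_ge0 P0 (ltW d0)).
set N := Num.bound _ => hN.
have [n /= nN gn] := hj N.+1 I.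
exists (j + n)%N; first by rewrite addn_gt0 (leq_trans _ nN) ?orbT.
apply: (le_trans (gD _ _ _)).
have hP : P <= expR ((c1 - c) * n%:R).
  apply: (@le_trans _ _ ((c1 - c) * n%:R)); last by apply: le_trans (expR_ge1Dx _); rewrite lerDr.
  rewrite mulrC -ler_pdivrMr // (le_trans (ltW hN)) // ler_nat; exact: ltnW.
have -> : expR (c1 * (j + n)%:R) = expR (c * n%:R) * (expR ((c1 - c) * n%:R) * expR (c1 * j%:R)).
  by rewrite -!expRD natrD; congr expR; ring.
apply: ler_pM => //.
have -> : g j x = P * expR (c1 * j%:R) by rewrite /P -mulrA -expRD mulNr addNr expR0 mulr1.
by rewrite ler_wpM2r ?expR_ge0.
Qed.

End Subadditive.

(** * Limits of matrices and measurability *)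

Section EntrywiseConvergence.
Variable R : realType.

Lemma bounded_ultra_cvg (T : Type) (G : set_system T) (h : T -> R) (c : R) :
  UltraFilter G -> (forall t, `|h t| <= c) -> exists l : R, h @ G --> l.
Proof.
move=> GU hc; have GP := ultra_proper (UltraFilter := GU).
have hG : (h @ G) `[- c, c]%classic.
  by apply: (@filterE _ G) => t /=; rewrite in_itv /=; have := hc t; rewrite ler_norml.
have [l [_ cl]] := @segment_compact R (- c) c (h @ G) _ hG.
exists l => B Bl; have [//|hn] := in_ultra_setVsetC (h @^-1` B) GU.
have [y [yn yB]] := cl (~` B) B hn Bl; exact: (False_ind _ (yn yB)).
Qed.

Definition mxcvg (T : Type) (F : set_system T) m n (X : T -> 'M[R]_(m, n)) (L : 'M[R]_(m, n)) : Prop :=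
  forall i j, X t i j @[t --> F] --> L i j.

Context (T : Type) (F : set_system T) {FF : Filter F}.

Lemma cvg_bigsum I (r : seq I) (h : I -> T -> R) (l : I -> R) :
  (forall i, h i t @[t --> F] --> l i) ->
  \sum_(i <- r) h i t @[t --> F] --> \sum_(i <- r) l i.
Proof.
move=> hl; elim: r => [|i r IH].
  by rewrite big_nil; under eq_fun do rewrite big_nil; exact: cvg_cst.
by rewrite big_cons; under eq_fun do rewrite big_cons; apply: cvgD.
Qed.

Lemma cvg_bigprod I (r : seq I) (h : I -> T -> R) (l : I -> R) :
  (forall i, h i t @[t --> F] --> l i) ->
  \prod_(i <- r) h i t @[t --> F] --> \prod_(i <- r) l i.
Proof.
move=> hl; elim: r => [|i r IH].
  by rewrite big_nil; under eq_fun do rewrite big_nil; exact: cvg_cst.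
by rewrite big_cons; under eq_fun do rewrite big_cons; apply: cvgM.
Qed.

Lemma mxcvg_cst m n (L : 'M[R]_(m, n)) : mxcvg F (fun=> L) L.
Proof. by move=> i j; exact: cvg_cst. Qed.

Lemma mxcvg_mul m n p (X : T -> 'M[R]_(m, n)) (Y : T -> 'M[R]_(n, p)) L L' :
  mxcvg F X L -> mxcvg F Y L' -> mxcvg F (fun t => X t *m Y t) (L *m L').
Proof.
move=> hX hY i j; rewrite mxE; under eq_fun do rewrite mxE.
by apply: cvg_bigsum => k; apply: cvgM.
Qed.

Lemma mxcvgB m n (X Y : T -> 'M[R]_(m, n)) L L' :
  mxcvg F X L -> mxcvg F Y L' -> mxcvg F (fun t => X t - Y t) (L - L').
Proof.
move=> hX hY i j; rewrite !mxE; under eq_fun do rewrite !mxE.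
by apply: cvgB.
Qed.

Lemma mxcvg_tr m n (X : T -> 'M[R]_(m, n)) L : mxcvg F X L -> mxcvg F (fun t => (X t)^T) L^T.
Proof. by move=> hX i j; rewrite mxE; under eq_fun do rewrite mxE; exact: hX. Qed.

Lemma mxcvg_det n (X : T -> 'M[R]_n) L : mxcvg F X L -> \det (X t) @[t --> F] --> \det L.
Proof.
move=> hX; apply: cvg_bigsum => s; apply: cvgM; first exact: cvg_cst.
by apply: cvg_bigprod => i; exact: hX.
Qed.

Lemma mxcvg_vol d r (X : T -> 'M[R]_(d, r)) L : mxcvg F X L -> vol (X t) @[t --> F] --> vol L.
Proof.
move=> hX; apply: (cvg_comp _ (@Num.sqrt R) _ (sqrt_continuous (x := _))).
by apply: mxcvg_det; apply: mxcvg_mul => //; exact: mxcvg_tr.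
Qed.

Lemma mxcvg_vnorm d (X : T -> 'cV[R]_d) L : mxcvg F X L -> vnorm (X t) @[t --> F] --> vnorm L.
Proof. by move=> /mxcvg_vol; under eq_fun do rewrite vol_col; rewrite vol_col. Qed.

End EntrywiseConvergence.

Section OperatorNorm.
Variable R : realType.

Lemma vnorm_le_opnorm d (B : 'M[R]_d) v : vnorm (B *m v) <= opnorm B * vnorm v.
Proof.
have [->|v0] := eqVneq v 0; first by rewrite mulmx0 vnorm0 mulr0.
rewrite -ler_pdivrMr ?vnorm_gt0 //; apply: sup_upper_bound; last by exists v.
split; first by exists (vnorm (B *m v) / vnorm v), v.
by exists (mxn B) => _ [w /= w0 <-]; rewrite ler_pdivrMr ?vnorm_gt0 // vnorm_mxn.
Qed.

End OperatorNorm.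

Section MetricSystem.
Variables (R : realType) (M : pointedType) (dist : M -> M -> R).
Hypothesis dist_metric : is_metric dist.

Let dist_ge0 x y : 0 <= dist x y. Proof. by case: dist_metric. Qed.
Let dist_xx x : dist x x = 0. Proof. by case: dist_metric => _ h _ _; apply/h. Qed.
Let dist_sym x y : dist x y = dist y x. Proof. by case: dist_metric. Qed.
Let dist_tri x y z : dist x z <= dist x y + dist y z. Proof. by case: dist_metric. Qed.

Definition mnbhs (x : M) : set_system M :=
  [set S | exists2 e : R, 0 < e & forall y, dist x y < e -> S y].

Global Instance mnbhs_filter x : ProperFilter (mnbhs x).
Proof.
apply: Build_ProperFilter_ex.
  by move=> S [e e0 h]; exists x; apply: h; rewrite dist_xx.
split; first by exists 1.
  move=> P Q [e e0 hP] [e' e'0 hQ]; exists (Num.min e e'); first by rewrite lt_min e0.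
  by move=> y; rewrite lt_min => /andP[/hP Py /hQ].
by move=> P Q PQ [e e0 hP]; exists e => // y /hP; exact: PQ.
Qed.

Lemma mopen_gt (h : M -> R) (c : R) :
  (forall x, h y @[y --> mnbhs x] --> h x) -> mopen dist [set x | c < h x].
Proof. by move=> hc x /= cx; exact: (cvgr_gt (h x) (hc x) _ cx). Qed.

Lemma mcompact_bounded : mcompact dist -> exists2 D : R, 0 < D & forall x y, dist x y <= D.
Proof.
move=> cpt; pose U (n : nat) : set M := [set x | dist point x < n%:R].
have oU n : mopen dist (U n).
  move=> x Ux; exists (n%:R - dist point x); first by rewrite subr_gt0.
  by move=> y; rewrite ltrBrDl; apply: le_lt_trans.
have cU x : exists n, U n x.
  by exists (Num.bound (dist point x)); exact: archi_boundP.
have [n [g hg]] := cpt _ U oU cU.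
pose N := (\max_(j < n) g j)%N.
have hN x : dist point x <= N%:R.
  have [j Uj] := hg x; apply: (le_trans (ltW Uj)); rewrite ler_nat.
  exact: leq_bigmax.
exists (N%:R + N%:R + 1); first by rewrite ltr_wpDl // addr_ge0.
move=> x y; apply: (le_trans (dist_tri x point y)).
by rewrite dist_sym; apply: (@le_trans _ _ (N%:R + N%:R)); rewrite ?lerDl // lerD.
Qed.

Section Cocycle.
Variables (f : M -> M) (d : nat) (A : M -> 'M[R]_d).
Hypothesis f_cont : mcontinuous dist f.

Lemma cocycleD n m x : cocycle f A (n + m) x = cocycle f A m (iter n f x) *m cocycle f A n x.
Proof.
elim: m => [|m IH]; first by rewrite addn0 mul1mx.
by rewrite addnS /= IH mulmxA -iterD addnC.
Qed.

Lemma cocycleS n x : cocycle f A n.+1 x = cocycle f A n (f x) *m A x.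
Proof. by rewrite -add1n cocycleD /= mulmx1. Qed.

Lemma measurable_preimage_mcont (S : set (g_sigma_algebraType (mopen dist))) :
  measurable S -> measurable (f @^-1` S : set (g_sigma_algebraType (mopen dist))).
Proof.
move: S; apply: smallest_sub => [|U oU]; last first.
  apply: sub_sigma_algebra => x /= Ufx.
  have [e e0 he] := oU _ Ufx; have [e' e'0 he'] := f_cont x e0.
  by exists e' => // y /he'/he.
split => [|S mS|F mF] /=.
- by rewrite preimage_set0; exact: (@measurable0 _ (g_sigma_algebraType (mopen dist))).
- by rewrite setTD preimage_setC; exact: measurableC.
- by rewrite preimage_bigcup; exact: bigcupT_measurable.
Qed.

Hypothesis A_cont : forall x, mxcvg (mnbhs x) A (A x).

Lemma cvg_iter n x : iter n f @ mnbhs x `=>` mnbhs (iter n f x).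
Proof.
elim: n => [|n IH] //= S [e e0 hS].
have [e' e'0 he'] := f_cont (iter n f x) e0.
have := IH [set y | dist (iter n f x) y < e'].
by case=> [|e1 e10 h]; [exists e' | exists e1 => // y /h /= /he' /hS].
Qed.

Lemma mxcvg_cocycle n x : mxcvg (mnbhs x) (cocycle f A n) (cocycle f A n x).
Proof.
elim: n x => [|n IH] x /=; first exact: mxcvg_cst.
apply: mxcvg_mul => // i j.
apply: (cvg_comp (iter n f) (fun y => A y i j)); first exact: cvg_iter.
exact: A_cont.
Qed.

Lemma measurable_Nvol_cocycle r n c : (r <= d)%N ->
  measurable ([set x | Nvol r (cocycle f A n x) <= c] : set (g_sigma_algebraType (mopen dist))).
Proof.
move=> rd; rewrite -[X in measurable X]setCK; apply: measurableC.
have -> : ~` [set x | Nvol r (cocycle f A n x) <= c] =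
    \bigcup_(X in [set X : 'M[R]_(d, r) | X^T *m X = 1%:M]) [set x | c < vol (cocycle f A n x *m X)].
  apply/seteqP; split => x /=.
    by move=> /negP; rewrite -ltNge => /(Nvol_adherent rd)[X XX h]; exists X.
  by move=> [X XX h]; apply/negP; rewrite -ltNge; apply: lt_le_trans h (vol_le_Nvol rd _ XX).
apply: sub_sigma_algebra => x [X XX hX].
have [e e0 he] : mnbhs x [set y | c < vol (cocycle f A n y *m X)].
  apply: (@mopen_gt (fun y => vol (cocycle f A n y *m X)) c _ x hX) => z.
  by apply: mxcvg_vol; apply: mxcvg_mul; [exact: mxcvg_cocycle | exact: mxcvg_cst].
by exists e => // y /he hy; exists X.
Qed.

Definition slow_frame s K x k (U : 'M[R]_(k, d)) : Prop :=
  U *m U^T = 1%:M /\ forall n v,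
    vnorm (cocycle f A n x *m (v - U^T *m (U *m v))) <= K * expR (s * n%:R) * vnorm v.

Lemma slow_frame_entry s K x k (U : 'M[R]_(k, d)) : slow_frame s K x U -> forall i j, `|U i j| <= 1.
Proof.
move=> [UU _]; apply: ler_entry_vnorm => v; rewrite mul1r -{1}[U]trmxK.
by apply: vnorm_tr_le; rewrite trmxK.
Qed.

Lemma slow_frame_limit s K x k (T : Type) (G : set_system T) (y : T -> M) (U : T -> 'M[R]_(k, d)) :
  UltraFilter G -> y @ G `=>` mnbhs x -> (forall t, slow_frame s K (y t) (U t)) ->
  exists2 L, mxcvg G U L & slow_frame s K x L.
Proof.
move=> GU yx hU; have GP := ultra_proper (UltraFilter := GU).
have hl i j : exists l : R, U t i j @[t --> G] --> l.
  by apply: bounded_ultra_cvg => t; exact: slow_frame_entry (hU t) i j.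
pose L := \matrix_(i, j) sval (cid (hl i j)).
have UL : mxcvg G U L by move=> i j; rewrite mxE; exact: svalP (cid (hl i j)).
exists L => //; split.
  apply/matrixP => i j.
  have h : (U t *m (U t)^T) i j @[t --> G] --> (L *m L^T) i j.
    by apply: mxcvg_mul => //; exact: mxcvg_tr.
  have h' : (U t *m (U t)^T) i j @[t --> G] --> (1%:M : 'M[R]_k) i j.
    by under eq_fun do rewrite (hU _).1; exact: cvg_cst.
  exact: cvg_unique _ h h'.
move=> n v; have yc : mxcvg G (fun t => cocycle f A n (y t)) (cocycle f A n x).
  by move=> i j; apply: (cvg_comp y (fun z => cocycle f A n z i j)); [exact: yx | exact: mxcvg_cocycle].
have h : vnorm (cocycle f A n (y t) *m (v - (U t)^T *m (U t *m v))) @[t --> G] -->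
    vnorm (cocycle f A n x *m (v - L^T *m (L *m v))).
  apply: mxcvg_vnorm; apply: mxcvg_mul => //; apply: mxcvgB; first exact: mxcvg_cst.
  apply: mxcvg_mul; first exact: mxcvg_tr.
  by apply: mxcvg_mul => //; exact: mxcvg_cst.
by apply: (cvgr_to_le h); apply: nearW => t; exact: (hU t).2.
Qed.

Lemma measurable_slow_frame s K k :
  measurable ([set x | exists U : 'M[R]_(k, d), slow_frame s K x U] : set (g_sigma_algebraType (mopen dist))).
Proof.
rewrite -[X in measurable X]setCK; apply: measurableC; apply: sub_sigma_algebra => x /= nx.
apply: contrapT => hx.
have hy n : exists yU : M * 'M[R]_(k, d), dist x yU.1 < n.+1%:R^-1 /\ slow_frame s K yU.1 yU.2.
  apply: contrapT => h; apply: hx; exists n.+1%:R^-1 => // y xy [U hU].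
  by apply: h; exists (y, U).
pose yU n := sval (cid (hy n)).
have [G [GU sG]] := ultraFilterLemma (eventually_filter).
have [|n|L _ hL] := @slow_frame_limit s K x k nat G (fun n => (yU n).1) (fun n => (yU n).2) GU.
- move=> S [e e0 hS]; apply: sG; exists (Num.bound e^-1) => // n /= en; apply: hS.
  apply: (lt_trans (svalP (cid (hy n))).1).
  rewrite invf_plt ?posrE //; apply: (lt_le_trans (archi_boundP _)); first by rewrite invr_ge0 ltW.
  by rewrite ler_nat (leq_trans en).
- exact: (svalP (cid (hy n))).2.
- by apply: nx; exists L.
Qed.

End Cocycle.
End MetricSystem.

(** * Growth rates and Lyapunov bases *)

Section AdaptedBasis.
Variable F : fieldType.

Lemma adapted_basis d l (E : 'I_l -> 'M[F]_d) :
  mxdirect (\sum_(i < l) E i) -> (\sum_(i < l) E i == 1%:M)%MS ->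
  exists P : 'M[F]_d, exists b : 'I_d -> 'I_l,
    [/\ P \in unitmx, (forall k, (row k P <= E (b k))%MS) &
     forall k : 'I_d, (\sum_(j < l | (j < b k)%N) \rank (E j) <= k
                       < \sum_(j < l | (j <= b k)%N) \rank (E j))%N].
Proof.
move=> /mxdirectP /= dE /eqmxP E1.
have hd : (\sum_i \rank (E i))%N = d by rewrite -dE E1 mxrank1.
pose B := \mxcol_i row_base (E i).
have rB : \rank B = d.
  apply/eqP; rewrite eqn_leq rank_leq_col -{1}(mxrank1 F d) mxrankS // -E1.
  apply/sumsmx_subP => i _; rewrite /B eqmx_col (sumsmx_sup i) // genmxE.
  by rewrite eq_row_base.
exists (castmx (hd, erefl d) B), (fun k => tagnat.sig1 (cast_ord (esym hd) k)); split.
- by rewrite -row_full_unit /row_full eqmx_cast rB.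
- move=> k; have -> : row k (castmx (hd, erefl d) B) = row (cast_ord (esym hd) k) B.
    by apply/rowP => j; rewrite mxE castmxE [RHS]mxE cast_ord_id.
  by rewrite row_mxcol (submx_trans (row_sub _ _)) // eq_row_base.
- move=> k; set s := cast_ord _ k.
  have -> : (k : nat) = s by [].
  rewrite (tagnat.rect s) leq_addr /= [X in (_ < X)%N](bigD1 (tagnat.sig1 s)) //= addnC.
  rewrite -addSn leq_add ?ltn_ord //.
  by rewrite eq_leq //; apply: eq_bigl => j; rewrite ltn_neqAle andbC.
Qed.

End AdaptedBasis.

Section Growth.
Variables (R : realType) (M : pointedType) (f : M -> M) (d : nat) (A : M -> 'M[R]_d).

Definition grows_le s x v : Prop :=
  exists K, forall n, vnorm (cocycle f A n x *m v) <= K * expR (s * n%:R).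

Lemma eventually_le_bound (a b : nat -> R) : (forall n, 0 < b n) ->
  (exists N, forall n, (N <= n)%N -> a n <= b n) -> exists2 K, 0 < K & forall n, a n <= K * b n.
Proof.
move=> b0 [N hN]; pose K := 1 + \sum_(i < N) `|a i| / b i.
have K0 : 1 <= K by rewrite lerDl sumr_ge0 // => i _; rewrite divr_ge0 // ltW.
exists K => [|n]; first exact: lt_le_trans K0.
have [Nn|nN] := leqP N n.
  by apply: (le_trans (hN n Nn)); rewrite ler_peMl // ltW.
rewrite -ler_pdivrMr //; apply: (@le_trans _ _ (`|a n| / b n)).
  by rewrite ler_wpM2r ?invr_ge0 ?ler_norm // ltW.
rewrite /K (bigD1 (Ordinal nN)) //= addrCA lerDl addr_ge0 // sumr_ge0 // => i _.
by rewrite divr_ge0 // ltW.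
Qed.

Lemma grows_leW s s' x v : s <= s' -> grows_le s x v -> grows_le s' x v.
Proof.
move=> ss' [K hK]; exists K => n; apply: (le_trans (hK n)).
have K0 : 0 <= K by have := hK 0%N; rewrite mulr0 expR0 mulr1; exact: le_trans (vnorm_ge0 _).
by rewrite ler_wpM2l // ler_expR ler_wpM2r.
Qed.

Lemma grows_le0 s x : grows_le s x 0.
Proof. by exists 0 => n; rewrite mulmx0 vnorm0 mul0r. Qed.

Lemma grows_leD s x u v : grows_le s x u -> grows_le s x v -> grows_le s x (u + v).
Proof.
move=> [K hK] [K' hK']; exists (K + K') => n; rewrite mulmxDr mulrDl.
by apply: (le_trans (ler_vnormD _ _)); apply: lerD.
Qed.

Lemma grows_leZ s x (a : R) v : grows_le s x v -> grows_le s x (a *: v).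
Proof.
move=> [K hK]; exists (`|a| * K) => n.
by rewrite -scalemxAr vnormZ -mulrA ler_wpM2l.
Qed.

Lemma grows_leN s x v : grows_le s x v -> grows_le s x (- v).
Proof. by rewrite -scaleN1r; exact: grows_leZ. Qed.

Lemma grows_le_sum s x I (r : seq I) (P : pred I) (F : I -> 'cV[R]_d) :
  (forall i, P i -> grows_le s x (F i)) -> grows_le s x (\sum_(i <- r | P i) F i).
Proof.
move=> h; elim/big_rec : _ => [|i v Pi]; first exact: grows_le0.
exact: grows_leD (h i Pi).
Qed.

Lemma grows_le_step s x v : grows_le s x v -> grows_le s (f x) (A x *m v).
Proof.
move=> [K hK]; exists (K * expR s) => n; rewrite mulmxA -cocycleS.
by apply: (le_trans (hK n.+1)); rewrite -mulrA -expRD -natr1 mulrDr mulr1 addrC.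
Qed.

Lemma elog_lt (n : nat) (r s : R) : (0 < n)%N -> 0 <= r ->
  ((n%:R^-1)%:E * elog r < s%:E)%E -> r < expR (s * n%:R).
Proof.
move=> n0 r0; rewrite /elog; have np : 0 < n%:R :> R by rewrite ltr0n.
case: eqP => [-> _|/eqP rn0]; first exact: expR_gt0.
have rp : 0 < r by rewrite lt_neqAle eq_sym rn0.
rewrite -EFinM lte_fin mulrC ltr_pdivrMr // => h.
by rewrite -(lnK (x := r)) ?posrE // ltr_expR.
Qed.

Lemma elog_gt (n : nat) (r s : R) : (0 < n)%N -> 0 <= r ->
  (s%:E < (n%:R^-1)%:E * elog r)%E -> expR (s * n%:R) < r.
Proof.
move=> n0 r0; rewrite /elog; have np : 0 < n%:R :> R by rewrite ltr0n.
case: eqP => [_|/eqP rn0]; first by rewrite gt0_muleNy ?lte_fin ?invr_gt0.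
have rp : 0 < r by rewrite lt_neqAle eq_sym rn0.
rewrite -EFinM lte_fin mulrC ltr_pdivlMr // => h.
by rewrite -(lnK (x := r)) ?posrE // ltr_expR.
Qed.

Lemma exponent_grows_le x v lam (s : R) :
  (fun n : nat => ((n%:R)^-1)%:E * elog (vnorm (cocycle f A n x *m v)))%E @ \oo --> lam ->
  (lam < s%:E)%E -> grows_le s x v.
Proof.
move=> cv ls.
have [N _ hN] : \forall n \near \oo, (((n%:R)^-1)%:E * elog (vnorm (cocycle f A n x *m v)) < s%:E)%E.
  apply: (cv [set y | (y < s%:E)%E]).
  by apply: open_nbhs_nbhs; split; first exact: open_ereal_lt_ereal.
have [||K _ hK] := @eventually_le_bound (fun n => vnorm (cocycle f A n x *m v)) (fun n => expR (s * n%:R)).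
- by move=> n; exact: expR_gt0.
- exists N.+1 => n Nn; apply/ltW/elog_lt; rewrite ?vnorm_ge0 //; first exact: leq_ltn_trans Nn.
  by apply: hN; exact: ltnW.
- by exists K.
Qed.

Lemma exponent_grows_ge x v lam (s : R) :
  (fun n : nat => ((n%:R)^-1)%:E * elog (vnorm (cocycle f A n x *m v)))%E @ \oo --> lam ->
  (s%:E < lam)%E -> exists N, forall n, (N <= n)%N -> expR (s * n%:R) < vnorm (cocycle f A n x *m v).
Proof.
move=> cv ls.
have [N _ hN] : \forall n \near \oo, (s%:E < ((n%:R)^-1)%:E * elog (vnorm (cocycle f A n x *m v)))%E.
  apply: (cv [set y | (s%:E < y)%E]).
  by apply: open_nbhs_nbhs; split; first exact: open_ereal_gt_ereal.
exists N.+1 => n Nn; apply: elog_gt; rewrite ?vnorm_ge0 //; first exact: leq_ltn_trans Nn.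
by apply: hN; exact: ltnW.
Qed.

Lemma expR_le_false (s t K : R) : s < t -> ~ exists N, forall n : nat, (N <= n)%N ->
  expR (t * n%:R) <= K * expR (s * n%:R).
Proof.
move=> st [N hN].
have ts : 0 < t - s by rewrite subr_gt0.
pose n := maxn N (Num.bound (`|K| / (t - s))).
have := hN n (leq_maxl _ _).
have -> : expR (t * n%:R) = expR ((t - s) * n%:R) * expR (s * n%:R).
  by rewrite -expRD; congr expR; ring.
rewrite ler_pM2r ?expR_gt0 //; apply/negP; rewrite -ltNge.
apply: (le_lt_trans (ler_norm K)); apply: (@lt_le_trans _ _ ((t - s) * n%:R)); last first.
  by apply: le_trans (expR_ge1Dx _); rewrite lerDr.
rewrite mulrC -ltr_pdivrMr //; apply: (lt_le_trans (archi_boundP _)).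
  by rewrite divr_ge0 // ltW.
by rewrite ler_nat leq_maxr.
Qed.

Definition lyap_basis x (gamma : 'I_d -> \bar R) (P : 'M[R]_d) : Prop :=
  [/\ P \in unitmx,
      (forall i s, (gamma i < s%:E)%E -> grows_le s x (col i P)) &
      (forall v s, grows_le s x (P *m v) -> forall i, (s%:E < gamma i)%E -> v i 0 = 0)].

Lemma ereal_mid_lt (a b : \bar R) : (a < b)%E -> exists r : R, (a < r%:E)%E /\ (r%:E < b)%E.
Proof.
case: a b => [a| |] [b| |] //.
- by rewrite lte_fin => ab; exists ((a + b) / 2); rewrite !lte_fin; lra.
- by move=> _; exists (a + 1); rewrite lte_fin ltry; split => //; lra.
- by move=> _; exists (b - 1); rewrite lte_fin ltNyr; split => //; lra.
- by move=> _; exists 0; rewrite ltry ltNyr.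
Qed.

Lemma splitting_lyap_basis l (lam : 'I_l -> \bar R) (E : 'I_l -> 'M[R]_d) (gamma : 'I_d -> \bar R) x :
  (forall i j : 'I_l, (i < j)%N -> (lam j < lam i)%E) ->
  (forall (i : 'I_l) (k : 'I_d),
    (\sum_(j < l | (j < i)%N) \rank (E j) <= k < \sum_(j < l | (j <= i)%N) \rank (E j))%N ->
    gamma k = lam i) ->
  mxdirect (\sum_(i < l) E i) -> (\sum_(i < l) E i == 1%:M)%MS ->
  (forall i (v : 'rV[R]_d), v != 0 -> (v <= E i)%MS ->
    (fun n : nat => ((n%:R)^-1)%:E * elog (vnorm (cocycle f A n x *m v^T)))%E @ \oo --> lam i) ->
  exists P, lyap_basis x gamma P.
Proof.
move=> lam_lt gE dE E1 grow.
have [P [b [uP Pb bk]]] := adapted_basis dE E1.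
have gb k : gamma k = lam (b k) by apply: gE; exact: bk.
have rP k : row k P != 0.
  apply/negP => /eqP r0.
  have := congr1 (fun v => v *m invmx P) r0; rewrite mul0mx -row_mul mulmxV //.
  move/rowP/(_ k); rewrite !mxE eqxx => /eqP; by rewrite oner_eq0.
exists P^T; split; first by rewrite unitmx_tr.
- move=> k s gs; rewrite -tr_row; apply: exponent_grows_le (grow (b k) _ (rP k) (Pb k)) _.
  by rewrite -gb.
move=> v s gv k sk; apply/eqP/negPn/negP => vk0.
pose w i := \sum_(j | b j == i) v j 0 *: row j P.
have wE i : (w i <= E i)%MS.
  by apply: summx_sub => j /eqP <-; rewrite scalemx_sub.
have vw : P^T *m v = \sum_i (w i)^T.
  rewrite -[LHS]trmxK -linear_sum /= trmx_mul trmxK; congr trmx.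
  rewrite mulmx_sum_row (partition_big b predT) //=; apply: eq_bigr => i _.
  by apply: eq_bigr => j _; rewrite mxE.
have wn0 j : v j 0 != 0 -> w (b j) != 0.
  apply: contra => /eqP wj0.
  have : w (b j) *m invmx P = 0 by rewrite wj0 mul0mx.
  rewrite mulmx_suml => /rowP/(_ j); rewrite summxE (bigD1 j) //= big1 => [|i /andP[_ ij]].
    by rewrite addr0 -scalemxAl -row_mul mulmxV // !mxE eqxx mulr1 => ->.
  by rewrite -scalemxAl -row_mul mulmxV // !mxE (negPf ij) mulr0.
pose Q (i : 'I_l) := w i != 0.
have Qk : Q (b k) by exact: wn0.
have [i Qi imin] := @arg_minnP _ (b k) Q (fun i => i : nat) Qk.
have slam : (s%:E < lam i)%E.
  apply: (lt_le_trans sk); rewrite gb.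
  have := imin _ Qk; rewrite leq_eqVlt => /predU1P[h|/lam_lt/ltW//].
  by rewrite (_ : i = b k) //; exact: val_inj.
have /choice[r hr] : forall j : 'I_l, exists r : R, (i < j)%N -> (lam j < r%:E)%E /\ (r%:E < lam i)%E.
  move=> j; have [ij|_] := boolP (i < j)%N; last by exists 0.
  by have [r hr] := ereal_mid_lt (lam_lt _ _ ij); exists r.
pose s2 := \big[Order.max/s]_(j < l | (i < j)%N) r j.
have s2lam : (s2%:E < lam i)%E.
  rewrite /s2; elim/big_ind : _ => [//|y z hy hz|j ij]; last by have [] := hr j ij.
  by rewrite EFin_max gt_max hy.
have ss2 : s <= s2 by rewrite /s2; exact: bigmax_ge_id.
have others (j : 'I_l) : j != i -> grows_le s2 x (w j)^T.
  move=> ji; have [wj0|wjn0] := eqVneq (w j) 0.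
    by rewrite wj0 trmx0; exact: grows_le0.
  have ij : (i < j)%N by rewrite ltn_neqAle imin // andbT; rewrite eq_sym -val_eqE in ji.
  apply: exponent_grows_le (grow j _ wjn0 (wE j)) _.
  apply: (lt_le_trans (hr j ij).1); rewrite lee_fin /s2.
  by apply: le_bigmax_cond.
have gi : grows_le s2 x (w i)^T.
  have -> : (w i)^T = P^T *m v - \sum_(j | j != i) (w j)^T.
    by rewrite vw (bigD1 i) //= addrK.
  apply: grows_leD; first exact: grows_leW gv.
  by apply: grows_leN; apply: grows_le_sum.
have [t [st tl]] := ereal_mid_lt s2lam; rewrite lte_fin in st.
have [N hN] := exponent_grows_ge (grow i _ Qi (wE i)) tl.
case: gi => K hK; apply: (expR_le_false (K := K) st).
by exists N => n /hN/ltW/le_trans; apply.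
Qed.

End Growth.

Section PointwiseData.
Variables (R : realType) (M : pointedType) (dist : M -> M -> R) (f : M -> M).
Variables (d : nat) (A : M -> 'M[R]_d).

Lemma lyap_spectrum_basis (nu : {measure set (g_sigma_algebraType (mopen dist)) -> \bar R}) gamma :
  lyap_spectrum f A nu gamma ->
  {ae nu, forall x, exists P, lyap_basis f A x gamma P} /\
  (forall i j : 'I_d, (i <= j)%N -> (gamma j <= gamma i)%E).
Proof.
move=> [l [lam [m [E [lam_lt m0 md gE ae]]]]]; split.
  apply: filterS ae => x [[rE dE] E1 _ _ grow].
  apply: (splitting_lyap_basis lam_lt _ dE E1 grow) => i k h; apply: gE.
  by under eq_bigr do rewrite -rE; under [X in (_ < X)%N]eq_bigr do rewrite -rE.
have block (k : 'I_d) : exists b : 'I_l,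
    (\sum_(j < l | (j < b)%N) m j <= k < \sum_(j < l | (j <= b)%N) m j)%N.
  have kd : (k < \sum_(i < l) m i)%N by rewrite md.
  pose s := Ordinal kd; exists (tagnat.sig1 s).
  have -> : (k : nat) = s by [].
  rewrite (tagnat.rect s) leq_addr /= [X in (_ < X)%N](bigD1 (tagnat.sig1 s)) //= addnC.
  rewrite -addSn leq_add ?ltn_ord //.
  by rewrite eq_leq //; apply: eq_bigl => j; rewrite ltn_neqAle andbC.
move=> i j ij; have [bi hi] := block i; have [bj hj] := block j.
rewrite (gE _ _ hi) (gE _ _ hj).
have [lt|lt|e] := ltngtP bi bj; [exact/ltW/lam_lt| |by rewrite (val_inj e : bi = bj)].
have : (i < i)%N; last by rewrite ltnn.
case/andP: hi => hi _; case/andP: hj => _ hj.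
apply: leq_ltn_trans ij (leq_trans hj _); apply: (leq_trans _ hi).
rewrite [X in (_ <= X)%N]big_mkcond [X in (X <= _)%N]big_mkcond /=; apply: leq_sum => a _.
by have [abj|//] := leqP a bj; rewrite (leq_ltn_trans abj lt).
Qed.

Variables (gamma : 'I_d -> \bar R) (x : M) (P : 'M[R]_d).
Hypothesis P_basis : lyap_basis f A x gamma P.
Hypothesis gamma_mono : forall i j : 'I_d, (i <= j)%N -> (gamma j <= gamma i)%E.

Lemma kernel_frame k (kd : (k <= d)%N) : exists U : 'M[R]_(k, d),
  [/\ U *m U^T = 1%:M,
      (forall v : 'cV[R]_d, U *m v = 0 -> forall i : 'I_d, (i < k)%N -> (invmx P *m v) i 0 = 0) &
      (forall v : 'cV[R]_d, (forall i : 'I_d, (i < k)%N -> (invmx P *m v) i 0 = 0) -> U *m v = 0)].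
Proof.
have [uP _ _] := P_basis.
pose U0 := rowsub (widen_ord kd) (invmx P); pose V0 := colsub (widen_ord kd) P.
have UV : U0 *m V0 = 1%:M.
  rewrite mul_rowsub_mx mulmx_colsub mulVmx //; apply/matrixP => i j.
  by rewrite !mxE -val_eqE.
have [Z [T [ZZ UE]]] := qr_decomp U0^T kd.
have U0E : U0 = T^T *m Z^T by rewrite -[U0]trmxK UE trmx_mul.
have uT : T^T \in unitmx by move: UV; rewrite U0E -mulmxA => /mulmx1_unit[].
exists Z^T; split; first by rewrite trmxK.
- move=> v Zv i ik; have : U0 *m v = 0 by rewrite U0E -mulmxA Zv mulmx0.
  rewrite mul_rowsub_mx => /matrixP/(_ (Ordinal ik) 0); rewrite mxE [RHS]mxE.
  by rewrite (_ : widen_ord kd _ = i) //; exact: val_inj.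
- move=> v hv; have : U0 *m v = 0.
    by rewrite mul_rowsub_mx; apply/matrixP => i j; rewrite ord1 mxE [RHS]mxE hv //=.
  by rewrite U0E -mulmxA => /(congr1 (mulmx (invmx T^T))); rewrite mulKmx // mulmx0.
Qed.

Lemma grow_kernel k (s : R) : (forall i : 'I_d, (k <= i)%N -> (gamma i < s%:E)%E) ->
  exists2 K, 0 <= K & forall v : 'cV[R]_d, (forall i : 'I_d, (i < k)%N -> (invmx P *m v) i 0 = 0) ->
    forall n, vnorm (cocycle f A n x *m v) <= K * expR (s * n%:R) * vnorm v.
Proof.
move=> gs; have [uP gP _] := P_basis.
have /choice[K hK] : forall i : 'I_d, exists K, (k <= i)%N ->
    forall n, vnorm (cocycle f A n x *m col i P) <= K * expR (s * n%:R).
  move=> i; have [ki|_] := boolP (k <= i)%N; last by exists 0.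
  by have [K hK] := gP i s (gs i ki); exists K.
pose N := mxn (invmx P); exists (N * \sum_i `|K i|).
  by rewrite mulr_ge0 ?mxn_ge0 // sumr_ge0.
move=> v hv n; set c := invmx P *m v.
have vE : v = \sum_i c i 0 *: col i P.
  rewrite -[LHS](mulKVmx uP) -/c.
  apply/colP => i; rewrite mxE summxE; apply: eq_bigr => j _.
  by rewrite !mxE mulrC.
have cN i : `|c i 0| <= N * vnorm v.
  exact: le_trans (ler_coord_vnorm c i) (vnorm_mxn _ _).
rewrite {1}vE mulmx_sumr; apply: (le_trans (ler_vnorm_sum _ _ _)).
have -> : N * (\sum_i `|K i|) * expR (s * n%:R) * vnorm v =
    \sum_i N * vnorm v * (`|K i| * expR (s * n%:R)).
  by rewrite -mulr_sumr -mulr_suml; ring.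
apply: ler_sum => i _; rewrite -scalemxAr vnormZ.
have [ik|ki] := ltnP i k.
  by rewrite hv // normr0 mul0r !mulr_ge0 ?mxn_ge0 ?vnorm_ge0 ?expR_ge0.
apply: ler_pM; rewrite ?vnorm_ge0 //.
by apply: (le_trans (hK i ki n)); rewrite ler_wpM2r ?expR_ge0 ?ler_norm.
Qed.

Lemma slow_frame_exists k (s t : R) : (k <= d)%N -> s < t ->
  (forall i : 'I_d, (k <= i)%N -> (gamma i < s%:E)%E) ->
  (forall i : 'I_d, (i < k)%N -> (t%:E < gamma i)%E) ->
  exists U : 'M[R]_(k, d), exists2 K, slow_frame f A s K x U &
    forall v r, r <= t -> grows_le f A r x v -> U *m v = 0.
Proof.
move=> kd st gs gt; have [U [UU U1 U2]] := kernel_frame kd.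
have [K K0 hK] := grow_kernel gs.
exists U, K.
  split => // n v; set w := v - _.
  have Uw : U *m w = 0 by rewrite mulmxBr !mulmxA UU mul1mx subrr.
  apply: (le_trans (hK w (U1 w Uw) n)); rewrite ler_wpM2l ?mulr_ge0 ?expR_ge0 //.
  rewrite /w -{2}[U]trmxK; apply: vnorm_cotr_le; by rewrite trmxK.
move=> v r rt gv; apply: U2 => i ik; have [uP _ h] := P_basis.
by apply: (h _ r); [rewrite mulKVmx | apply: le_lt_trans (gt i ik); rewrite lee_fin].
Qed.

Lemma Nvol_upper r (c : nat -> R) : (r <= d)%N ->
  (forall i : 'I_d, (i < r)%N -> (gamma i < (c i)%:E)%E) ->
  exists K, forall n, Nvol r (cocycle f A n x) <= K * expR ((\sum_(i < r) c i) * n%:R).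
Proof.
move=> rd gc.
have /choice[K hK] : forall i, exists K, (i < r)%N -> 0 <= K /\
    forall v : 'cV[R]_d, (forall j : 'I_d, (j < i)%N -> (invmx P *m v) j 0 = 0) ->
      forall n, vnorm (cocycle f A n x *m v) <= K * expR (c i * n%:R) * vnorm v.
  move=> i; have [ir|_] := boolP (i < r)%N; last by exists 0.
  have id : (i < d)%N by exact: leq_trans rd.
  have [|K K0 h] := @grow_kernel i (c i); last by exists K.
  by move=> j ij; apply: le_lt_trans (gc (Ordinal id) ir); exact: gamma_mono.
exists (\prod_(i < r) K i) => n.
have -> : (\prod_(i < r) K i) * expR ((\sum_(i < r) c i) * n%:R)
    = \prod_(i < r) (K i * expR (c i * n%:R)).
  rewrite big_split /= -expR_sum; congr (_ * expR _).
  by rewrite mulr_suml.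
apply: (@Nvol_flag _ _ _ _ (fun i => K i * expR (c i * n%:R))) => // i ir.
have [K0 h] := hK i ir; split; first by rewrite mulr_ge0 ?expR_ge0.
have [U [_ U1 _]] := kernel_frame (ltnW (leq_trans ir rd)).
by exists U => b Ub; apply: h => j; exact: U1.
Qed.

End PointwiseData.

Section FrameUnicity.
Variables (R : realType) (d k : nat).

Lemma frame_proj_eq (U V : 'M[R]_(k, d)) : U *m U^T = 1%:M -> V *m V^T = 1%:M ->
  (forall v : 'cV[R]_d, U *m v = 0 -> V *m v = 0) -> V^T *m V = U^T *m U.
Proof.
move=> UU VV UV; pose O := V *m U^T.
have VE : V = O *m U.
  apply/eqP; rewrite -subr_eq0; apply/eqP/matrixP => i j.
  have : V *m (delta_mx j 0 - U^T *m (U *m (delta_mx j 0 : 'cV_d))) = 0.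
    by apply: UV; rewrite mulmxBr !mulmxA UU mul1mx subrr.
  rewrite mulmxBr !mulmxA -mulmxBl -colE => /matrixP/(_ i 0).
  by rewrite [LHS]mxE [RHS]mxE => ->; rewrite mxE.
have OO : O^T *m O = 1%:M.
  apply: mulmx1C; move: VV; rewrite {2}VE trmx_mul mulmxA => <-.
  by rewrite -/O.
by rewrite VE trmx_mul mulmxA -(mulmxA U^T) OO mulmx1.
Qed.

End FrameUnicity.

(** * Expansion transverse to a slow subspace *)

Section Angle.
Variable R : realType.

(* [a n] and [b n] are the cocycles at a point [x] and at its [m]-th iterate [y]; [U] and [V] are
   frames of the orthogonal complements of the slow spaces at [x] and [y].  A [k]-frame which
   realises the [k]-volume growth up to time [m + l], with [l] a small multiple of [m], must be
   transverse to the slow space at time [m]: otherwise its growth between [m] and [m + l] would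
   be too small. *)
Lemma frame_det_lower (d k0 : nat) (Gk Gk1 s be ep' : R) : (k0 < d)%N -> s < Gk - Gk1 -> 0 < ep' ->
  exists2 ep0, 0 < ep0 & forall ep, 0 < ep -> ep <= ep0 -> forall ka, 0 <= ka -> exists ka', 
  forall (a b : nat -> 'M[R]_d) m (U V : 'M[R]_(k0.+1, d)),
  (forall l, a (m + l)%N = b l *m a m) ->
  (forall l (v : 'cV[R]_d), vnorm (b l *m v) <= expR (be * l%:R) * vnorm v) ->
  U *m U^T = 1%:M -> V *m V^T = 1%:M ->
  (forall v : 'cV[R]_d, V *m (a m *m (v - U^T *m (U *m v))) = 0) ->
  (forall n (v : 'cV[R]_d), vnorm (b n *m (v - V^T *m (V *m v))) <= expR (ka + s * n%:R) * vnorm v) ->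
  Nvol k0.+1 (a m) <= expR (ka + (Gk + ep) * m%:R) ->
  (forall l, Nvol k0.+1 (b l) <= expR (ka + (Gk + ep) * l%:R)) ->
  (forall l, Nvol k0 (b l) <= expR (ka + (Gk1 + ep) * l%:R)) ->
  (forall n, expR (- ka + (Gk - ep) * n%:R) <= Nvol k0.+1 (a n)) ->
  expR (- ka' + (Gk - ep') * m%:R) <= `|\det (V *m a m *m U^T)|.
Proof.
move=> kd sG ep'0; pose de := Gk - Gk1 - s.
have de0 : 0 < de by rewrite /de; lra.
pose L := k0.+1%:R * `|s - be| + de / 2.
have L0 : 0 <= L by rewrite addr_ge0 ?mulr_ge0 // ltW.
pose ep0 := Num.min (de / 4) (ep' / (1 + 4 * L / de)).
have q0 : 0 < 1 + 4 * L / de by rewrite ltr_wpDr // divr_ge0 ?mulr_ge0 // ltW.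
exists ep0; first by rewrite /ep0 lt_min !divr_gt0.
move=> ep ep_gt0; rewrite le_min => /andP[ep1 ep2] ka ka0.
have {}ep2 : ep + 4 * ep * L / de <= ep'.
  by move: ep2; rewrite ler_pdivlMr //; lra.
exists (L * ((8 * ka + 4) / de + 1) + 2 * ka + 1).
move=> a b m U V ab bbe UU VV equi slow Na Nb Nb1 Na_lo.
pose y := (2 / de) * (2 * ep * m%:R + 4 * ka + 2).
have y0 : 0 <= y.
  apply: mulr_ge0; first by rewrite divr_ge0 // ltW.
  by rewrite !addr_ge0 // !mulr_ge0 // ltW.
pose l := (Num.truncn y).+1.
have [yl ly] : y < l%:R /\ l%:R <= y + 1.
  have := truncn_itv y0 => /andP[h1 h2]; split => //.
  by rewrite -natr1 lerD2r.
pose K0 := - ka - 1 + (Gk - ep) * (m + l)%:R.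
have [|X XX hX] := @Nvol_adherent R k0.+1 d kd (a (m + l)%N) (expR K0).
  apply: lt_le_trans (Na_lo _); rewrite ltr_expR /K0; lra.
have [Z [T [ZZ ZT]]] := qr_decomp (a m *m X) kd.
have volT : vol (a m *m X) = `|\det T| by rewrite ZT vol_qr.
have volE : vol (a (m + l)%N *m X) = vol (b l *m Z) * `|\det T|.
  by rewrite ab -mulmxA ZT mulmxA vol_mulr.
have T_up : `|\det T| <= expR (ka + (Gk + ep) * m%:R).
  by rewrite -volT; apply: le_trans (vol_le_Nvol kd _ XX) Na.
have T_lo : expR (K0 - (ka + (Gk + ep) * l%:R)) <= `|\det T|.
  rewrite expRD expRN ler_pdivrMr ?expR_gt0 // mulrC.
  apply: (le_trans (ltW hX)); rewrite volE ler_wpM2r //.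
  by apply: le_trans (vol_le_Nvol kd _ ZZ) (Nb l).
have bZ_lo : expR (K0 - (ka + (Gk + ep) * m%:R)) <= vol (b l *m Z).
  rewrite expRD expRN ler_pdivrMr ?expR_gt0 //.
  apply: (le_trans (ltW hX)); rewrite volE ler_wpM2l ?vol_ge0 //.
have gapl : 2 * ep * m%:R + 4 * ka + 2 <= (de - 2 * ep) * l%:R.
  have e1 : (de / 2) * y = 2 * ep * m%:R + 4 * ka + 2.
    by rewrite /y; field; rewrite gt_eqF.
  apply: (@le_trans _ _ ((de / 2) * l%:R)).
    by rewrite -e1 ler_wpM2l ?divr_ge0 // ltW.
  rewrite ler_wpM2r //; lra.
have stretch1 (u : 'cV[R]_k0.+1) : vnorm u = 1 -> expR ((s - be) * l%:R) <= vnorm (V *m Z *m u).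
  move=> u1; have h := vol_le_stretch_Nvol (b l) kd ZZ u1.
  have low : expR (K0 - (ka + (Gk + ep) * m%:R) - (ka + (Gk1 + ep) * l%:R)) <= vnorm (b l *m Z *m u).
    rewrite expRD (expRN (ka + (Gk1 + ep) * l%:R)) ler_pdivrMr ?expR_gt0 //.
    apply: (le_trans bZ_lo); apply: (le_trans h); rewrite ler_wpM2l ?vnorm_ge0 //.
  have up : vnorm (b l *m Z *m u) <= expR (be * l%:R) * vnorm (V *m Z *m u) + expR (ka + s * l%:R).
    pose v := Z *m u; have v1 : vnorm v = 1 by rewrite /v vnorm_orth.
    have -> : b l *m Z *m u = b l *m (V^T *m (V *m v)) + b l *m (v - V^T *m (V *m v)).
      by rewrite -mulmxDr addrC subrK mulmxA.
    apply: (le_trans (ler_vnormD _ _)); apply: lerD; last by have := slow l v; rewrite v1 mulr1.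
    apply: (le_trans (bbe _ _)); rewrite ler_wpM2l ?expR_ge0 //.
    by rewrite vnorm_orth ?trmxK // /v mulmxA.
  have two : 2 * expR (ka + s * l%:R) <=
      expR (K0 - (ka + (Gk + ep) * m%:R) - (ka + (Gk1 + ep) * l%:R)).
    apply: (@le_trans _ _ (expR 1 * expR (ka + s * l%:R))).
      by rewrite ler_wpM2r ?expR_ge0 //; have := expR_ge1Dx (1 : R); lra.
    rewrite -expRD ler_expR /K0 natrD; move: gapl; rewrite /de; lra.
  have -> : (s - be) * l%:R = s * l%:R - be * l%:R by ring.
  rewrite expRD expRN ler_pdivrMr ?expR_gt0 // [X in _ <= X]mulrC.
  have : expR (s * l%:R) <= expR (ka + s * l%:R) by rewrite ler_expR lerDr.
  move: low up two; set e1 := expR _; set e2 := expR (be * _) * _; set e3 := expR (ka + _); lra.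
have stretch (u : 'cV[R]_k0.+1) : expR ((s - be) * l%:R) * vnorm u <= vnorm (V *m Z *m u).
  have [->|u0] := eqVneq u 0; first by rewrite mulmx0 vnorm0 mulr0.
  have up := vnorm_gt0 u0; rewrite -ler_pdivlMr //.
  have := stretch1 ((vnorm u)^-1 *: u).
  rewrite -scalemxAr !vnormZ ger0_norm ?invr_ge0 ?vnorm_ge0 // mulVf ?gt_eqF // => /(_ erefl).
  by rewrite [X in _ -> _ <= X]mulrC.
have detVZ : expR ((s - be) * l%:R) ^+ k0.+1 <= `|\det (V *m Z)|.
  by apply: det_ge_expr => //; exact: expR_gt0.
have UX1 : `|\det (U *m X)| <= 1.
  apply: det_contraction => v; rewrite -mulmxA -(vnorm_orth v XX).
  by rewrite -{1}[U]trmxK; apply: vnorm_tr_le; rewrite trmxK.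
have VaX : V *m a m *m U^T *m (U *m X) = V *m Z *m T.
  have VaU : V *m a m *m U^T *m U = V *m a m.
    apply/eqP; rewrite eq_sym -subr_eq0; apply/eqP/matrixP => i j.
    have := equi (delta_mx j 0); rewrite !mulmxBr !mulmxA -mulmxBl -colE => /matrixP/(_ i 0).
    by rewrite [LHS]mxE [RHS]mxE => ->; rewrite mxE.
  by rewrite mulmxA VaU -!mulmxA ZT.
have : expR ((s - be) * l%:R) ^+ k0.+1 * expR (K0 - (ka + (Gk + ep) * l%:R)) <=
    `|\det (V *m a m *m U^T)|.
  apply: (@le_trans _ _ (`|\det (V *m Z)| * `|\det T|)).
    by apply: ler_pM => //; rewrite ?exprn_ge0 ?expR_ge0.
  by rewrite -normrM -det_mulmx -VaX det_mulmx normrM ler_piMr.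
apply: le_trans; rewrite -expRM_natl -expRD ler_expR /K0 natrD.
have h1 : L * l%:R <= L * (y + 1) by rewrite ler_wpM2l.
have h2 : L * y = (4 * ep * L / de) * m%:R + L * ((8 * ka + 4) / de).
  by rewrite /y; field; rewrite gt_eqF.
have h3 : (ep + 4 * ep * L / de) * m%:R <= ep' * m%:R by rewrite ler_wpM2r.
have h4 : - (k0.+1%:R * `|s - be|) * l%:R <= k0.+1%:R * (s - be) * l%:R.
  by rewrite ler_wpM2r // -mulrN ler_wpM2l //; have := ler_norm (- (s - be)); rewrite normrN; lra.
have h5 : 2 * ep * l%:R <= (de / 2) * l%:R by rewrite ler_wpM2r //; lra.
have h6 : L * l%:R = k0.+1%:R * `|s - be| * l%:R + (de / 2) * l%:R by rewrite /L mulrDl.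
rewrite [k0.+1%:R * ((s - be) * _)]mulrA; lra.
Qed.

End Angle.

Section SlowVectorLimit.
Variable R : realType.

Lemma orth_project d e j (B : 'M[R]_(e, d)) (Z : 'M[R]_(d, j)) (m : R) b : (j <= e)%N -> 0 < m ->
  (forall w, m * vnorm w <= vnorm (B *m (Z *m w))) ->
  exists w, (B *m Z)^T *m (B *m (b - Z *m w)) = 0 /\ vnorm (B *m (Z *m w)) <= vnorm (B *m b).
Proof.
move=> je m0 h; have [Z2 [T [ZZ E]]] := qr_decomp (B *m Z) je.
have uT : T \in unitmx.
  rewrite unitmxE unitfE -normr_gt0.
  apply: lt_le_trans (det_ge_expr m0 _); first exact: exprn_gt0.
  by move=> w; apply: (le_trans (h w)); rewrite mulmxA E -mulmxA vnorm_orth.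
exists (invmx T *m (Z2^T *m (B *m b))).
have BZw : B *m (Z *m (invmx T *m (Z2^T *m (B *m b)))) = Z2 *m (Z2^T *m (B *m b)).
  by rewrite mulmxA E -mulmxA mulKVmx.
split; last by rewrite BZw vnorm_orth // vnorm_tr_le.
have Z20 : Z2^T *m (B *m b - Z2 *m (Z2^T *m (B *m b))) = 0.
  by rewrite mulmxBr !mulmxA ZZ mul1mx subrr.
by rewrite mulmxBr BZw E trmx_mul -mulmxA Z20 mulmx0.
Qed.

Lemma geometric_start (C q : R) : 0 < C -> 0 < q -> q < 1 -> exists n, C * q ^+ n <= (1 - q) / 4.
Proof.
move=> C0 q0 q1; have q'1 : 1 < q^-1 by rewrite invf_gt1.
have [n hn] := bernoulli_unbounded (4 * C / (1 - q)) q'1; exists n.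
have p1 : 0 < 1 - q by lra.
have qn : 0 < q ^+ n by exact: exprn_gt0.
move: hn; rewrite exprVn ltr_pdivrMr // ltr_pdivlMl // => h.
by rewrite ler_pdivlMr //; lra.
Qed.

Lemma slow_vector_limit d k j (a : nat -> 'M[R]_d) (U : 'M[R]_(k, d)) (U3 : 'M[R]_((k + j).+1, d))
    (be ka si ta la rho : R) : (j <= d)%N ->
  (forall n v, vnorm (a n.+1 *m v) <= expR be * vnorm (a n *m v)) ->
  U3 *m U3^T = 1%:M -> si < ta -> si <= rho -> la - (ta - si) <= rho ->
  (forall n, exists Z : 'M[R]_(d, j), [/\ Z^T *m Z = 1%:M, U *m Z = 0,
     forall w, expR (- ka + ta * n%:R) * vnorm w <= vnorm (a n *m (Z *m w)) &
     forall b, U *m b = 0 -> (a n *m Z)^T *m (a n *m b) = 0 ->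
       vnorm (a n *m b) <= expR (ka + si * n%:R) * vnorm b]) ->
  (forall n b, U *m b = 0 -> vnorm (a n *m b) <= expR (ka + la * n%:R) * vnorm b) ->
  exists u, [/\ U3 *m u != 0, U *m u = 0 &
    exists K N, forall n, (N <= n)%N -> vnorm (a n *m u) <= K * expR (rho * n%:R)].
Proof.
move=> jd abe UU3 st sr lr /choice[Z hZ] hla.
pose q := expR (si - ta); pose C := expR (2 * ka + be - ta).
have q0 : 0 < q by exact: expR_gt0.
have q1 : q < 1 by rewrite /q -expR0 ltr_expR; lra.
have C0 : 0 < C by exact: expR_gt0.
have p1 : 0 < 1 - q by lra.
have [n0 hn0] := geometric_start C0 q0 q1.
pose adm n (b : 'cV[R]_d) := U *m b = 0 /\ (a n *m Z n)^T *m (a n *m b) = 0.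
have step n b : adm n b -> exists b', adm n.+1 b' /\ vnorm (b' - b) <= C * q ^+ n * vnorm b.
  move=> [Ub ab].
  have [ZZ UZ Zlo Zsi] := hZ n.+1.
  have [w [ow hw]] := orth_project b jd (expR_gt0 _) Zlo.
  exists (b - Z n.+1 *m w); split.
    by split => //; rewrite mulmxBr Ub mulmxA UZ mul0mx subrr.
  rewrite [X in vnorm X](_ : _ = - (Z n.+1 *m w)); last first.
    by rewrite addrAC subrr add0r.
  rewrite vnormN vnorm_orth //.
  have [_ _ _ hsi] := hZ n.
  have h1 : expR (- ka + ta * n.+1%:R) * vnorm w <= expR be * (expR (ka + si * n%:R) * vnorm b).
    apply: (le_trans (Zlo w)); apply: (le_trans hw); apply: (le_trans (abe n b)).
    by rewrite ler_wpM2l ?expR_ge0 //; apply: hsi.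
  rewrite -(ler_pM2l (expR_gt0 (- ka + ta * n.+1%:R))); apply: (le_trans h1).
  rewrite !mulrA -!expRD /C /q -expRM_natl -!expRD ler_wpM2r ?vnorm_ge0 // ler_expR -natr1; lra.
have [_ _ Zlo0 _] := hZ n0.
pose N0 := col_mx (U *m U3^T) ((a n0 *m Z n0)^T *m (a n0 *m U3^T)).
have [y y1 /eqP] := ker_unit N0 (ltnSn (k + j)).
rewrite mul_col_mx col_mx_eq0 -!mulmxA => /andP[/eqP Uy /eqP ay].
pose b0 := U3^T *m y.
have b01 : vnorm b0 = 1 by rewrite vnorm_orth // trmxK.
have /choice[nxt hnxt] : forall nb : nat * 'cV[R]_d, exists b', adm nb.1 nb.2 ->
    adm nb.1.+1 b' /\ vnorm (b' - nb.2) <= C * q ^+ nb.1 * vnorm nb.2.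
  move=> [n b]; have [h|h] := pselect (adm n b); last by exists 0 => /h.
  by have [b' hb'] := step n b h; exists b'.
pose bs := fix bs m := if m is m'.+1 then nxt ((n0 + m')%N, bs m') else b0.
have bs_adm m : adm (n0 + m)%N (bs m).
  elim: m => [|m IH]; first by rewrite addn0; split => //=; rewrite -?mulmxA.
  by rewrite addnS; exact: (hnxt (_, _) IH).1.
have bs_step m : vnorm (bs m.+1 - bs m) <= C * q ^+ (n0 + m) * vnorm (bs m).
  exact: (hnxt (_, _) (bs_adm m)).2.
pose D m := 2 * C * q ^+ (n0 + m) / (1 - q).
have D0 m : 0 <= D m by rewrite !mulr_ge0 ?exprn_ge0 ?invr_ge0 // ltW.
have Dhalf : D 0%N <= 1 / 2.
  by rewrite /D addn0 ler_pdivrMr //; lra.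
have Dstep m : D m.+1 + 2 * C * q ^+ (n0 + m) = D m.
  by rewrite /D addnS exprS; field; rewrite gt_eqF.
have bs_bound m : vnorm (bs m - b0) <= D 0%N - D m /\ vnorm (bs m) <= 2.
  elim: m => [|m [IH1 IH2]].
    by rewrite !subrr vnorm0 b01; split => //; lra.
  have h : vnorm (bs m.+1 - bs m) <= 2 * C * q ^+ (n0 + m).
    apply: (le_trans (bs_step m)); rewrite [2 * C]mulrC -[C * 2 * _]mulrA [2 * q ^+ _]mulrC mulrA.
    by rewrite ler_wpM2l // mulr_ge0 ?exprn_ge0 // ltW.
  have h1 : vnorm (bs m.+1 - b0) <= D 0%N - D m.+1.
    have -> : bs m.+1 - b0 = (bs m.+1 - bs m) + (bs m - b0) by rewrite addrA subrK.
    by apply: (le_trans (ler_vnormD _ _)); have := Dstep m; lra.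
  split => //; rewrite -[bs m.+1](subrK b0); apply: (le_trans (ler_vnormD _ _)).
  by rewrite b01; have := D0 m.+1; lra.
have bs_dist m p : vnorm (bs (m + p)%N - bs m) <= D m - D (m + p)%N.
  elim: p => [|p IH]; first by rewrite addn0 !subrr vnorm0.
  have h : vnorm (bs (m + p).+1 - bs (m + p)%N) <= 2 * C * q ^+ (n0 + (m + p)).
    apply: (le_trans (bs_step _)); rewrite [2 * C]mulrC -[C * 2 * _]mulrA [2 * q ^+ _]mulrC mulrA.
    by rewrite ler_wpM2l ?mulr_ge0 ?exprn_ge0 ?(ltW q0) ?(ltW C0) //; case: (bs_bound (m + p)%N).
  rewrite addnS.
  have -> : bs (m + p).+1 - bs m = (bs (m + p).+1 - bs (m + p)%N) + (bs (m + p)%N - bs m).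
    by rewrite addrA subrK.
  by apply: (le_trans (ler_vnormD _ _)); have := Dstep (m + p)%N; lra.
have [G [GU sG]] := ultraFilterLemma eventually_filter.
have GP := ultra_proper (UltraFilter := GU).
have hl i : exists l : R, bs m i 0 @[m --> G] --> l.
  apply: (@bounded_ultra_cvg R nat G _ 2) => m.
  by apply: (le_trans (ler_coord_vnorm _ _)); case: (bs_bound m).
pose u : 'cV[R]_d := \col_i sval (cid (hl i)).
have bu : mxcvg G bs u by move=> i i'; rewrite ord1 mxE; exact: svalP (cid (hl i)).
have udist m : vnorm (u - bs m) <= D m.
  have cv : vnorm (bs p - bs m) @[p --> G] --> vnorm (u - bs m).
    by apply: mxcvg_vnorm; apply: mxcvgB => //; exact: mxcvg_cst.
  apply: (cvgr_to_le cv); apply: sG; exists m => // p /= mp.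
  rewrite -(subnKC mp); apply: (le_trans (bs_dist m _)).
  by have := D0 (m + (p - m))%N; lra.
have Uu0 : U *m u = 0.
  apply/matrixP => i i'.
  have cv : (U *m bs m) i i' @[m --> G] --> (U *m u) i i'.
    by apply: mxcvg_mul => //; exact: mxcvg_cst.
  have cv0 : (U *m bs m) i i' @[m --> G] --> (0 : 'cV[R]_k) i i'.
    by under eq_fun do rewrite (bs_adm _).1; exact: cvg_cst.
  exact: cvg_unique _ cv cv0.
exists u; split.
- apply/negP => /eqP U3u.
  have : vnorm (U3 *m (u - b0)) <= 1 / 2.
    apply: (@le_trans _ _ (vnorm (u - b0))); last exact: le_trans (udist 0%N) Dhalf.
    by rewrite -{1}[U3]trmxK; apply: vnorm_tr_le; rewrite trmxK.
  by rewrite mulmxBr U3u /b0 mulmxA UU3 mul1mx sub0r vnormN y1; lra.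
- by [].
- pose K2 := 2 * C / (1 - q).
  exists (2 * expR ka + expR ka * K2), n0 => n n0n.
  have nE : n = (n0 + (n - n0))%N by rewrite subnKC.
  set m := (n - n0)%N in nE.
  rewrite -[u](subrK (bs m)) mulmxDr; apply: (le_trans (ler_vnormD _ _)).
  rewrite mulrDl addrC; apply: lerD.
    have [_ _ _ hsi] := hZ n; have [Ub ab] := bs_adm m; rewrite -nE in ab.
    apply: (le_trans (hsi _ Ub ab)); rewrite expRD.
    apply: (@le_trans _ _ (expR ka * expR (rho * n%:R) * 2)); last by rewrite le_eqVlt; apply/orP; left; apply/eqP; ring.
    apply: ler_pM; rewrite ?vnorm_ge0 ?mulr_ge0 ?expR_ge0 //; last by case: (bs_bound m).
    by rewrite ler_wpM2l ?expR_ge0 // ler_expR ler_wpM2r.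
  have Uu : U *m (u - bs m) = 0 by rewrite mulmxBr Uu0 (bs_adm m).1 subrr.
  apply: (le_trans (hla n _ Uu)).
  apply: (@le_trans _ _ (expR (ka + la * n%:R) * D m)); first by rewrite ler_wpM2l ?expR_ge0.
  have -> : D m = K2 * expR ((si - ta) * n%:R).
    by rewrite /D -nE /q -expRM_natl /K2 [n%:R * _]mulrC; ring.
  have K20 : 0 <= K2 by rewrite /K2 !mulr_ge0 ?invr_ge0 ?(ltW C0) ?(ltW p1).
  move: (K2) K20 => K3 K30.
  rewrite expRD -!mulrA ler_wpM2l ?expR_ge0 // mulrCA ler_wpM2l //.
  by rewrite -expRD ler_expR -mulrDl ler_wpM2r //; lra.
Qed.

End SlowVectorLimit.

(** * Volume growth along typical orbits *)

Section System.
Variables (R : realType) (M : pointedType) (dist : M -> M -> R) (f : M -> M).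
Variables (mu : {measure set (g_sigma_algebraType (mopen dist)) -> \bar R}).
Variables (d : nat) (A : M -> 'M[R]_d) (gamma : 'I_d -> \bar R) (be : R).
Hypothesis dist_metric : is_metric dist.
Hypothesis mu1 : mu setT = 1%E.
Hypothesis f_cont : mcontinuous dist f.
Hypothesis f_inv : invariant_measure f mu.
Hypothesis f_erg : ergodic_measure f mu.
Hypothesis A_cont : forall x, mxcvg (mnbhs dist x) A (A x).
Hypothesis be_ge0 : 0 <= be.
Hypothesis A_bound : forall x v, vnorm (A x *m v) <= expR be * vnorm v.
Hypothesis gamma_mono : forall i j : 'I_d, (i <= j)%N -> (gamma j <= gamma i)%E.
Hypothesis ae_basis : {ae mu, forall x, exists P, lyap_basis f A x gamma P}.

Local Notation "'An'" := (cocycle f A).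

Lemma cocycle_bound n x v : vnorm (An n x *m v) <= expR (be * n%:R) * vnorm v.
Proof.
elim: n => [|n IH]; first by rewrite mulr0 expR0 mul1r mul1mx.
rewrite /= -mulmxA; apply: (le_trans (A_bound _ _)).
have -> : expR (be * n.+1%:R) = expR be * expR (be * n%:R).
  by rewrite -expRD -natr1; congr expR; ring.
by rewrite -mulrA ler_wpM2l ?expR_ge0.
Qed.

Definition regular x := forall n, exists P, lyap_basis f A (iter n f x) gamma P.

Lemma regular_iter n x : regular x -> regular (iter n f x).
Proof. by move=> h m; rewrite -iterD; exact: h. Qed.

Let mf (S : set (g_sigma_algebraType (mopen dist))) : measurable S ->
  measurable (f @^-1` S : set (g_sigma_algebraType (mopen dist))).
Proof. exact: measurable_preimage_mcont. Qed.

Lemma ae_regular : {ae mu, forall x, regular x}.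
Proof. exact: (ae_iter mf f_inv ae_basis). Qed.

Variable c : nat -> R.
Definition psum r := \sum_(i < r) c i.
Definition finite_upto r := (r <= d)%N /\ forall i : 'I_d, (i < r)%N -> gamma i = (c i)%:E.

Lemma finite_uptoW r r' : (r <= r')%N -> finite_upto r' -> finite_upto r.
Proof.
move=> rr' [rd h]; split; first exact: leq_trans rd.
by move=> i ir; apply: h; exact: leq_trans rr'.
Qed.

Lemma le_expR_bound (K : R) (g h : nat -> R) : (forall n, g n <= K * expR (h n)) ->
  exists ka : nat, forall q n, (ka <= q)%N -> g n <= expR (q%:R + h n).
Proof.
move=> gK; exists (Num.bound (`|K|)) => q n kq; apply: (le_trans (gK n)).
rewrite expRD ler_wpM2r ?expR_ge0 //; apply: (le_trans (ler_norm K)).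
apply: (le_trans (ltW (archi_boundP (normr_ge0 K)))).
by apply: le_trans (expR_ge1Dx _); rewrite -[X in X <= _]add0r lerD // ler_nat.
Qed.

Lemma Nvol_upper_psum r x ep : finite_upto r -> 0 < ep -> regular x ->
  exists ka : nat, forall q n, (ka <= q)%N -> Nvol r (An n x) <= expR (q%:R + (psum r + ep) * n%:R).
Proof.
move=> [rd fin] ep0 /(_ 0%N)[P /= hP].
have [|K hK] := Nvol_upper hP gamma_mono (r := r) (c := fun i => c i + ep / r.+1%:R) rd.
  by move=> i ir; rewrite fin // lte_fin ltrDl divr_gt0.
apply: (le_expR_bound (K := K)) => n; apply: (le_trans (hK n)).
have K0 : 0 <= K.
  by have := hK 0%N; rewrite mulr0 expR0 mulr1; apply: le_trans; exact: Nvol_ge0.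
rewrite ler_wpM2l // ler_expR ler_wpM2r // big_split /= lerD2l sumr_const card_ord.
rewrite -[X in X <= _]mulr_natr -mulrA ler_piMr ?(ltW ep0) // mulrC ler_pdivrMr //.
by rewrite mul1r ler_nat.
Qed.

Definition Nvol_lower r := forall ep, 0 < ep ->
  {ae mu, forall x, exists ka, forall n, expR (- ka + (psum r - ep) * n%:R) <= Nvol r (An n x)}.

Definition is_frame k s x (U : 'M[R]_(k, d)) :=
  U *m U^T = 1%:M /\ forall v, U *m v = 0 <-> grows_le f A s x v.

Definition exponent_gap k s t := [/\ (k <= d)%N, s < t,
  (forall i : 'I_d, (k <= i)%N -> (gamma i < s%:E)%E) &
  (forall i : 'I_d, (i < k)%N -> (t%:E < gamma i)%E)].

Lemma slow_frame_grows k s K x (U : 'M[R]_(k, d)) v :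
  slow_frame f A s K x U -> U *m v = 0 -> grows_le f A s x v.
Proof.
move=> [_ h] Uv; exists (K * vnorm v) => n.
by have := h n v; rewrite Uv mulmx0 subr0 mulrAC.
Qed.

Lemma is_frame_exists k s t x : exponent_gap k s t -> regular x ->
  exists U : 'M[R]_(k, d), exists2 K, slow_frame f A s K x U & is_frame s x U.
Proof.
move=> [kd st gs gt] /(_ 0%N)[P /= hP].
have [U [K sU hU]] := slow_frame_exists hP kd st gs gt.
exists U, K => //; split; first by case: sU.
move=> v; split; first exact: slow_frame_grows sU.
by move=> gv; apply: (hU _ s) => //; exact: ltW.
Qed.

Lemma frame_comp k s n x (U V : 'M[R]_(k, d)) : is_frame s x U -> is_frame s (iter n f x) V ->
  forall v : 'cV[R]_d, V *m (An n x *m (v - U^T *m (U *m v))) = 0.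
Proof.
move=> [UU hU] [_ hV] v; apply/hV.
have : grows_le f A s x (v - U^T *m (U *m v)).
  by apply/hU; rewrite mulmxBr !mulmxA UU mul1mx subrr.
elim: n {hV} => [|n IH] g; first by rewrite mul1mx.
by rewrite /= -mulmxA; apply: grows_le_step; exact: IH.
Qed.

Lemma frame_mul k s n x (U V : 'M[R]_(k, d)) : is_frame s x U -> is_frame s (iter n f x) V ->
  V *m An n x *m U^T *m U = V *m An n x.
Proof.
move=> hU hV; apply/eqP; rewrite eq_sym -subr_eq0; apply/eqP/matrixP => i j.
have := frame_comp hU hV (delta_mx j 0).
rewrite !mulmxBr !mulmxA -mulmxBl -colE => /matrixP/(_ i 0).
by rewrite [LHS]mxE [RHS]mxE => ->; rewrite mxE.
Qed.

Definition frame_det k n x (U V : 'M[R]_(k, d)) := `|\det (V *m An n x *m U^T)|.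

Lemma frame_detD k s n m x (U V W : 'M[R]_(k, d)) : is_frame s x U -> is_frame s (iter n f x) V ->
  is_frame s (iter (n + m) f x) W ->
  frame_det (n + m) x U W = frame_det m (iter n f x) V W * frame_det n x U V.
Proof.
move=> hU hV hW; rewrite /frame_det -normrM -det_mulmx; congr `|\det _|.
rewrite addnC iterD in hW.
by rewrite !mulmxA (frame_mul hV hW) cocycleD !mulmxA.
Qed.

Lemma frame_det_upper k s n x (U V : 'M[R]_(k, d)) : is_frame s x U -> is_frame s (iter n f x) V ->
  frame_det n x U V <= expR (k%:R * be * n%:R).
Proof.
move=> [UU _] [VV _]; rewrite -mulrA expRM_natl; apply: det_le_expr; first exact: expR_ge0.
move=> v; rewrite -!mulmxA -{1}[V]trmxK.
apply: (le_trans (vnorm_tr_le _ _)); first by rewrite trmxK.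
by apply: (le_trans (cocycle_bound _ _ _)); rewrite vnorm_orth // trmxK.
Qed.

Section Good.
Variables (k0 : nat) (s t ep : R).
Let k := k0.+1.
Hypothesis gap : exponent_gap k s t.
Hypothesis fin : finite_upto k.
Hypothesis ep0 : 0 < ep.

Definition good (q : nat) : set (g_sigma_algebraType (mopen dist)) :=
  [set x | [/\ exists U : 'M[R]_(k, d), slow_frame f A s (expR q%:R) x U,
     forall n, Nvol k (An n x) <= expR (q%:R + (psum k + ep) * n%:R),
     forall n, Nvol k0 (An n x) <= expR (q%:R + (psum k0 + ep) * n%:R) &
     forall n, ~ (Nvol k (An n x) <= expR (- q%:R + (psum k - ep) * n%:R))]].

Lemma measurable_good q : measurable (good q).
Proof.
have kd : (k <= d)%N by case: gap.
have -> : good q = [set x | exists U : 'M[R]_(k, d), slow_frame f A s (expR q%:R) x U] `&`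
    (\bigcap_n [set x | Nvol k (An n x) <= expR (q%:R + (psum k + ep) * n%:R)]) `&`
    (\bigcap_n [set x | Nvol k0 (An n x) <= expR (q%:R + (psum k0 + ep) * n%:R)]) `&`
    (\bigcap_n ~` [set x | Nvol k (An n x) <= expR (- q%:R + (psum k - ep) * n%:R)]).
  apply/seteqP; split => x.
    by move=> [h1 h2 h3 h4]; split; [split; [split => // n _ | move=> n _] | move=> n _]; [exact: h2 | exact: h3 | exact: h4].
  by move=> [[[h1 h2] h3] h4]; split => // n; [exact: h2 | exact: h3 | exact: h4].
apply: measurableI; first (apply: measurableI; first apply: measurableI).
- exact: measurable_slow_frame.
- by apply: bigcapT_measurable => n; apply: measurable_Nvol_cocycle.
- by apply: bigcapT_measurable => n; apply: measurable_Nvol_cocycle => //; exact: ltnW.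
- by apply: bigcapT_measurable => n; apply: measurableC; apply: measurable_Nvol_cocycle.
Qed.

Lemma good_mono q q' : (q <= q')%N -> good q `<=` good q'.
Proof.
move=> qq'; have qR : q%:R <= q'%:R :> R by rewrite ler_nat.
move=> x [[U [UU hU]] h2 h3 h4]; split.
- exists U; split => // n v; apply: (le_trans (hU n v)).
  by rewrite ler_wpM2r ?vnorm_ge0 // ler_wpM2r ?expR_ge0 // ler_expR.
- by move=> n; apply: (le_trans (h2 n)); rewrite ler_expR lerD2r.
- by move=> n; apply: (le_trans (h3 n)); rewrite ler_expR lerD2r.
- move=> n h; apply: (h4 n); apply: (le_trans h).
  by rewrite ler_expR lerD2r lerN2.
Qed.

Lemma ae_good : Nvol_lower k -> {ae mu, forall x, exists q, good q x}.
Proof.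
move=> low; have low' := low ep ep0.
have reg := ae_regular.
near=> x; have rx : regular x by near: x.
have [ka hka] : exists ka, forall n, expR (- ka + (psum k - ep) * n%:R) <= Nvol k (An n x) by near: x.
have [U [K [UU sU] _]] := is_frame_exists gap rx.
have [q1 hq1] := Nvol_upper_psum fin ep0 rx.
have [q2 hq2] := Nvol_upper_psum (finite_uptoW (leqnSn k0) fin) ep0 rx.
pose q3 := (Num.bound (`|ka| + 1)); pose q4 := Num.bound (`|K|).
exists (maxn (maxn q1 q2) (maxn q3 q4)); split.
- exists U; split => // n v; apply: (le_trans (sU n v)).
  rewrite ler_wpM2r ?vnorm_ge0 // ler_wpM2r ?expR_ge0 //.
  apply: (le_trans (ler_norm K)); apply: (le_trans (ltW (archi_boundP (normr_ge0 K)))).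
  apply: le_trans (expR_ge1Dx _); rewrite -[X in X <= _]add0r lerD // ler_nat.
  by rewrite (leq_trans (leq_maxr q3 _)) ?leq_maxr.
- by move=> n; apply: hq1; rewrite (leq_trans (leq_maxl _ q2)) ?leq_maxl.
- by move=> n; apply: hq2; rewrite (leq_trans (leq_maxr q1 _)) ?leq_maxl.
- move=> n; apply/negP; rewrite -ltNge; apply: lt_le_trans (hka n).
  rewrite ltr_expR ltrD2r ltrN2.
  have q3m : q3%:R <= (maxn (maxn q1 q2) (maxn q3 q4))%:R :> R.
    by rewrite ler_nat (leq_trans (leq_maxl _ q4)) ?leq_maxr.
  apply: lt_le_trans q3m; apply: le_lt_trans (ler_norm ka) _.
  have b0 : 0 <= `|ka| + 1 by rewrite addr_ge0.
  by apply: lt_trans (archi_boundP b0); rewrite ltrDl.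
Unshelve. all: by end_near.
Qed.

Lemma good_frame q x : regular x -> good q x ->
  exists2 U : 'M[R]_(k, d), slow_frame f A s (expR q%:R) x U & is_frame s x U.
Proof.
move=> rx [[U sU] _ _ _]; exists U => //; split; first by case: sU.
have [V [K sV [VV hV]]] := is_frame_exists gap rx.
have VU : V^T *m V = U^T *m U.
  apply: frame_proj_eq => //; first by case: sU.
  by move=> v Uv; apply/hV; exact: slow_frame_grows sU Uv.
move=> v; split; first exact: slow_frame_grows sU.
move/hV => Vv; case: sU => UU _.
by rewrite -[U]mul1mx -UU -!mulmxA (mulmxA U^T) -VU -mulmxA Vv !mulmx0.
Qed.

End Good.

Local Notation MT := (g_sigma_algebraType (mopen dist)).
Local Notation vis := (@visits _ MT f).

Lemma visits_full (B : set MT) n m L x : (n + L <= m)%N ->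
  (forall u, (n <= u < n + L)%N -> B (iter u f x)) -> (L <= vis B m x)%N.
Proof.
move=> nL h; rewrite -(subnKC nL) (@visitsD _ MT f) (leq_trans _ (leq_addr _ _)) // (@visitsD _ MT f).
rewrite (leq_trans _ (leq_addl _ _)) // (@visits_shift _ MT f).
rewrite big_nat (eq_bigr (fun=> 1%N)) => [|u hu]; last by rewrite mem_set //; exact: h.
by rewrite -big_nat sum_nat_const_nat addKn muln1.
Qed.

Lemma next_good_time (B : set MT) (eta : R) x n : 0 < eta -> eta <= 1 / 2 ->
  (forall n, (0 < n)%N -> (vis B n x)%:R < eta * n%:R) ->
  exists j : nat, ~ B (iter (n + j) f x) /\ j%:R <= 2 * eta * n%:R.
Proof.
move=> eta0 eta2 hv; pose L := (Num.truncn (2 * eta * n%:R)).+1.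
have y0 : 0 <= 2 * eta * n%:R by rewrite !mulr_ge0 // ltW.
have /andP[h1 h2] := truncn_itv y0.
apply: contrapT => hn.
have all_bad u : (n <= u < n + L)%N -> B (iter u f x).
  move=> /andP[nu uL]; apply: contrapT => nB; apply: hn; exists (u - n)%N.
  rewrite subnKC //; split => //; apply: le_trans h1; rewrite ler_nat -ltnS.
  by rewrite ltn_subLR.
have := visits_full (leqnn (n + L)%N) all_bad.
rewrite -(ler_nat R) => hL.
have nL : (0 < n + L)%N by rewrite addnS.
have := hv _ nL; rewrite natrD => hlt.
have h3 : 2 * eta * n%:R < L%:R by [].
have h4 : eta * L%:R <= 1 / 2 * L%:R by rewrite ler_wpM2r.
by rewrite mulrDr in hlt; lra.
Qed.

Lemma frame_det_eqr j s n x (U V V' : 'M[R]_(j, d)) :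
  is_frame s (iter n f x) V -> is_frame s (iter n f x) V' ->
  frame_det n x U V = frame_det n x U V'.
Proof.
move=> [VV hV] [VV' hV'].
have e : V'^T *m V' = V^T *m V by apply: frame_proj_eq => // v /hV/hV'.
pose O := V *m V'^T.
have VE : V = O *m V' by rewrite /O -mulmxA e mulmxA VV mul1mx.
have OO : O *m O^T = 1%:M by rewrite /O trmx_mul trmxK mulmxA -(mulmxA V) e mulmxA VV mul1mx.
have := congr1 (fun B => \det B) OO; rewrite det_mulmx det_tr det1 -expr2 => h.
have O1 : `|\det O| = 1.
  by apply/eqP; rewrite -(eqrXn2 (n := 2)) // expr1n real_normK ?num_real // h.
rewrite /frame_det; have -> : V *m An n x *m U^T = O *m (V' *m An n x *m U^T) by rewrite {1}VE !mulmxA.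
by rewrite det_mulmx normrM O1 mul1r.
Qed.

Section FrameDet.
Variables (k0 : nat) (s t : R).
Let k := k0.+1.
Hypothesis gap : exponent_gap k s t.
Hypothesis fin : finite_upto k.

Lemma gap_psum : s < psum k - psum k0.
Proof.
have [kd st _ gt] := gap; rewrite /psum big_ord_recr /= [X in _ < X]addrC addKr.
have [_ fk] := fin; have := gt (Ordinal kd) (ltnSn k0); rewrite fk // lte_fin.
exact: lt_trans.
Qed.

Lemma good_frame_det ep' : 0 < ep' -> exists2 ep0, 0 < ep0 &
  forall ep, 0 < ep -> ep <= ep0 -> forall q : nat, exists ka', forall x m (U V : 'M[R]_(k, d)),
    regular x -> good k0 s ep q x -> good k0 s ep q (iter m f x) ->
    is_frame s x U -> is_frame s (iter m f x) V ->
    expR (- ka' + (psum k - ep') * m%:R) <= frame_det m x U V.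
Proof.
move=> ep'0; have [kd _ _ _] := gap.
have [ep0 ep0_gt0 H] := @frame_det_lower R d k0 (psum k) (psum k0) s be ep' kd gap_psum ep'0.
exists ep0 => // ep e0 e1 q; have [ka' hka'] := H ep e0 e1 q%:R (ler0n _ _).
exists ka' => x m U V rx gx gy hU hV.
have [V' sV' hV'] := good_frame gap (regular_iter m rx) gy.
have -> : frame_det m x U V = frame_det m x U V'.
  exact: frame_det_eqr hV hV'.
apply: (hka' (fun n => An n x) (fun n => An n (iter m f x))).
- by move=> l; rewrite cocycleD.
- by move=> l v; exact: cocycle_bound.
- by case: hU.
- by case: hV'.
- exact: (frame_comp hU hV').
- move=> n v; apply: (le_trans (sV'.2 n v)); by rewrite expRD.
- by case: gx.
- by case: gy.
- by case: gy.
- by move=> n; case: gx => _ _ _ /(_ n)/negP; rewrite -ltNge => /ltW.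
Qed.

End FrameDet.

Lemma frame_det0 n x (U V : 'M[R]_(0, d)) : @frame_det 0 n x U V = 1.
Proof. by rewrite /frame_det det_mx00 normr1. Qed.

Lemma ae_frame_det k s t ep' : exponent_gap k s t -> finite_upto k -> Nvol_lower k -> 0 < ep' ->
  {ae mu, forall x : MT, exists ka, forall n (U V : 'M[R]_(k, d)),
    is_frame s x U -> is_frame s (iter n f x) V ->
    expR (- ka + (psum k - ep') * n%:R) <= frame_det n x U V}.
Proof.
case: k => [|k0] gap fin low ep'0.
  apply: nearW => x; exists 0 => n U V _ _; rewrite frame_det0 -[X in _ <= X]expR0 ler_expR.
  by rewrite /psum big_ord0 oppr0 add0r sub0r mulNr oppr_le0 mulr_ge0 // ltW.
have e2 : 0 < ep' / 2 by lra.
have [ep0 ep0_gt0 H] := good_frame_det gap fin e2.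
pose L := `|psum k0.+1 - ep' / 2| + k0.+1%:R * be + 1.
have L0 : 0 < L by rewrite ltr_wpDl // addr_ge0 // mulr_ge0.
pose eta := Num.min (1 / 2) (ep' / (4 * L)).
have eta0 : 0 < eta by rewrite /eta lt_min !divr_gt0 // mulr_gt0.
have eta_half : eta <= 1 / 2 by rewrite /eta ge_min lexx.
have etaL : 2 * eta * L <= ep' / 2.
  have : eta <= ep' / (4 * L) by rewrite /eta ge_min lexx orbT.
  by rewrite ler_pdivlMr ?mulr_gt0 //; lra.
have rare := ae_rarely mu1 mf f_inv eta0
  (fun q => measurableC (measurable_good ep0 gap q))
  (fun q => subsetC (good_mono (leqnSn q)))
  (filterS (fun x h => let: ex_intro q g := h in ex_intro _ q (fun ng => ng g)) (ae_good gap fin ep0_gt0 low)).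
have reg := ae_regular.
near=> x; have rx : regular x by near: x.
have [q hq] : exists q, forall n, (0 < n)%N -> (vis (~` good k0 s ep0 q) n x)%:R < eta * n%:R by near: x; exact: rare.
have gx : good k0 s ep0 q x.
  have := hq 1%N isT; rewrite /visits big_nat1 /= mulr1 => h; apply: contrapT => ng.
  by move: h; rewrite mem_set //= ; lra.
have [ka' hka'] := H ep0 ep0_gt0 (lexx _) q; exists ka' => n U V hU hV.
have [j [/contrapT gj hj]] := next_good_time n eta0 eta_half hq.
have [W [K sW hW]] := is_frame_exists gap (regular_iter (n + j) rx).
have h1 := hka' x (n + j)%N U W rx gx gj hU hW.
rewrite (frame_detD hU hV hW) in h1.
rewrite addnC iterD in hW.
have h2 := frame_det_upper hV hW.
have V0 : 0 <= frame_det n x U V by exact: normr_ge0.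
have {}h1 := le_trans h1 (ler_wpM2r V0 h2).
rewrite -ler_pdivrMl ?expR_gt0 // -expRN -expRD in h1.
apply: le_trans h1; rewrite ler_expR natrD.
have hL : L * j%:R <= ep' / 2 * n%:R.
  apply: (@le_trans _ _ (L * (2 * eta * n%:R))); first by rewrite ler_wpM2l // ltW.
  by have := ler_wpM2r (ler0n R n) etaL; lra.
have h3 : - `|psum k0.+1 - ep' / 2| * j%:R <= (psum k0.+1 - ep' / 2) * j%:R.
  by rewrite ler_wpM2r // lerNl; have := ler_norm (- (psum k0.+1 - ep' / 2)); rewrite normrN.
have j0 : 0 <= j%:R :> R by [].
move: hL h3; rewrite /L; lra.
Unshelve. all: by end_near.
Qed.

Lemma core_point k j s t la Gk c1 (x : M) : let ep := c1 / (4 * (j%:R + 6)) in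
  0 < c1 -> regular x -> exponent_gap k s t -> ((k + j).+1 <= d)%N -> s <= la + ep ->
  (forall i : 'I_d, (i <= k + j)%N -> (la%:E <= gamma i)%E) ->
  (exists ka, forall n, Nvol k (An n x) <= expR (ka + (Gk + ep) * n%:R)) ->
  (exists ka, forall n, expR (- ka + (Gk + j%:R * la - ep) * n%:R) <= Nvol (j + k) (An n x)) ->
  (exists ka, forall n (U V : 'M[R]_(k, d)), is_frame s x U -> is_frame s (iter n f x) V ->
    expR (- ka + (Gk - ep) * n%:R) <= frame_det n x U V) ->
  (exists ka, forall n, Nvol (k + j).+1 (An n x) <= expR (ka + (Gk + j%:R * la + la - c1) * n%:R)) ->
  False.
Proof.
move=> ep c10 rx gap kjd sla hla [ka2 a2] [ka3 a3] [ka4 a4] [ka5 a5].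
have j0 : 0 <= j%:R :> R by [].
have epE : (j%:R + 6) * ep = c1 / 4 by rewrite /ep; field; lra.
have ep0 : 0 < ep by rewrite /ep divr_gt0 //; lra.
have ep6 : 6 * ep <= c1 / 4 by rewrite -epE ler_wpM2r ?(ltW ep0) //; lra.
have [U [K1 [UU sU] hU]] := is_frame_exists gap rx.
have [P /= hP] := rx 0%N.
have [U3 [UU3 _ U3z]] := kernel_frame hP kjd.
pose ka := `|K1| + `|ka2| + `|ka3| + `|ka4| + `|ka5|.
have ka0 : 0 <= ka by rewrite !addr_ge0.
have [k1 k2 k3 k4 k5] : [/\ `|K1| <= ka, ka2 <= ka, ka3 <= ka, ka4 <= ka & ka5 <= ka].
  have := normr_ge0 K1; have := ler_norm ka2; have := ler_norm ka3; have := ler_norm ka4; have := ler_norm ka5.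
  have := normr_ge0 ka2; have := normr_ge0 ka3; have := normr_ge0 ka4; have := normr_ge0 ka5.
  by rewrite /ka; split; lra.
have slow n (b : 'cV[R]_d) : U *m b = 0 -> vnorm (An n x *m b) <= expR (ka + (la + ep) * n%:R) * vnorm b.
  move=> Ub; have := sU n b; rewrite Ub mulmx0 subr0 => /le_trans; apply.
  rewrite ler_wpM2r ?vnorm_ge0 // expRD.
  apply: (@le_trans _ _ (expR ka * expR (s * n%:R))).
    rewrite ler_wpM2r ?expR_ge0 //; apply: (le_trans (ler_norm _)); apply: (le_trans k1).
    by apply: le_trans (expR_ge1Dx _); rewrite lerDr.
  by rewrite ler_wpM2l ?expR_ge0 // ler_expR ler_wpM2r.
pose kap := (j%:R + 4) * ka + 1.
have kap4 : 4 * ka + 1 <= kap by rewrite /kap; have := mulr_ge0 j0 ka0; lra.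
have frames n : exists2 V : 'M[R]_(k, d), is_frame s (iter n f x) V & V *m V^T = 1%:M.
  have [V [K' _ hV]] := is_frame_exists gap (regular_iter n rx).
  by exists V => //; case: hV.
have [|n v|||||n|u [U3u _ [K [N hN]]]] :=
  @slow_vector_limit R d k j (fun n => An n x) U U3 be kap (la - c1 + 3 * ep) (la - (j%:R + 2) * ep)
    (la + ep) (la - c1 / 2) _ _ UU3 _ _ _ _ _.
- by rewrite (leq_trans _ kjd) // (leq_trans (leq_addl k j)).
- by rewrite /= -mulmxA; exact: A_bound.
- by lra.
- by lra.
- by lra.
- move=> n.
  have jkd : (j + k <= d)%N by rewrite addnC ltnW.
  have [|X XX hX] := @Nvol_adherent R (j + k) d jkd (An n x) (expR (- ka - 1 + (Gk + j%:R * la - ep) * n%:R)).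
    apply: lt_le_trans (a3 n); rewrite ltr_expR; lra.
  have [Z [ZZ UZ hZ]] := vol_restrict_kernel U (An n x) jkd XX.
  have volZ : expR (- 2 * ka - 1 + (j%:R * la - 2 * ep) * n%:R) <= vol (An n x *m Z).
    rewrite -(ler_pM2r (expR_gt0 (ka + (Gk + ep) * n%:R))).
    apply: (@le_trans _ _ (expR (- ka - 1 + (Gk + j%:R * la - ep) * n%:R))).
      by rewrite -expRD ler_expR; lra.
    apply: (le_trans (ltW hX)); apply: (le_trans hZ); rewrite ler_wpM2l ?vol_ge0 //.
    by apply: (le_trans (a2 n)); rewrite ler_expR lerD2r.
  have slowZ v : vnorm (An n x *m Z *m v) <= expR (ka + (la + ep) * n%:R) * vnorm v.
    rewrite -mulmxA -(vnorm_orth v ZZ); apply: slow.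
    by rewrite mulmxA UZ mul0mx.
  have jd : (j <= d)%N by exact: leq_trans (leq_addr k j) jkd.
  exists Z; split => //.
  + move=> w; have h := vol_min_stretch_scale w jd (expR_ge0 _) slowZ.
    rewrite -expRM_natl in h.
    have {}h : expR (- 2 * ka - 1 + (j%:R * la - 2 * ep) * n%:R) * expR (ka + (la + ep) * n%:R) * vnorm w
        <= vnorm (An n x *m Z *m w) * expR (j%:R * (ka + (la + ep) * n%:R)).
      by apply: le_trans h; rewrite !ler_wpM2r ?vnorm_ge0 ?expR_ge0.
    rewrite mulmxA -(ler_pM2r (expR_gt0 (j%:R * (ka + (la + ep) * n%:R)))).
    apply: le_trans h; rewrite mulrAC -!expRD ler_wpM2r ?vnorm_ge0 // ler_expR.
    have nep : 0 <= ep * n%:R by rewrite mulr_ge0 // ltW.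
    by have := mulr_ge0 j0 ka0; rewrite /kap; lra.
  + move=> b Ub ob.
    have [V hV VV] := frames n.
    have e : (k + (j + 1))%N = (k + j).+1 by rewrite addn1 addnS.
    have kjd' : (k + (j + 1) <= d)%N by rewrite e.
    pose Y := row_mx Z b; pose W := row_mx U^T Y.
    have volW : vol W <= vnorm b.
      apply: (le_trans (vol_fischer _ _ kjd')); rewrite (vol_orth (Z := U^T)) ?trmxK // mul1r.
      apply: le_trans (vol_fischer _ _ _) _; first by rewrite (leq_trans _ kjd') // leq_addl.
      by rewrite (vol_orth ZZ) mul1r vol_col.
    have VAY : V *m (An n x *m Y) = 0.
      have VA0 m (y : 'M[R]_(d, m)) : U *m y = 0 -> V *m (An n x *m y) = 0.
        by move=> Uy; rewrite mulmxA -(frame_mul hU hV) -!mulmxA Uy !mulmx0.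
      by apply: VA0; rewrite mul_mx_row UZ Ub row_mx0.
    have volAW : frame_det n x U V * (vol (An n x *m Z) * vnorm (An n x *m b)) <=
        Nvol (k + (j + 1)) (An n x) * vol W.
      apply: le_trans (vol_mul_le_Nvol kjd' _ _); rewrite mul_mx_row.
      have := vol_transverse (An n x *m U^T) kjd' VV VAY; rewrite mulmxA.
      apply: le_trans; rewrite /frame_det ler_wpM2l // mul_mx_row vol_orthcat // vol_col //.
    have low : expR (- ka + (Gk - ep) * n%:R) * (expR (- 2 * ka - 1 + (j%:R * la - 2 * ep) * n%:R)
        * vnorm (An n x *m b)) <= expR (ka + (Gk + j%:R * la + la - c1) * n%:R) * vnorm b.
      apply: (@le_trans _ _ (frame_det n x U V * (vol (An n x *m Z) * vnorm (An n x *m b)))).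
        apply: ler_pM; rewrite ?mulr_ge0 ?expR_ge0 ?vnorm_ge0 //.
          by apply: le_trans (a4 n U V hU hV); rewrite ler_expR lerD2r lerN2.
        by rewrite ler_wpM2r ?vnorm_ge0.
      apply: (le_trans volAW); apply: ler_pM; rewrite ?vol_ge0 //.
        by apply: Nvol_ge0; rewrite -e in kjd.
      by rewrite e; apply: (le_trans (a5 n)); rewrite ler_expR lerD2r.
    rewrite mulrA -expRD -ler_pdivlMl ?expR_gt0 // -expRN mulrA -expRD in low.
    apply: (le_trans low); rewrite ler_wpM2r ?vnorm_ge0 // ler_expR.
    by move: kap4; lra.
- move=> b Ub; apply: (le_trans (slow n b Ub)).
  by rewrite ler_wpM2r ?vnorm_ge0 // ler_expR; have := mulr_ge0 j0 ka0; lra.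
have K0 : 0 < `|K| + 1 by rewrite ltr_wpDl.
have [||K2 _ hK2] := @eventually_le_bound R (fun n => vnorm (An n x *m u))
    (fun n => (`|K| + 1) * expR ((la - c1 / 2) * n%:R)).
- by move=> n; rewrite mulr_gt0 ?expR_gt0.
- exists N => n Nn; apply: (le_trans (hN n Nn)).
  by rewrite ler_wpM2r ?expR_ge0 //; have := ler_norm K; lra.
have gu : grows_le f A (la - c1 / 2) x (P *m (invmx P *m u)).
  have [uP _ _] := hP; rewrite mulKVmx //.
  by exists (K2 * (`|K| + 1)) => n; rewrite -mulrA.
move/negP: U3u; apply; apply/eqP; apply: U3z => i ik.
have [_ _ h2] := hP; apply: (h2 _ _ gu); apply: (lt_le_trans _ (hla i _)) => //.
by rewrite lte_fin; lra.
Qed.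

Lemma exponents_mono r i j : finite_upto r -> (i <= j)%N -> (j < r)%N -> c j <= c i.
Proof.
move=> [rd fin] ij jr; have jd := leq_trans jr rd; have id := leq_ltn_trans ij jd.
have := @gamma_mono (Ordinal id) (Ordinal jd) ij.
by rewrite !fin ?lee_fin //=; exact: leq_ltn_trans jr.
Qed.

Lemma Nvol_lower_all r : finite_upto r -> Nvol_lower r.
Proof.
elim/ltn_ind: r => -[_ _|r IH fin] e e0.
  apply: nearW => x; exists 0 => n; rewrite Nvol0 -[X in _ <= X]expR0 ler_expR.
  by rewrite /psum big_ord0 oppr0 add0r sub0r mulNr oppr_le0 mulr_ge0 // ltW.
have [rd fc] := fin.
have gD n m x : Nvol r.+1 (An (n + m) x) <= Nvol r.+1 (An m (iter n f x)) * Nvol r.+1 (An n x).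
  by rewrite cocycleD; exact: Nvol_mul.
have g1 x : Nvol r.+1 (An 1 x) <= expR be ^+ r.+1.
  apply: Nvol_expr; rewrite ?expR_ge0 // => v; rewrite /= mulmx1; exact: A_bound.
have g0 (x : 'M[R]_d) : 0 <= Nvol r.+1 x by exact: Nvol_ge0.
have lt_e : psum r.+1 - e < psum r.+1 - e / 2 by lra.
have [|||up|low] := @subadditive_dichotomy _ MT R mu f mu1 mf f_inv (fun n x => Nvol r.+1 (An n x))
    (expR be ^+ r.+1) _ _ g1 gD _ f_erg _ _ lt_e.
- by move=> n x; exact: g0.
- by move=> x; exact: Nvol1.
- by move=> n a; exact: measurable_Nvol_cocycle.
- exfalso.
  have la_ex : exists k, (k <= r)%N && (c k <= c r) by exists r; rewrite leqnn lexx.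
  have [k /andP[kr ckr] kmin] := ex_minnP la_ex; set la := c r in ckr kmin.
  have hk i : (k <= i)%N -> (i <= r)%N -> c i = la.
    move=> ki ir; apply/eqP; rewrite eq_le; apply/andP; split.
      by apply: le_trans ckr; exact: exponents_mono fin ki _.
    exact: exponents_mono fin ir _.
  have hk' i : (i < k)%N -> la < c i.
    move=> ik; rewrite ltNge; apply/negP => h.
    have := kmin i; rewrite h andbT (ltnW (leq_trans ik kr)) => /(_ isT).
    by rewrite leqNgt ik.
  have [j rE] : exists j, r = (k + j)%N by exists (r - k)%N; rewrite subnKC.
  pose c1 := e / 2; have c10 : 0 < c1 by rewrite /c1; lra.
  pose ep := c1 / (4 * (j%:R + 6)).
  have ep0 : 0 < ep by rewrite /ep divr_gt0 // mulr_gt0 // ltr_wpDl.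
  have psumk : psum r = psum k + j%:R * la.
    rewrite /psum rE big_split_ord /=; congr (_ + _).
    rewrite (eq_bigr (fun=> la)) => [|i _]; first by rewrite sumr_const card_ord mulr_natl.
    by apply: hk; rewrite ?leq_addr // rE leq_add2l ltnW.
  pose de := if k is k'.+1 then Num.min ep ((c k' - la) / 3) else ep.
  have [de0 deep dek] : [/\ 0 < de, de <= ep & forall k', k = k'.+1 -> de <= (c k' - la) / 3].
    rewrite /de {de}; case: k hk' {kr ckr kmin hk rE psumk} => [|k'] h; first by rewrite lexx.
    split; rewrite ?ge_min ?lexx ?lt_min ?ep0 //=.
      by rewrite divr_gt0 // subr_gt0 h.
    by move=> _ [<-]; rewrite ge_min lexx orbT.
  have kd : (k < d)%N by rewrite (leq_trans _ rd).
  have gap : exponent_gap k (la + de) (la + 2 * de).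
    split; [exact: ltnW | by lra | move=> i ki | move=> i ik].
      apply: (@le_lt_trans _ _ (gamma (Ordinal kd))); first exact: gamma_mono.
      by rewrite fc //= lte_fin hk //; lra.
    have ir : (i < r.+1)%N by rewrite (leq_trans ik) // ltnW.
    rewrite fc // lte_fin.
    have kE : k = k.-1.+1 by rewrite prednK // (leq_ltn_trans _ ik).
    have ik' : (i <= k.-1)%N by rewrite -ltnS -kE.
    have : c k.-1 <= c i by apply: exponents_mono fin ik' _; rewrite -ltnS -kE leqW // ltnS.
    by have := dek _ kE; have := hk' k.-1; rewrite -{1}kE => /(_ (leqnn _)); lra.
  have finr : finite_upto r by exact: finite_uptoW fin.
  have fink : finite_upto k by exact: finite_uptoW finr.
  have lowr := IH r (ltnSn r) finr ep ep0.
  have lowk := ae_frame_det gap fink (IH k (leq_ltn_trans kr (ltnSn r)) fink) ep0.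
  have reg := ae_regular.
  have bad : {ae mu, forall x : MT, False}.
    near=> x; have rx : regular x by near: x.
    apply: (@core_point k j (la + de) (la + 2 * de) la (psum k) c1 x c10 rx gap).
    + by rewrite -rE.
    + by rewrite lerD2l.
    + move=> i ikj; rewrite -rE in ikj; rewrite fc // lee_fin; exact: exponents_mono fin ikj _.
    + have [q hq] := Nvol_upper_psum fink ep0 rx; exists q%:R => n; exact: hq.
    + have [ka hka] : exists ka, forall n, expR (- ka + (psum r - ep) * n%:R) <= Nvol r (An n x) by near: x.
      by exists ka => n; rewrite addnC -rE -psumk.
    + by near: x; exact: lowk.
    + have [K hK] : exists K, forall n, Nvol r.+1 (An n x) <= K * expR ((psum r.+1 - e / 2) * n%:R) by near: x.
      have [q hq] := le_expR_bound hK; exists q%:R => n.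
      rewrite -rE -psumk; apply: (le_trans (hq q n (leqnn q))).
      by rewrite /psum big_ord_recr.
  move: bad => [S [mS S0 hS]].
  have : mu S = 1%E.
    rewrite -mu1; congr (mu _); apply/seteqP; split => // x _; exact: hS.
  by rewrite (S0 : mu S = 0%E) => /eqP; rewrite eqe eq_sym oner_eq0.
- apply: filterS low => x [N hN].
  have pos n : 0 < Nvol r.+1 (An n x).
    rewrite lt_neqAle g0 andbT; apply/negP => /eqP e'.
    have := gD n N x; rewrite -e' mulr0 => h.
    by have := lt_le_trans (hN (n + N)%N (leq_addl _ _)) h; rewrite ltNge expR_ge0.
  have [|K K0 hK] := @eventually_le_bound R (fun n => expR ((psum r.+1 - e) * n%:R))
      (fun n => Nvol r.+1 (An n x)) pos.
    by exists N => n /hN/ltW.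
  exists (ln K) => n; rewrite expRD expRN lnK ?posrE //.
  by rewrite ler_pdivrMl.
Unshelve. all: by end_near.
Qed.

End System.

(** * Cones along an orbit segment *)

Lemma minn_subS n j : (minn j.+1 (n - j.+1) <= minn j (n - j) + 1)%N.
Proof. lia. Qed.

Lemma minn_subSr n j : (minn j (n - j) <= minn j.+1 (n - j.+1) + 1)%N.
Proof. lia. Qed.

Section Cone.
Variables (R : realType) (M : pointedType) (f : M -> M) (d : nat) (A : M -> 'M[R]_d).
Variables (k n : nat) (z : M) (U : nat -> 'M[R]_(k, d)) (be ka s0 t0 ep : R).
Local Notation An := (cocycle f A).
Local Notation zz j := (iter j f z).
Local Notation tau j := ((minn j (n - j))%:R : R).

Hypothesis A_bound : forall x v, vnorm (A x *m v) <= expR be * vnorm v.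
Hypothesis UU : forall j, U j *m (U j)^T = 1%:M.
Hypothesis U_inv : forall j, (j < n)%N -> U j.+1 *m A (zz j) *m (U j)^T *m U j = U j.+1 *m A (zz j).
Hypothesis ep0 : 0 <= ep.

Definition quot_step j : 'M[R]_k := U j.+1 *m A (zz j) *m (U j)^T.
Definition quot j m : 'M[R]_k := U (j + m)%N *m An m (zz j) *m (U j)^T.

Lemma quot0 j : quot j 0 = 1%:M.
Proof. by rewrite /quot addn0 mulmx1. Qed.

Lemma quotS j m : (j + m < n)%N -> quot j m.+1 = quot_step (j + m) *m quot j m.
Proof.
move=> h; rewrite /quot /quot_step addnS /= -iterD (addnC m j) !mulmxA; congr (_ *m _ *m _).
by rewrite U_inv.
Qed.

Hypothesis slow_seg : forall j m b, (j + m <= n)%N -> U j *m b = 0 ->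
  vnorm (An m (zz j) *m b) <= expR (ka + s0 * m%:R + ep * tau j) * vnorm b.
Hypothesis fast_seg : forall j m w, (j + m <= n)%N ->
  expR (- ka + t0 * m%:R - ep * tau (j + m)) * vnorm w <= vnorm (quot j m *m w).

Lemma quot_unit j m : (j + m <= n)%N -> quot j m \in unitmx.
Proof.
move=> h; rewrite unitmxE unitfE -normr_gt0.
apply: lt_le_trans (det_ge_expr (expR_gt0 _) _); first exact: (exprn_gt0 _ (expR_gt0 _)).
by move=> w; exact: fast_seg.
Qed.

Variable de : R.
Hypothesis de0 : 0 < de.
Let s1 := s0 + de.
Let t1 := t0 - de.

(* Lyapunov norms: they absorb [ka] and the errors [ep * tau], so that a single step already expands
   by [expR t1] and contracts by [expR s1]. *)
Definition fnorm j (w : 'cV[R]_k) : R :=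
  \sum_(i < j.+1) expR (t1 * (j - i)%:R) * vnorm (invmx (quot i (j - i)) *m w).

Definition snorm j (b : 'cV[R]_d) : R :=
  \sum_(m < (n - j).+1) expR (- s1 * m%:R) * vnorm (An m (zz j) *m b).

Lemma fnorm_ge0 j w : 0 <= fnorm j w.
Proof. by apply: sumr_ge0 => i _; rewrite mulr_ge0 ?expR_ge0 ?vnorm_ge0. Qed.

Lemma snorm_ge0 j b : 0 <= snorm j b.
Proof. by apply: sumr_ge0 => i _; rewrite mulr_ge0 ?expR_ge0 ?vnorm_ge0. Qed.

Lemma fnormD j u v : fnorm j (u + v) <= fnorm j u + fnorm j v.
Proof.
rewrite /fnorm -big_split /=; apply: ler_sum => i _.
by rewrite -mulrDr ler_wpM2l ?expR_ge0 // mulmxDr ler_vnormD.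
Qed.

Lemma snormD j u v : snorm j (u + v) <= snorm j u + snorm j v.
Proof.
rewrite /snorm -big_split /=; apply: ler_sum => i _.
by rewrite -mulrDr ler_wpM2l ?expR_ge0 // mulmxDr ler_vnormD.
Qed.

Lemma vnorm_le_fnorm j w : vnorm w <= fnorm j w.
Proof.
rewrite /fnorm big_ord_recr /= subnn quot0 invmx1 mul1mx mulr0 expR0 mul1r lerDr.
by apply: sumr_ge0 => i _; rewrite mulr_ge0 ?expR_ge0 ?vnorm_ge0.
Qed.

Lemma vnorm_le_snorm j b : vnorm b <= snorm j b.
Proof.
rewrite /snorm big_ord_recl /= mul1mx mulr0 expR0 mul1r lerDl.
by apply: sumr_ge0 => i _; rewrite mulr_ge0 ?expR_ge0 ?vnorm_ge0.
Qed.

Lemma fnorm0 w : fnorm 0 w = vnorm w.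
Proof. by rewrite /fnorm big_ord1 subnn quot0 invmx1 mul1mx mulr0 expR0 mul1r. Qed.

Lemma snormn b : snorm n b = vnorm b.
Proof. by rewrite /snorm subnn big_ord1 mul1mx mulr0 expR0 mul1r. Qed.

Lemma fnorm_step j w : (j < n)%N -> expR t1 * fnorm j w <= fnorm j.+1 (quot_step j *m w).
Proof.
move=> jn; rewrite {2}/fnorm big_ord_recr /= mulr_sumr -[X in X <= _]addr0; apply: lerD; last first.
  by rewrite mulr_ge0 ?expR_ge0 ?vnorm_ge0.
apply: ler_sum => i _; have ij : (i <= j)%N by rewrite -ltnS.
rewrite subSn //.
have -> : expR (t1 * (j - i).+1%:R) = expR t1 * expR (t1 * (j - i)%:R).
  by rewrite -expRD -natr1; congr expR; ring.
rewrite mulrA ler_wpM2l ?mulr_ge0 ?expR_ge0 //.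
have us : quot i (j - i) \in unitmx by apply: quot_unit; rewrite subnKC // ltnW.
have us' : quot i (j - i).+1 \in unitmx by apply: quot_unit; rewrite addnS subnKC.
have E : quot i (j - i).+1 = quot_step j *m quot i (j - i) by rewrite quotS subnKC.
have -> : quot_step j *m w = quot i (j - i).+1 *m (invmx (quot i (j - i)) *m w).
  by rewrite E -mulmxA mulKVmx.
by rewrite mulKmx.
Qed.

Lemma snorm_step j b : (j < n)%N -> snorm j.+1 (A (zz j) *m b) <= expR s1 * snorm j b.
Proof.
move=> jn; rewrite /snorm.
have -> : (n - j)%N = (n - j.+1).+1 by rewrite subnSK.
rewrite [X in _ <= _ * X]big_ord_recl mulrDr mulr_sumr.
rewrite -[X in X <= _]add0r; apply: lerD; first by rewrite !mulr_ge0 ?expR_ge0 ?vnorm_ge0.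
apply: ler_sum => m _.
rewrite [X in _ <= X]mulrA -expRD lift0.
have -> : An m.+1 (zz j) *m b = An m (zz j.+1) *m (A (zz j) *m b).
  by rewrite cocycleS mulmxA.
by rewrite -natr1 ler_wpM2r ?vnorm_ge0 // ler_expR; lra.
Qed.

Let Cg := (1 - expR (- de))^-1.
Let ka2 := ka + ln Cg.

Lemma sum_expr_le N : \sum_(i < N) expR (- de * i%:R) <= Cg.
Proof.
have q1 : expR (- de) < 1 by rewrite -[X in _ < X]expR0 ltr_expR oppr_lt0.
have p1 : 0 < 1 - expR (- de) by rewrite subr_gt0.
have -> : \sum_(i < N) expR (- de * i%:R) = \sum_(i < N) expR (- de) ^+ i.
  by apply: eq_bigr => i _; rewrite mulrC expRM_natl.
rewrite /Cg -[X in _ <= X]mul1r ler_pdivlMr // mulrC.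
suff h : forall m, (1 - expR (- de)) * (\sum_(i < m) expR (- de) ^+ i) = 1 - expR (- de) ^+ m.
  by rewrite h gerBl exprn_ge0 // expR_ge0.
elim=> [|m IHm]; first by rewrite big_ord0 mulr0 expr0 subrr.
by rewrite big_ord_recr /= mulrDr IHm exprS; ring.
Qed.

Lemma Cg_gt0 : 0 < Cg.
Proof. by rewrite invr_gt0 subr_gt0 -[X in _ < X]expR0 ltr_expR oppr_lt0. Qed.

Lemma expR_ka2 x : expR (ka2 + x) = expR (ka + x) * Cg.
Proof. by rewrite /ka2 -[in RHS](lnK (x := Cg)) ?posrE ?Cg_gt0 // -expRD; congr expR; ring. Qed.

Lemma fnorm_le j w : (j <= n)%N -> fnorm j w <= expR (ka2 + ep * tau j) * vnorm w.
Proof.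
move=> jn; rewrite /fnorm.
apply: (@le_trans _ _ (\sum_(i < j.+1) expR (ka + ep * tau j) * vnorm w * expR (- de * (j - i)%:R))).
  apply: ler_sum => i _; have ij : (i <= j)%N by rewrite -ltnS.
  have h := @fast_seg i (j - i) (invmx (quot i (j - i)) *m w).
  rewrite subnKC // mulKVmx ?quot_unit ?subnKC // in h.
  rewrite -ler_pdivlMl ?expR_gt0 // -expRN in h.
  rewrite mulrAC -expRD.
  apply: (@le_trans _ _ (expR (t1 * (j - i)%:R) * (expR (- (- ka + t0 * (j - i)%:R - ep * tau j)) * vnorm w))).
    by rewrite ler_wpM2l ?expR_ge0 //; exact: h.
  by rewrite mulrA -expRD ler_wpM2r ?vnorm_ge0 // ler_expR /t1; lra.
rewrite -mulr_sumr (reindex_inj rev_ord_inj) /=.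
rewrite (eq_bigr (fun i : 'I_j.+1 => expR (- de * i%:R))) => [|i _]; last first.
  by rewrite subSS subKn // -ltnS.
rewrite expR_ka2 [X in _ <= X]mulrAC.
by rewrite ler_wpM2l ?mulr_ge0 ?expR_ge0 ?vnorm_ge0 // sum_expr_le.
Qed.

Lemma snorm_le j b : (j <= n)%N -> U j *m b = 0 -> snorm j b <= expR (ka2 + ep * tau j) * vnorm b.
Proof.
move=> jn Ub; rewrite /snorm.
apply: (@le_trans _ _ (\sum_(m < (n - j).+1) expR (ka + ep * tau j) * vnorm b * expR (- de * m%:R))).
  apply: ler_sum => m _; have jm : (j + m <= n)%N by rewrite -leq_subRL // -ltnS.
  have h := slow_seg jm Ub.
  apply: (@le_trans _ _ (expR (- s1 * m%:R) * (expR (ka + s0 * m%:R + ep * tau j) * vnorm b))).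
    by rewrite ler_wpM2l ?expR_ge0.
  by rewrite mulrA -expRD mulrAC -expRD ler_wpM2r ?vnorm_ge0 // ler_expR /s1; lra.
rewrite -mulr_sumr expR_ka2 [X in _ <= X]mulrAC.
by rewrite ler_wpM2l ?mulr_ge0 ?expR_ge0 ?vnorm_ge0 // sum_expr_le.
Qed.

Variables (p : M) (kp ze h rh om va s3 t2 : R).
Local Notation pp j := (iter j f p).
Let s2 := s1 + ep + ze.

Hypothesis kp0 : 0 <= kp.
Hypothesis ze0 : 0 <= ze.
Hypothesis h0 : 0 <= h.
Hypothesis rh0 : 0 <= rh.
Hypothesis om_ep : 2 * ep <= om.
Hypothesis close_seg : forall j v, (j < n)%N ->
  vnorm ((A (pp j) - A (zz j)) *m v) <= rh * expR (- om * tau j) * vnorm v.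
Hypothesis va_fast : rh * expR (ka2 + ep + kp) <= va.
Hypothesis va_slow : rh * expR (ka2 + h) <= va / 2.
Hypothesis va_mixed : expR (ka2 + h - kp + be) <= va / 2.
Hypothesis t2_lt : expR t2 <= expR t1 - 2 * va.
Hypothesis s3_gt : expR s2 + 2 * va <= expR s3.
Hypothesis s3_t2 : s3 <= t2.

Let proj j (v : 'cV[R]_d) : 'cV[R]_d := (U j)^T *m (U j *m v).
(* The term [min (ze * j) h] makes the weight grow by the factor [expR h] along the segment, which
   pays for the change of frame and of norms at the return to [z]. *)
Let wt j := expR (- kp - ep * tau j + Num.min (ze * j%:R) h).
Let X j v := fnorm j (U j *m v).
Let Y j v := wt j * snorm j (v - proj j v).

Lemma UU' j : ((U j)^T)^T *m (U j)^T = 1%:M.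
Proof. by rewrite trmxK. Qed.

Lemma vnorm_coord_le j v : vnorm (U j *m v) <= vnorm v.
Proof. by have := vnorm_tr_le v (UU' j); rewrite trmxK. Qed.

Lemma vnorm_proj j v : vnorm (proj j v) = vnorm (U j *m v).
Proof. by rewrite /proj vnorm_orth ?UU'. Qed.

Lemma vnorm_coproj_le j v : vnorm (v - proj j v) <= vnorm v.
Proof. by have := vnorm_cotr_le v (UU' j); rewrite trmxK. Qed.

Lemma tauS j : tau j.+1 <= tau j + 1.
Proof. by rewrite natr1 ler_nat -[X in (_ <= X)%N]addn1 minn_subS. Qed.

Lemma tauSr j : tau j <= tau j.+1 + 1.
Proof. by rewrite natr1 ler_nat -[X in (_ <= X)%N]addn1 minn_subSr. Qed.

Lemma wt_lb j : expR (- kp - ep * tau j) <= wt j.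
Proof. by rewrite ler_expR lerDl le_min mulr_ge0. Qed.

Lemma wt_ub j : wt j <= expR (- kp - ep * tau j + h).
Proof. by rewrite ler_expR lerD2l ge_min lexx orbT. Qed.

Lemma wtS j : wt j.+1 <= expR (ep + ze) * wt j.
Proof.
rewrite /wt -expRD ler_expR.
have -> : ep + ze + (- kp - ep * tau j + Num.min (ze * j%:R) h)
  = - kp + (ep - ep * tau j) + (Num.min (ze * j%:R) h + ze) by ring.
apply: lerD; first by have := ler_wpM2l ep0 (tauSr j); lra.
by rewrite -natr1 mulrDr mulr1 addr_minl le_min !ge_min lexx lerDl ze0 orbT.
Qed.

Lemma proj_orth j v : U j *m (v - proj j v) = 0.
Proof. by rewrite mulmxBr /proj !mulmxA UU mul1mx subrr. Qed.

Lemma X_ge0 j v : 0 <= X j v. Proof. exact: fnorm_ge0. Qed.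
Lemma Y_ge0 j v : 0 <= Y j v. Proof. by rewrite mulr_ge0 ?expR_ge0 ?snorm_ge0. Qed.

Lemma vnorm_le_XY j v : vnorm v <= expR (kp + ep * tau j) * (X j v + Y j v).
Proof.
have e1 : 1 <= expR (kp + ep * tau j).
  by rewrite -[X in X <= _]expR0 ler_expR addr_ge0 // mulr_ge0.
have -> : v = proj j v + (v - proj j v) by rewrite addrC subrK.
apply: (le_trans (ler_vnormD _ _)).
rewrite subrKC mulrDr; apply: lerD.
  rewrite vnorm_proj; apply: (le_trans (vnorm_le_fnorm j _)).
  by rewrite -[X in X <= _]mul1r ler_wpM2r // fnorm_ge0.
apply: (le_trans (vnorm_le_snorm j _)); rewrite /Y mulrA -[X in X <= _]mul1r.
rewrite ler_wpM2r ?snorm_ge0 //.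
apply: (@le_trans _ _ (expR (kp + ep * tau j) * expR (- kp - ep * tau j))).
  by rewrite -expRD -[X in X <= _]expR0 ler_expR; lra.
by rewrite ler_wpM2l ?expR_ge0 // wt_lb.
Qed.

Lemma perturbation j v : (j < n)%N ->
  vnorm ((A (pp j) - A (zz j)) *m v) <= rh * expR (kp - ep * tau j) * (X j v + Y j v).
Proof.
move=> jn; apply: (le_trans (close_seg v jn)).
apply: (@le_trans _ _ (rh * expR (- om * tau j) * (expR (kp + ep * tau j) * (X j v + Y j v)))).
  by rewrite ler_wpM2l ?mulr_ge0 ?expR_ge0 // vnorm_le_XY.
rewrite mulrA -[_ * _ * expR _]mulrA -expRD ler_wpM2r ?addr_ge0 ?X_ge0 ?Y_ge0 //.
rewrite ler_wpM2l // ler_expR.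
by have := ler_wpM2r (ler0n R (minn j (n - j))) om_ep; lra.
Qed.

Lemma fast_step j v : (j < n)%N ->
  expR t1 * X j v - va * (X j v + Y j v) <= X j.+1 (A (pp j) *m v).
Proof.
move=> jn.
have E : U j.+1 *m (A (pp j) *m v)
  = quot_step j *m (U j *m v) + U j.+1 *m ((A (pp j) - A (zz j)) *m v).
  by rewrite /quot_step mulmxA (mulmxA _ (U j)) U_inv // mulmxBl mulmxBr !mulmxA addrC subrK.
have E2 : quot_step j *m (U j *m v)
  = U j.+1 *m (A (pp j) *m v) + U j.+1 *m (- ((A (pp j) - A (zz j)) *m v)).
  by rewrite E mulmxN addrK.
rewrite lerBlDr; apply: (le_trans (fnorm_step _ jn)); rewrite E2.
apply: (le_trans (fnormD _ _ _)); rewrite lerD2l.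
apply: (le_trans (fnorm_le _ jn)).
apply: (@le_trans _ _ (expR (ka2 + ep * tau j.+1) * (rh * expR (kp - ep * tau j) * (X j v + Y j v)))).
  rewrite ler_wpM2l ?expR_ge0 //; apply: (le_trans (vnorm_coord_le _ _)).
  by rewrite -scaleN1r vnormZ normrN1 mul1r perturbation.
rewrite mulrA ler_wpM2r ?addr_ge0 ?X_ge0 ?Y_ge0 //.
apply: le_trans va_fast; rewrite mulrCA ler_wpM2l // -expRD ler_expR.
by have := ler_wpM2l ep0 (tauS j); lra.
Qed.

Lemma wt_snorm j c : (j <= n)%N -> U j *m c = 0 ->
  wt j * snorm j c <= expR (ka2 + h - kp) * vnorm c.
Proof.
move=> jn Uc.
apply: (@le_trans _ _ (expR (- kp - ep * tau j + h) * (expR (ka2 + ep * tau j) * vnorm c))).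
  by apply: ler_pM; rewrite ?expR_ge0 ?snorm_ge0 ?wt_ub ?snorm_le.
by rewrite mulrA -expRD ler_wpM2r ?vnorm_ge0 // ler_expR; lra.
Qed.

Lemma slow_step j v : (j < n)%N ->
  Y j.+1 (A (pp j) *m v) <= expR s2 * Y j v + va * (X j v + Y j v).
Proof.
move=> jn; set b := v - proj j v; set w := (A (pp j) - A (zz j)) *m v.
set c := A (zz j) *m proj j v.
have UAb : U j.+1 *m (A (zz j) *m b) = 0.
  by rewrite /b /proj mulmxBr mulmxBr !mulmxA U_inv // subrr.
have E : A (pp j) *m v - proj j.+1 (A (pp j) *m v)
  = A (zz j) *m b + (c - proj j.+1 c + (w - proj j.+1 w)).
  have -> : A (pp j) *m v = A (zz j) *m b + (c + w).
    by rewrite /b /c /w mulmxBr mulmxBl addrA subrK addrC subrK.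
  have projD u u' : proj j.+1 (u + u') = proj j.+1 u + proj j.+1 u' by rewrite /proj !mulmxDr.
  have -> : proj j.+1 (A (zz j) *m b + (c + w)) = proj j.+1 c + proj j.+1 w.
    by rewrite !projD {1}/proj UAb mulmx0 add0r.
  by rewrite opprD -!addrA; congr (_ + (_ + _)); rewrite addrCA.
rewrite /Y E.
apply: (@le_trans _ _ (wt j.+1 * snorm j.+1 (A (zz j) *m b)
   + (wt j.+1 * snorm j.+1 (c - proj j.+1 c) + wt j.+1 * snorm j.+1 (w - proj j.+1 w)))).
  rewrite -!mulrDr ler_wpM2l ?expR_ge0 //; apply: (le_trans (snormD _ _ _)).
  by rewrite lerD2l snormD.
apply: lerD.
  rewrite -/b mulrA; apply: (@le_trans _ _ (expR (ep + ze) * wt j * (expR s1 * snorm j b))).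
    by apply: ler_pM; rewrite ?expR_ge0 ?snorm_ge0 ?wtS ?snorm_step.
  rewrite (_ : s2 = ep + ze + s1); last by rewrite /s2; ring.
  by rewrite [expR (ep + ze + s1)]expRD mulrACA mulrA.
have -> : va * (X j v + wt j * snorm j (v - proj j v))
  = va / 2 * (X j v + Y j v) + va / 2 * (X j v + Y j v) by rewrite -/(Y j v); field.
have va0 : 0 <= va / 2 by apply: le_trans va_mixed; exact: expR_ge0.
apply: lerD.
  apply: (le_trans (wt_snorm jn (proj_orth _ _))).
  apply: (@le_trans _ _ (expR (ka2 + h - kp) * (expR be * X j v))).
    rewrite ler_wpM2l ?expR_ge0 //; apply: (le_trans (vnorm_coproj_le _ _)).
    apply: (le_trans (A_bound _ _)); rewrite ler_wpM2l ?expR_ge0 // vnorm_proj.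
    exact: vnorm_le_fnorm.
  rewrite mulrA -expRD; apply: ler_pM; rewrite ?expR_ge0 ?X_ge0 //.
  by rewrite lerDl Y_ge0.
apply: (le_trans (wt_snorm jn (proj_orth _ _))).
apply: (@le_trans _ _ (expR (ka2 + h - kp) * (rh * expR (kp - ep * tau j) * (X j v + Y j v)))).
  by rewrite ler_wpM2l ?expR_ge0 //; apply: (le_trans (vnorm_coproj_le _ _)); exact: perturbation.
rewrite mulrA ler_wpM2r ?addr_ge0 ?X_ge0 ?Y_ge0 //.
apply: le_trans va_slow; rewrite mulrCA ler_wpM2l // -expRD ler_expR.
by have := mulr_ge0 ep0 (ler0n R (minn j (n - j))); lra.
Qed.

Let cz j (v : 'cV[R]_d) := An j p *m v.

Lemma cz_step j v : cz j.+1 v = A (pp j) *m cz j v.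
Proof. by rewrite /cz /= mulmxA. Qed.

Lemma cone_forward v : Y 0 v <= X 0 v -> forall j, (j <= n)%N ->
  Y j (cz j v) <= X j (cz j v) /\ expR (t2 * j%:R) * X 0 v <= X j (cz j v).
Proof.
move=> h00; elim=> [|j IH] jn; first by rewrite /cz /= mul1mx mulr0 expR0 mul1r.
have [YX Xj] := IH (ltnW jn); rewrite cz_step.
have F := fast_step (cz j v) jn; have S := slow_step (cz j v) jn.
have X0 := X_ge0 j (cz j v); have Y0 := Y_ge0 j (cz j v).
have va0 : 0 <= va.
  by have := le_trans (expR_ge0 _) va_mixed; rewrite ler_pdivlMr // mul0r.
have Xt : expR t2 * X j (cz j v) <= X j.+1 (A (pp j) *m cz j v).
  apply: le_trans F; apply: (@le_trans _ _ ((expR t1 - 2 * va) * X j (cz j v))).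
    by rewrite ler_wpM2r.
  by have := ler_wpM2l va0 YX; lra.
split; last first.
  apply: le_trans Xt; rewrite -natr1 mulrDr mulr1 addrC expRD -mulrA ler_wpM2l ?expR_ge0 //.
apply: le_trans Xt; apply: (le_trans S).
apply: (@le_trans _ _ ((expR s2 + 2 * va) * X j (cz j v))).
  by have := ler_wpM2l va0 YX; have := ler_wpM2l (expR_ge0 s2) YX; lra.
by rewrite ler_wpM2r //; apply: (le_trans s3_gt); rewrite ler_expR.
Qed.

Lemma cone_backward v j : (j <= n)%N -> X j (cz j v) <= Y j (cz j v) ->
  X 0 v <= Y 0 v /\ Y j (cz j v) <= expR (s3 * j%:R) * Y 0 v.
Proof.
elim: j => [|j IH] jn; first by rewrite /cz /= mul1mx mulr0 expR0 mul1r.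
rewrite cz_step => XY'.
have F := fast_step (cz j v) jn; have S := slow_step (cz j v) jn.
have X0 := X_ge0 j (cz j v); have Y0 := Y_ge0 j (cz j v).
have va0 : 0 <= va.
  by have := le_trans (expR_ge0 _) va_mixed; rewrite ler_pdivlMr // mul0r.
have XY : X j (cz j v) <= Y j (cz j v).
  rewrite leNgt; apply/negP => YX.
  have : expR t2 * (X j (cz j v) - Y j (cz j v)) <= 0.
    have a1 := ler_wpM2r X0 t2_lt; have a2 := ler_wpM2r Y0 s3_gt.
    have a3 : expR s3 * Y j (cz j v) <= expR t2 * Y j (cz j v) by rewrite ler_wpM2r // ler_expR.
    lra.
  by rewrite pmulr_rle0 ?expR_gt0 // subr_le0 leNgt YX.
have [h00 hY] := IH (ltnW jn) XY; split => //; apply: (le_trans S).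
apply: (@le_trans _ _ (expR s3 * Y j (cz j v))).
  have := ler_wpM2l va0 XY; have := ler_wpM2r Y0 s3_gt; lra.
by rewrite -natr1 mulrDr mulr1 addrC expRD -mulrA ler_wpM2l ?expR_ge0.
Qed.

Variables (xi t3 : R).
Hypothesis n0 : (0 < n)%N.
Hypothesis period : iter n f p = p.
Hypothesis ka0 : 0 <= ka.
Hypothesis wrap : forall v, vnorm (proj 0 v - proj n v) <= xi * vnorm v.
Hypothesis wrap_n : h <= ze * n%:R.
Hypothesis wrap_h : expR (ka2 - h) <= expR (- ka2) / 4.
Hypothesis wrap_xi : expR ka2 * (xi * (1 + expR kp)) <= expR (- ka2) / 8.
Hypothesis t3_lt : expR (t3 * n%:R) <= expR (- ka2) / 2 * expR (t2 * n%:R).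

Lemma ka2_ge0 : 0 <= ka2.
Proof.
have q1 : expR (- de) < 1 by rewrite -[X in _ < X]expR0 ltr_expR oppr_lt0.
by rewrite addr_ge0 // ln_ge0 // /Cg invf_ge1 ?subr_gt0 // gerBl expR_ge0.
Qed.

Lemma Y0E v : Y 0 v = expR (- kp) * snorm 0 (v - proj 0 v).
Proof. by rewrite /Y /wt min0n mulr0 subr0 mulr0 (min_l h0) addr0. Qed.

Lemma YnE v : Y n v = expR (h - kp) * vnorm (v - proj n v).
Proof. by rewrite /Y /wt subnn minn0 mulr0 subr0 snormn (min_r wrap_n) addrC. Qed.

Lemma X0E v : X 0 v = vnorm (U 0 *m v).
Proof. exact: fnorm0. Qed.

Lemma Y0_le v : Y 0 v <= expR (ka2 - kp) * vnorm (v - proj 0 v).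
Proof.
rewrite Y0E (addrC ka2) expRD -mulrA ler_wpM2l ?expR_ge0 //.
have := snorm_le (leq0n n) (proj_orth 0 v).
by rewrite min0n mulr0 addr0.
Qed.

Lemma vnorm_le_n v : vnorm v <= X n v + expR (kp - h) * Y n v.
Proof.
rewrite YnE mulrA -expRD.
have -> : kp - h + (h - kp) = 0 by ring.
rewrite expR0 mul1r -[in X in X <= _](subrK (proj n v) v) addrC.
apply: (le_trans (ler_vnormD _ _)); rewrite lerD2r vnorm_proj; exact: vnorm_le_fnorm.
Qed.

(* Passing from the frame at [z] to the frame at [f^n z], which are [xi]-close. *)
Lemma wrap_Y v m : X n v <= m -> Y n v <= m -> Y 0 v <= expR (- ka2) * (3 / 8) * m.
Proof.
move=> Xm Ym; have m0 : 0 <= m by apply: le_trans Xm; exact: X_ge0.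
have h1 := vnorm_le_n v.
have e1 : expR (kp - h) <= expR kp by rewrite ler_expR gerBl.
have vm : vnorm v <= (1 + expR kp) * m.
  apply: (le_trans h1); rewrite mulrDl mul1r; apply: lerD => //.
  by apply: ler_pM; rewrite ?expR_ge0 ?Y_ge0.
have xi0 : 0 <= xi * vnorm v by apply: le_trans (wrap v); exact: vnorm_ge0.
have xim : expR ka2 * (xi * vnorm v) <= expR (- ka2) / 8 * m.
  have [xi_ge0|xi_lt0] := leP 0 xi; last first.
    apply: (@le_trans _ _ 0); last by rewrite !mulr_ge0 ?expR_ge0.
    by rewrite pmulr_rle0 ?expR_gt0 // nmulr_rle0 // vnorm_ge0.
  apply: (@le_trans _ _ (expR ka2 * (xi * (1 + expR kp)) * m)); last by rewrite ler_wpM2r.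
  by rewrite -!mulrA ler_wpM2l ?expR_ge0 // ler_wpM2l.
apply: (le_trans (Y0_le v)).
have -> : v - proj 0 v = (v - proj n v) - (proj 0 v - proj n v).
  by rewrite opprB addrA subrK.
apply: (@le_trans _ _ (expR (ka2 - kp) * vnorm (v - proj n v) + expR (ka2 - kp) * (xi * vnorm v))).
  by rewrite -mulrDr ler_wpM2l ?expR_ge0 //; apply: (le_trans (ler_vnormB _ _)); rewrite lerD2l.
have -> : expR (ka2 - kp) * vnorm (v - proj n v) = expR (ka2 - h) * Y n v.
  by rewrite YnE mulrA -expRD; congr (expR _ * _); ring.
have a1 : expR (ka2 - h) * Y n v <= expR (- ka2) / 4 * m.
  by apply: ler_pM; rewrite ?expR_ge0 ?Y_ge0.
have a2 : expR (ka2 - kp) * (xi * vnorm v) <= expR ka2 * (xi * vnorm v).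
  by rewrite ler_wpM2r // ler_expR gerBl.
by lra.
Qed.

Lemma wrap_X v : Y n v <= X n v -> expR (- ka2) / 2 * X n v <= X 0 v.
Proof.
move=> YX; have X0 := X_ge0 n v; have h1 := vnorm_le_n v.
have e1 : expR (kp - h) <= expR kp by rewrite ler_expR gerBl.
have vm : vnorm v <= (1 + expR kp) * X n v.
  apply: (le_trans h1); rewrite mulrDl mul1r; apply: lerD => //.
  by apply: ler_pM; rewrite ?expR_ge0 ?Y_ge0.
have xim : xi * vnorm v <= expR (- ka2) / 8 * X n v.
  have [xi_ge0|xi_lt0] := leP 0 xi; last first.
    apply: (@le_trans _ _ 0); last by rewrite !mulr_ge0 ?expR_ge0.
    by rewrite nmulr_rle0 // vnorm_ge0.
  apply: (@le_trans _ _ (expR ka2 * (xi * (1 + expR kp)) * X n v)); last by rewrite ler_wpM2r.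
  apply: (@le_trans _ _ (xi * (1 + expR kp) * X n v)); first by rewrite -mulrA ler_wpM2l.
  rewrite ler_wpM2r // -[X in X <= _]mul1r ler_wpM2r //.
    by rewrite mulr_ge0 // addr_ge0 // expR_ge0.
  by rewrite -[X in X <= _]expR0 ler_expR ka2_ge0.
have XU : expR (- ka2) * X n v <= vnorm (U n *m v).
  have := fnorm_le (U n *m v) (leqnn n); rewrite subnn minn0 mulr0 addr0 => h2.
  rewrite -[X in _ <= X]mul1r -expR0 -(addNr ka2) expRD -mulrA ler_wpM2l ?expR_ge0 //.
have : vnorm (U n *m v) - xi * vnorm v <= X 0 v.
  rewrite X0E -!vnorm_proj lerBlDr; apply: (@le_trans _ _ (vnorm (proj 0 v) + vnorm (proj 0 v - proj n v))).
    by rewrite -[in X in X <= _](subKr (proj 0 v) (proj n v)) ler_vnormB.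
  by rewrite lerD2l.
have := mulr_ge0 (expR_ge0 (- ka2)) X0; lra.
Qed.

Lemma return_fast v : Y 0 v <= X 0 v -> Y 0 (An n p *m v) <= X 0 (An n p *m v) /\
  expR (t3 * n%:R) * X 0 v <= X 0 (An n p *m v).
Proof.
move=> /cone_forward /(_ _ (leqnn n)) [YX Xn]; rewrite -/(cz n v) in YX Xn *.
have X1 := wrap_X YX; have Y1 := wrap_Y (lexx _) YX.
have := mulr_ge0 (expR_ge0 (- ka2)) (X_ge0 n (cz n v)) => p0.
split; first by lra.
apply: le_trans X1; apply: (@le_trans _ _ (expR (- ka2) / 2 * expR (t2 * n%:R) * X 0 v)).
  by rewrite ler_wpM2r // X_ge0.
by rewrite -mulrA ler_wpM2l // divr_ge0 // expR_ge0.
Qed.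

Lemma return_slow v : X 0 (An n p *m v) <= Y 0 (An n p *m v) ->
  X 0 v <= Y 0 v /\ Y 0 (An n p *m v) <= expR (s3 * n%:R) * Y 0 v.
Proof.
rewrite -/(cz n v) => XY0.
have XY : X n (cz n v) <= Y n (cz n v).
  rewrite leNgt; apply/negP => YX.
  have X1 := wrap_X (ltW YX); have Y1 := wrap_Y (lexx _) (ltW YX).
  have : 0 < expR (- ka2) * X n (cz n v).
    by rewrite mulr_gt0 ?expR_gt0 //; apply: le_lt_trans YX; exact: Y_ge0.
  lra.
have [h00 hY] := cone_backward (leqnn n) XY; split => //; apply: le_trans hY.
apply: (le_trans (wrap_Y XY (lexx _))).
rewrite -[X in _ <= X]mul1r ler_wpM2r ?Y_ge0 //.
have : expR (- ka2) <= 1 by rewrite -[X in _ <= X]expR0 ler_expR oppr_le0 ka2_ge0.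
lra.
Qed.

Lemma cocycle_return m : An (n * m.+1) p = An n p *m An (n * m) p.
Proof.
have it m' : iter (n * m') f p = p.
  by elim: m' => [|m' IH]; rewrite ?muln0 // mulnS iterD IH.
by rewrite mulnS addnC cocycleD it.
Qed.

Lemma periodic_fast m a :
  expR (t3 * (n * m)%:R) * vnorm a <= vnorm (U 0 *m (An (n * m) p *m ((U 0)^T *m a))).
Proof.
pose v m := An (n * m) p *m ((U 0)^T *m a).
suff : Y 0 (v m) <= X 0 (v m) /\ expR (t3 * (n * m)%:R) * vnorm a <= X 0 (v m).
  by rewrite X0E => -[].
elim: m => [|m [IH1 IH2]].
  rewrite /v muln0 /= !mul1mx mulr0 expR0 mul1r X0E mulmxA UU mul1mx; split => //.
  rewrite Y0E /proj (mulmxA (U 0)) UU mul1mx subrr.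
  have := snorm_le (leq0n n) (mulmx0 _ (U 0)); rewrite vnorm0 mulr0 => s0'.
  by apply: (@le_trans _ _ 0); rewrite ?vnorm_ge0 // pmulr_rle0 ?expR_gt0.
have [h1 h2] := return_fast IH1.
rewrite /v cocycle_return -mulmxA -/(v m); split => //; apply: le_trans h2.
rewrite mulnS natrD mulrDr expRD -mulrA ler_wpM2l ?expR_ge0 //.
Qed.

Lemma periodic_slow m l v : (l <= m)%N -> U 0 *m (An (n * m) p *m v) = 0 ->
  vnorm (An (n * l) p *m v) <= (1 + expR kp) * expR ka2 * expR (s3 * (n * l)%:R) * vnorm v.
Proof.
move=> lm Um.
have XYm : X 0 (An (n * m) p *m v) <= Y 0 (An (n * m) p *m v).
  by rewrite X0E Um vnorm0 Y_ge0.
have XYl : X 0 (An (n * l) p *m v) <= Y 0 (An (n * l) p *m v).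
  rewrite -(subnK lm) in XYm; elim: (m - l)%N XYm => [//|i IH].
  by rewrite addSn cocycle_return -mulmxA => /return_slow[hXY _]; exact: IH.
have Yl : Y 0 (An (n * l) p *m v) <= expR (s3 * (n * l)%:R) * Y 0 v.
  elim: l {lm} XYl => [|l IH]; first by rewrite muln0 /= mul1mx mulr0 expR0 mul1r.
  rewrite cocycle_return -mulmxA => /return_slow[/IH h1 h2]; apply: (le_trans h2).
  by rewrite mulnS natrD mulrDr expRD -mulrA ler_wpM2l ?expR_ge0.
have Y0v : Y 0 v <= expR ka2 * vnorm v.
  apply: (le_trans (Y0_le v)); apply: ler_pM; rewrite ?expR_ge0 ?vnorm_ge0 ?vnorm_coproj_le //.
  by rewrite ler_expR gerBl.
have h2 : vnorm (An (n * l) p *m v) <= (1 + expR kp) * Y 0 (An (n * l) p *m v).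
  rewrite mulrDl mul1r -[in X in X <= _](subrK (proj 0 (An (n * l) p *m v)) (An (n * l) p *m v)) addrC.
  apply: (le_trans (ler_vnormD _ _)); apply: lerD; first by rewrite vnorm_proj -X0E.
  rewrite Y0E mulrA -expRD subrr expR0 mul1r; exact: vnorm_le_snorm.
apply: (le_trans h2); rewrite -!mulrA ler_wpM2l ?addr_ge0 ?expR_ge0 //.
apply: (le_trans Yl); by rewrite [X in _ <= X]mulrCA ler_wpM2l ?expR_ge0.
Qed.

End Cone.

Definition orbit_splitting (R : realType) (M : pointedType) (f : M -> M) d (A : M -> 'M[R]_d)
    k n z (U : nat -> 'M[R]_(k, d)) (ka s0 t0 ep : R) : Prop :=
  [/\ forall j, U j *m (U j)^T = 1%:M,
      forall j, (j < n)%N ->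
        U j.+1 *m A (iter j f z) *m (U j)^T *m U j = U j.+1 *m A (iter j f z),
      forall j m b, (j + m <= n)%N -> U j *m b = 0 ->
        vnorm (cocycle f A m (iter j f z) *m b)
          <= expR (ka + s0 * m%:R + ep * (minn j (n - j))%:R) * vnorm b &
      forall j m w, (j + m <= n)%N ->
        expR (- ka + t0 * m%:R - ep * (minn (j + m) (n - (j + m)))%:R) * vnorm w
          <= vnorm (quot f A z U j m *m w)].

Lemma shadowing_cone (R : realType) (be ka s0 t0 ep om de s t : R) :
  0 <= ka -> 0 <= ep -> 0 < de -> ep <= de -> 2 * ep <= om ->
  s0 + 4 * de <= s -> t + 3 * de <= t0 -> s < t ->
  exists rh xi (N : nat), [/\ 0 < rh, 0 < xi &
    forall (M : pointedType) (f : M -> M) d (A : M -> 'M[R]_d) k n z (U : nat -> 'M[R]_(k, d)) p,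
    (forall x v, vnorm (A x *m v) <= expR be * vnorm v) ->
    orbit_splitting f A n z U ka s0 t0 ep ->
    (N < n)%N -> iter n f p = p ->
    (forall v, vnorm ((U 0)^T *m (U 0 *m v) - (U n)^T *m (U n *m v)) <= xi * vnorm v) ->
    (forall j v, (j < n)%N -> vnorm ((A (iter j f p) - A (iter j f z)) *m v)
       <= rh * expR (- om * (minn j (n - j))%:R) * vnorm v) ->
    (forall m a, expR (t * (n * m)%:R) * vnorm a
       <= vnorm (U 0 *m (cocycle f A (n * m) p *m ((U 0)^T *m a)))) /\
    exists K, forall m l v, (l <= m)%N -> U 0 *m (cocycle f A (n * m) p *m v) = 0 ->
      vnorm (cocycle f A (n * l) p *m v) <= K * expR (s * (n * l)%:R) * vnorm v].
Proof.
move=> ka0 ep0 de0 ep_de om_ep s0s tt0 st.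
pose ka2 := ka + ln (1 - expR (- de))^-1.
pose s2 := s0 + de + ep + de; pose t2 := t0 - 2 * de.
pose va := Num.min ((expR s - expR s2) / 2) ((expR (t0 - de) - expR t2) / 2).
have va0 : 0 < va.
  by rewrite lt_min !divr_gt0 ?subr_gt0 ?ltr_expR // /s2 /t2; lra.
have ka20 : 0 <= ka2 by exact: ka2_ge0.
have l4 : 0 <= ln (4 : R) by rewrite ln_ge0 // ler1n.
pose h := 2 * ka2 + ln 4; pose kp := Num.max 0 (ka2 + h + be - ln (va / 2)).
have h0 : 0 <= h by rewrite addr_ge0 // mulr_ge0.
have kp0 : 0 <= kp by rewrite le_max lexx.
pose rh := Num.min (va / expR (ka2 + ep + kp)) (va / 2 / expR (ka2 + h)).
pose xi := expR (- ka2) / 8 / (expR ka2 * (1 + expR kp)).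
have e1 : 0 < 1 + expR kp by rewrite addr_gt0 ?expR_gt0.
have va2 : 0 < va / 2 by rewrite divr_gt0.
exists rh, xi, (Num.bound (`|h / de|) + Num.bound (`|(ka2 + ln 2) / de|))%N; split.
- by rewrite lt_min !divr_gt0 ?expR_gt0.
- by rewrite !divr_gt0 ?mulr_gt0 ?expR_gt0.
move=> M f d A k n z U p A_bound [UU U_inv slow fast] Nn per wrap close.
have nb (x : R) : (Num.bound (`|x / de|) <= n)%N -> x <= de * n%:R.
  move=> bn; rewrite mulrC -ler_pdivrMr //; apply: (le_trans (ler_norm _)).
  by apply: (le_trans (ltW (archi_boundP (normr_ge0 _)))); rewrite ler_nat.
have n1 : h <= de * n%:R by apply: nb; apply: leq_trans (ltnW Nn); exact: leq_addr.
have n2 : ka2 + ln 2 <= de * n%:R by apply: nb; apply: leq_trans (ltnW Nn); exact: leq_addl.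
have rh0 : 0 <= rh by rewrite le_min !divr_ge0 ?expR_ge0 // ltW.
have va_fast : rh * expR (ka2 + ep + kp) <= va.
  by rewrite -ler_pdivlMr ?expR_gt0 // ge_min lexx.
have va_slow : rh * expR (ka2 + h) <= va / 2.
  by rewrite -ler_pdivlMr ?expR_gt0 // ge_min lexx orbT.
have va_mixed : expR (ka2 + h - kp + be) <= va / 2.
  rewrite -[X in _ <= X]lnK ?posrE // ler_expR.
  have : ka2 + h + be - ln (va / 2) <= kp by rewrite le_max lexx orbT.
  lra.
have t2_lt : expR t2 <= expR (t0 - de) - 2 * va.
  have : va <= (expR (t0 - de) - expR t2) / 2 by rewrite ge_min lexx orbT.
  lra.
have s3_gt : expR s2 + 2 * va <= expR s.
  have : va <= (expR s - expR s2) / 2 by rewrite ge_min lexx.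
  lra.
have s3_t2 : s <= t2 by rewrite /t2; lra.
have wrap_h : expR (ka2 - h) <= expR (- ka2) / 4.
  have -> : ka2 - h = - ka2 - ln 4 by rewrite /h; ring.
  by rewrite expRD (expRN (ln _)) lnK // posrE.
have wrap_xi : expR ka2 * (xi * (1 + expR kp)) <= expR (- ka2) / 8.
  by rewrite mulrCA /xi divfK // mulf_neq0 // ?gt_eqF ?expR_gt0.
have t3_lt : expR (t * n%:R) <= expR (- ka2) / 2 * expR (t2 * n%:R).
  have -> : expR (- ka2) / 2 = expR (- ka2 - ln 2) by rewrite expRD (expRN (ln _)) lnK // posrE.
  rewrite -expRD ler_expR.
  have : (t + de) * n%:R <= t2 * n%:R by rewrite ler_wpM2r // /t2; lra.
  lra.
split.
  move=> m a.
  exact: (periodic_fast A_bound UU U_inv ep0 slow fast de0 kp0 (ltW de0) h0 rh0 om_ep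
    close va_fast va_slow va_mixed t2_lt s3_gt s3_t2 per ka0 wrap n1 wrap_h wrap_xi t3_lt).
exists ((1 + expR kp) * expR ka2) => m l v.
exact: (periodic_slow A_bound UU U_inv ep0 slow fast de0 kp0 (ltW de0) h0 rh0 om_ep
    close va_fast va_slow va_mixed t2_lt s3_gt s3_t2 per ka0 wrap n1 wrap_h wrap_xi).
Qed.

(** * Exponents at a shadowing periodic point *)

Section PeriodicExponents.
Variables (R : realType) (M : pointedType) (f : M -> M) (d : nat) (A : M -> 'M[R]_d).
Variable be : R.
Hypothesis A_bound : forall x v, vnorm (A x *m v) <= expR be * vnorm v.
Local Notation An := (cocycle f A).

Lemma grows_le_multiples n s x (K : R) v : (0 < n)%N ->
  (forall l, vnorm (An (n * l) x *m v) <= K * expR (s * (n * l)%:R)) -> grows_le f A s x v.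
Proof.
move=> n0 hK; have K0 : 0 <= K.
  by have := hK 0%N; rewrite muln0 mulr0 expR0 mulr1; exact: le_trans (vnorm_ge0 _).
exists (expR (`|be| * n%:R) * (K * expR (`|s| * n%:R))) => m.
have rn : ((m %% n)%:R : R) <= n%:R by rewrite ler_nat ltnW // ltn_mod.
rewrite {1 2}(divn_eq m n) mulnC; set l := (m %/ n)%N; set r := (m %% n)%N in rn *.
rewrite cocycleD -mulmxA.
have Ab y w : vnorm (A y *m w) <= expR `|be| * vnorm w.
  apply: (le_trans (A_bound _ _)); rewrite ler_wpM2r ?vnorm_ge0 // ler_expR; exact: ler_norm.
apply: (le_trans (cocycle_bound f Ab r _ _)); rewrite -!mulrA; apply: ler_pM; rewrite ?expR_ge0 ?vnorm_ge0 //.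
  by rewrite ler_expR ler_wpM2l.
apply: (le_trans (hK l)); rewrite ler_wpM2l // -expRD ler_expR natrD mulrDr.
have : - s * r%:R <= `|s| * n%:R.
  by apply: (le_trans (ler_norm _)); rewrite normrM normrN normr_nat ler_wpM2l.
lra.
Qed.

Variables (k n : nat) (p : M) (U : 'M[R]_(k, d)) (s t : R).
Variables (gk : 'I_d -> \bar R) (P : 'M[R]_d).
Hypothesis n0 : (0 < n)%N.
Hypothesis P_basis : lyap_basis f A p gk P.
Hypothesis gk_mono : forall i j : 'I_d, (i <= j)%N -> (gk j <= gk i)%E.
Hypothesis UU : U *m U^T = 1%:M.

Lemma periodic_exponent_ge :
  (forall m a, expR (t * (n * m)%:R) * vnorm a
     <= vnorm (U *m (An (n * m) p *m (U^T *m a)))) ->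
  forall i : 'I_d, (i < k)%N -> (t%:E <= gk i)%E.
Proof.
move=> fast i ik; rewrite leNgt; apply/negP => /ereal_mid_lt[r [gr]]; rewrite lte_fin => rt.
have [K K0 hK] := grow_kernel P_basis (k := i) (fun j ij => le_lt_trans (gk_mono ij) gr).
have [V' [_ V'0 _]] := kernel_frame P_basis (ltnW (ltn_ord i)).
have [y y1 Vy] := ker_unit (V' *m U^T) ik.
rewrite -mulmxA in Vy; have grow := hK _ (V'0 _ Vy).
apply: (@expR_le_false _ (r * n%:R) (t * n%:R) K); first by rewrite ltr_pM2r // ltr0n.
exists 0%N => m _; rewrite -!mulrA -!natrM.
have := fast m y; rewrite y1 mulr1 => /le_trans; apply.
have UU' : U^T^T *m U^T = 1%:M by rewrite trmxK.
have := vnorm_tr_le (An (n * m) p *m (U^T *m y)) UU'; rewrite trmxK => /le_trans; apply.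
by apply: (le_trans (grow _)); rewrite vnorm_orth // y1 mulr1.
Qed.

Lemma periodic_exponent_le :
  (exists K, forall m l v, (l <= m)%N -> U *m (An (n * m) p *m v) = 0 ->
     vnorm (An (n * l) p *m v) <= K * expR (s * (n * l)%:R) * vnorm v) ->
  forall i : 'I_d, (k <= i)%N -> (gk i <= s%:E)%E.
Proof.
move=> [K slow] i ki; rewrite leNgt; apply/negP => sg.
have id : (i < d)%N := ltn_ord i.
pose w := widen_ord id : 'I_i.+1 -> 'I_d; pose P' := colsub w P.
have /choice[y hy] m : exists y : 'cV[R]_i.+1, vnorm y = 1 /\ U *m (An (n * m) p *m (P' *m y)) = 0.
  have [y y1 Uy] := ker_unit (U *m An (n * m) p *m P') (leq_ltn_trans ki (ltnSn i)).
  by exists y; rewrite !mulmxA in Uy *.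
have [G [GU sG]] := ultraFilterLemma eventually_filter.
have GP := ultra_proper (UltraFilter := GU).
have hl a : exists l : R, y m a 0 @[m --> G] --> l.
  apply: (@bounded_ultra_cvg R nat G _ 1) => m.
  by rewrite -(hy m).1; exact: ler_coord_vnorm.
pose z : 'cV[R]_i.+1 := \col_a sval (cid (hl a)).
have yz : mxcvg G y z by move=> a b; rewrite mxE (ord1 b); exact: svalP (cid (hl a)).
have z1 : vnorm z = 1.
  have h : vnorm (y m) @[m --> G] --> vnorm z by exact: mxcvg_vnorm.
  have hc : vnorm (y m) @[m --> G] --> (1 : R).
    by rewrite (_ : (fun m => vnorm (y m)) = cst 1); [exact: cvg_cst|apply/funext => m; exact: (hy m).1].
  exact: cvg_unique _ h hc.
have cv (B : 'M[R]_d) : vnorm (B *m (P' *m y m)) @[m --> G] --> vnorm (B *m (P' *m z)).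
  by apply: mxcvg_vnorm; do 2![apply: mxcvg_mul; first exact: mxcvg_cst].
have grow l : vnorm (An (n * l) p *m (P' *m z)) <= `|K| * mxn P' * expR (s * (n * l)%:R).
  apply: (cvgr_to_le (cv _)); apply: sG; exists l => // m /= lm.
  apply: (le_trans (slow m l _ lm (hy m).2)).
  rewrite mulrAC ler_wpM2r ?expR_ge0 //.
  apply: (le_trans (ler_wpM2r (vnorm_ge0 _) (ler_norm K))); rewrite ler_wpM2l //.
  by have := vnorm_mxn P' (y m); rewrite (hy m).1 mulr1.
have [_ _ P0] := P_basis.
have zP : P' *m z = P *m (colsub w 1%:M *m z).
  by rewrite mulmxA mulmx_colsub mulmx1.
have := grows_le_multiples n0 grow; rewrite zP => /P0 z0.
have : z = 0.
  apply/colP => a; rewrite [RHS]mxE.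
  have -> : z a 0 = (colsub w 1%:M *m z) (w a) 0.
    rewrite [RHS]mxE (bigD1 a) //= [colsub _ _ _ _]mxE [1%:M _ _]mxE eqxx mul1r big1 ?addr0 // => b ba.
    by rewrite [colsub _ _ _ _]mxE [1%:M _ _]mxE -val_eqE /= val_eqE eq_sym (negbTE ba) mul0r.
  by apply: z0; apply: lt_le_trans sg _; apply: gk_mono; rewrite /= -ltnS.
by move=> z0'; move: z1; rewrite z0' vnorm0 => /eqP; rewrite eq_sym oner_eq0.
Qed.

End PeriodicExponents.

(** * Orbit segments between good times *)

Section Windows.
Variables (R : realType) (M : pointedType) (dist : M -> M -> R).
Local Notation MT := (g_sigma_algebraType (mopen dist)).
Implicit Types (f : M -> M) (B G : set MT) (z : M).

Definition sparse f B (eta : R) z :=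
  forall n, (0 < n)%N -> (@visits _ MT f B n z)%:R < eta * n%:R.

Definition windows f G (eta : R) z n := forall i, (i <= n)%N -> exists a b,
  [/\ (a <= i)%N, (i <= b)%N, G (iter a f z), G (iter b f z) &
    (i - a)%:R <= 2 * eta * ((minn i (n - i))%:R + 1) /\
    (b - i)%:R <= 2 * eta * ((minn i (n - i))%:R + 1)].

Lemma sparse_window f G eta z i : 0 < eta -> eta <= 1 / 2 -> sparse f (~` G) eta z ->
  exists a b, [/\ (a <= i)%N, (i <= b)%N, G (iter a f z), G (iter b f z) &
    (i - a)%:R <= 2 * eta * (i%:R + 1) /\ (b - i)%:R <= 2 * eta * i%:R].
Proof.
move=> eta0 eta2 sp.
have [j [/contrapT Gj hj]] := @next_good_time R M dist f _ eta z i eta0 eta2 sp.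
have G0 : `[< (0 <= i)%N /\ G (iter 0 f z) >].
  apply/asboolP; split => //; apply: contrapT => nG.
  have := sp 1%N isT; rewrite /visits big_nat1 mem_set // mulr1 /=; lra.
have ub a : `[< (a <= i)%N /\ G (iter a f z) >] -> (a <= i)%N by move/asboolP => [].
have [a /asboolP[ai Ga] amax] := ex_maxnP (ex_intro _ 0%N G0) ub.
exists a, (i + j)%N; rewrite leq_addr addKn; split => //; split => //.
have bad u : (a.+1 <= u < a.+1 + (i - a))%N -> (~` G) (iter u f z).
  rewrite addSn subnKC // ltnS => /andP[au ui] Gu.
  have : (u <= a)%N by apply: amax; apply/asboolP.
  by rewrite leqNgt au.
have h : (a.+1 + (i - a) <= i.+1)%N by rewrite addSn subnKC.
have := visits_full (dist := dist) h bad; rewrite -(ler_nat R) => /le_trans; apply.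
apply: (le_trans (ltW (sp _ (ltn0Sn i)))); rewrite natr1 ler_wpM2r //; lra.
Qed.

Lemma two_sided_windows f g G eta z n : cancel f g -> 0 < eta -> eta <= 1 / 2 ->
  sparse f (~` G) eta z -> sparse g (~` G) eta (iter n f z) -> windows f G eta z n.
Proof.
move=> fg eta0 eta2 spf spg i i_n.
have back j : (j <= n)%N -> iter j g (iter n f z) = iter (n - j) f z.
  move=> jn; rewrite -{1}(subnKC jn) iterD.
  by elim: j {jn} (iter (n - j) f z) => //= j IH y; rewrite -iterS iterSr /= fg IH.
have m1 (x y : nat) : (x <= y)%N -> 2 * eta * x%:R <= 2 * eta * (y%:R + 1).
  by move=> xy; rewrite ler_wpM2l ?mulr_ge0 ?(ltW eta0) // natr1 ler_nat leqW.
have [le_i|lt_i] := leqP i (n - i).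
  have [a [b [ai ib Ga Gb [ha hb]]]] := sparse_window i eta0 eta2 spf.
  exists a, b; split => //; split => //.
  by apply: (le_trans hb); exact: m1.
have [a [b [ai ib Ga Gb [ha hb]]]] := sparse_window (n - i) eta0 eta2 spg.
have bn : (b <= n)%N.
  have : ((b - (n - i))%:R : R) <= (n - i)%:R.
    apply: (le_trans hb); rewrite -[X in _ <= X]mul1r ler_wpM2r //; lra.
  rewrite ler_nat => h; lia.
have an : (a <= n)%N by rewrite (leq_trans ai) // leq_subr.
rewrite back // in Ga; rewrite back // in Gb.
exists (n - b)%N, (n - a)%N; split => //; [lia|lia|].
split; last by have -> : (n - a - i = n - i - a)%N by lia.
have -> : (i - (n - b) = b - (n - i))%N by lia.
by apply: (le_trans hb); exact: m1.
Qed.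

Lemma windowsS f G G' (eta eta' : R) z n : G `<=` G' -> 0 <= eta -> eta <= eta' ->
  windows f G eta z n -> windows f G' eta' z n.
Proof.
move=> GG' e0 ee h i i_n; have [a [b [ai ib Ga Gb [ha hb]]]] := h i i_n.
have m1 : 2 * eta * ((minn i (n - i))%:R + 1) <= 2 * eta' * ((minn i (n - i))%:R + 1).
  by rewrite ler_wpM2r ?addr_ge0 // ler_wpM2l.
exists a, b; split; [done|done|exact: GG'|exact: GG'|].
by split; [exact: le_trans ha m1 | exact: le_trans hb m1].
Qed.

End Windows.

Lemma minn_subD n j m : (minn j (n - j) <= minn (j + m) (n - (j + m)) + m)%N.
Proof. lia. Qed.

Section Segments.
Variables (R : realType) (M : pointedType) (dist : M -> M -> R) (f : M -> M).
Variables (d : nat) (A : M -> 'M[R]_d) (gamma : 'I_d -> \bar R) (be : R).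
Hypothesis be_ge0 : 0 <= be.
Hypothesis A_bound : forall x v, vnorm (A x *m v) <= expR be * vnorm v.
Local Notation An := (cocycle f A).
Local Notation MT := (g_sigma_algebraType (mopen dist)).

Lemma frame_det_stretch k0 n x (U V : 'M[R]_(k0.+1, d)) w : (k0 < d)%N ->
  U *m U^T = 1%:M -> V *m V^T = 1%:M ->
  frame_det f A n x U V * vnorm w <= vnorm (V *m An n x *m U^T *m w) * Nvol k0 (An n x).
Proof.
move=> kd UU VV.
have [->|w0] := eqVneq w 0; first by rewrite mulmx0 !vnorm0 mulr0 mul0r.
have wp := vnorm_gt0 w0; pose y := (vnorm w)^-1 *: w.
have y1 : vnorm y = 1 by rewrite vnormZ ger0_norm ?invr_ge0 ?vnorm_ge0 // mulVf ?gt_eqF.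
have UU' : U^T^T *m U^T = 1%:M by rewrite trmxK.
have VV' : V^T^T *m V^T = 1%:M by rewrite trmxK.
have := @vol_le_stretch_Nvol R d k0 (V^T *m V *m An n x) U^T y kd UU' y1.
have -> : V^T *m V *m An n x *m U^T = V^T *m (V *m An n x *m U^T) by rewrite !mulmxA.
rewrite vol_mulr // (vol_orth VV') mul1r -/(frame_det f A n x U V) -[_ *m _ *m y]mulmxA (vnorm_orth _ VV').
rewrite /y -scalemxAr vnormZ ger0_norm ?invr_ge0 ?vnorm_ge0 // => h.
have hN : Nvol k0 (V^T *m V *m An n x) <= Nvol k0 (An n x).
  have kd' := ltnW kd; apply: (le_trans (Nvol_mul kd' _ _)).
  apply: ler_piMl; first exact: Nvol_ge0.
  rewrite -[X in _ <= X](expr1n _ k0); apply: (Nvol_expr kd' ler01) => v; rewrite mul1r -mulmxA (vnorm_orth _ VV').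
  by have := vnorm_tr_le v VV'; rewrite trmxK.
rewrite -ler_pdivlMr //; apply: (le_trans h); rewrite -mulrA mulrC.
by rewrite ler_wpM2r ?invr_ge0 ?vnorm_ge0 // ler_wpM2l ?vnorm_ge0.
Qed.

Lemma slow_segment k s (G : set MT) (q : nat) (eta : R) z n (U : nat -> 'M[R]_(k, d)) : 0 <= eta ->
  (forall x, G x -> exists V : 'M[R]_(k, d), slow_frame f A s (expR q%:R) x V) ->
  (forall j, is_frame f A s (iter j f z) (U j)) ->
  (forall j (V : 'M[R]_(k, d)), slow_frame f A s (expR q%:R) (iter j f z) V -> forall v : 'cV[R]_d, U j *m v = 0 -> V *m v = 0) ->
  windows f G eta z n ->
  let e := (be + `|s|) * (2 * eta) in
  forall j m (b : 'cV[R]_d), (j <= n)%N -> U j *m b = 0 ->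
    vnorm (An m (iter j f z) *m b) <= expR (q%:R + e + s * m%:R + e * (minn j (n - j))%:R) * vnorm b.
Proof.
move=> eta0 slowG frame ker win e j m b jn Ub.
have [_ [c [_ jc _ Gc [_ hc]]]] := win j jn.
set r := (c - j)%N in hc; set ta := (minn j (n - j))%:R in hc *.
have hr : (be + `|s|) * r%:R <= e + e * ta.
  by have := ler_wpM2l (addr_ge0 be_ge0 (normr_ge0 s)) hc; rewrite /e; lra.
have := ler_norm s; have := ler_norm (- s); rewrite normrN => s1 s2.
have sr y : 0 <= y -> - s * y <= `|s| * y by move=> y0; rewrite ler_wpM2r.
have q0 : 0 <= q%:R :> R by [].
have [mr|rm] := leqP m r.
  apply: (le_trans (cocycle_bound f A_bound m _ b)); rewrite ler_wpM2r ?vnorm_ge0 // ler_expR.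
  have h1 : (be + `|s|) * m%:R <= (be + `|s|) * r%:R.
    by rewrite ler_wpM2l ?addr_ge0 // ler_nat.
  by have := sr m%:R (ler0n _ _); lra.
have mE : m = (r + (m - r))%N by rewrite subnKC // ltnW.
have rjc : (r + j = c)%N by exact: subnK.
rewrite [in X in X <= _]mE cocycleD -mulmxA -iterD rjc.
have [V sV] := slowG _ Gc.
have Vb : V *m (An r (iter j f z) *m b) = 0.
  apply: (ker _ _ sV); have hc' := frame c; rewrite -rjc iterD in hc'.
  by have := frame_comp (frame j) hc' b; rewrite Ub mulmx0 subr0 -{1}rjc.
have := sV.2 (m - r)%N (An r (iter j f z) *m b); rewrite Vb mulmx0 subr0 => /le_trans; apply.
apply: (le_trans (ler_wpM2l (mulr_ge0 (expR_ge0 _) (expR_ge0 _)) (cocycle_bound f A_bound r _ b))).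
rewrite mulrA -!expRD ler_wpM2r ?vnorm_ge0 // ler_expR.
have e1 : m%:R = r%:R + (m - r)%:R :> R by rewrite -natrD -mE.
by have := sr r%:R (ler0n _ _); rewrite e1; lra.
Qed.

Lemma fast_segment k0 s (G : set MT) (q : nat) (eta P0 P1 ka : R) z n (U : nat -> 'M[R]_(k0.+1, d)) :
  (k0 < d)%N -> 0 <= eta ->
  (forall x, G x -> forall m, Nvol k0 (An m x) <= expR (q%:R + P0 * m%:R)) ->
  (forall j, is_frame f A s (iter j f z) (U j)) ->
  (forall a m, G (iter a f z) -> G (iter (a + m) f z) ->
     expR (- ka + P1 * m%:R) <= frame_det f A m (iter a f z) (U a) (U (a + m)%N)) ->
  windows f G eta z n ->
  let e := 6 * eta * ((2 * k0.+1%:R) * be + `|P0| + `|P1|) in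
  forall j m (w : 'cV[R]_k0.+1), (j + m <= n)%N ->
    expR (- (ka + q%:R + e) + (P1 - P0 - e) * m%:R - e * (minn (j + m) (n - (j + m)))%:R) * vnorm w
      <= vnorm (quot f A z U j m *m w).
Proof.
move=> kd eta0 NG frame detG win e j m w jmn.
have jn : (j <= n)%N by exact: leq_trans (leq_addr m j) jmn.
have [a [c [aj jc Ga Gc [ha hc]]]] := win j jn.
have [_ [b [_ jb _ Gb [_ hb]]]] := win (j + m)%N jmn.
have tauD : (minn j (n - j))%:R <= (minn (j + m) (n - (j + m)))%:R + m%:R :> R.
  by rewrite -natrD ler_nat minn_subD.
set g1 := (j - a)%N in ha; set g2 := (b - (j + m))%N in hb; set r := (c - j)%N in hc.
set tau := (minn (j + m) (n - (j + m)))%:R in hb tauD *.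
set tau' := (minn j (n - j))%:R in ha hc tauD.
pose K : R := k0.+1%:R; have K0 : 0 <= K * be by rewrite mulr_ge0.
have k0K : k0%:R * be <= K * be by rewrite ler_wpM2r // ler_nat.
pose C := 2 * K * be + `|P0| + `|P1|.
have C0 : 0 <= C by rewrite /C !addr_ge0 // -mulrA mulr_ge0.
have gaps : C * (g1%:R + g2%:R + r%:R) <= e * tau + e * m%:R + e.
  have h : g1%:R + g2%:R + r%:R <= 2 * eta * (3 * tau + 3 * m%:R + 3).
    have := ler_wpM2l (mulr_ge0 (ler0n R 2) eta0) tauD.
    have : 0 <= 2 * eta * m%:R by rewrite !mulr_ge0.
    lra.
  apply: (le_trans (ler_wpM2l C0 h)); rewrite /e -/K -/C; lra.
have e1 := ler_norm P0; have e2 := ler_norm (- P0); have e3 := ler_norm P1; have e4 := ler_norm (- P1).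
rewrite normrN in e2; rewrite normrN in e4.
have pr (x y t : R) : x <= y -> 0 <= t -> x * t <= y * t by move=> xy t0; rewrite ler_wpM2r.
have det_lo : expR (- ka + P1 * m%:R - (K * be + `|P1|) * (g1%:R + g2%:R))
    <= frame_det f A m (iter j f z) (U j) (U (j + m)%N).
  have aE : (a + g1 = j)%N by rewrite subnKC.
  have bE : (a + (g1 + m + g2) = b)%N by rewrite !addnA aE subnKC.
  have := detG a (g1 + m + g2)%N Ga; rewrite bE => /(_ Gb).
  have fa := frame a; have fj := frame j; have fjm := frame (j + m)%N; have fb := frame b.
  have ajm : (a + (g1 + m) = j + m)%N by rewrite addnA aE.
  have fj' : is_frame f A s (iter g1 f (iter a f z)) (U j) by rewrite -iterD addnC aE.
  have fjm' : is_frame f A s (iter (g1 + m) f (iter a f z)) (U (j + m)%N).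
    by rewrite -iterD addnC ajm.
  have fb' : is_frame f A s (iter (g1 + m + g2) f (iter a f z)) (U b) by rewrite -iterD addnC bE.
  rewrite (frame_detD fa fjm' fb') (frame_detD fa fj' fjm') -!iterD.
  rewrite ![(_ + a)%N]addnC ajm aE => h.
  have u1 := frame_det_upper A_bound fa fj'.
  have u2 : frame_det f A g2 (iter (j + m) f z) (U (j + m)%N) (U b) <= expR (K * be * g2%:R).
    apply: (frame_det_upper A_bound fjm); by rewrite -iterD addnC subnKC.
  have D0 : 0 <= frame_det f A m (iter j f z) (U j) (U (j + m)%N) by exact: normr_ge0.
  have {}h := le_trans h (ler_pM (normr_ge0 _) (mulr_ge0 D0 (normr_ge0 _)) u2 (ler_wpM2l D0 u1)).
  rewrite mulrCA -expRD -ler_pdivrMr ?expR_gt0 // -expRN -expRD in h.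
  apply: le_trans h; rewrite ler_expR !natrD.
  have := pr _ _ (g1%:R + g2%:R) e4 (addr_ge0 (ler0n _ _) (ler0n _ _)).
  by rewrite -/K; lra.
have N_hi : Nvol k0 (An m (iter j f z)) <= expR (q%:R + P0 * m%:R + (K * be + `|P0|) * r%:R).
  have q0 : 0 <= q%:R :> R by [].
  have Nb l x : Nvol k0 (An l x) <= expR (K * be * l%:R).
    apply: (@le_trans _ _ (expR (be * l%:R) ^+ k0)).
      by apply: Nvol_expr (ltnW kd) _ _ (expR_ge0 _) _; exact: cocycle_bound.
    rewrite -expRM_natl ler_expR; have := pr _ _ l%:R k0K (ler0n _ _); lra.
  have [mr|rm] := leqP m r.
    apply: (le_trans (Nb _ _)); rewrite ler_expR.
    have h1 : (K * be + `|P0|) * m%:R <= (K * be + `|P0|) * r%:R by rewrite ler_wpM2l ?addr_ge0 // ler_nat.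
    have := pr _ _ m%:R e2 (ler0n _ _); lra.
  have mE : m = (r + (m - r))%N by rewrite subnKC // ltnW.
  have rjc : (r + j = c)%N by exact: subnK.
  rewrite [in X in X <= _]mE cocycleD -iterD rjc.
  apply: (le_trans (Nvol_mul (ltnW kd) _ _)).
  apply: (le_trans (ler_pM (Nvol_ge0 (ltnW kd) _) (Nvol_ge0 (ltnW kd) _) (NG _ Gc _) (Nb _ _))).
  have e5 : m%:R = r%:R + (m - r)%:R :> R by rewrite -natrD -mE.
  rewrite -expRD ler_expR e5.
  have := pr _ _ r%:R e2 (ler0n _ _); lra.
have := frame_det_stretch m (iter j f z) w kd (frame j).1 (frame (j + m)%N).1; rewrite -/(quot f A z U j m).
have w0 := vnorm_ge0 w.
move=> h; have {}h := le_trans (ler_wpM2r w0 det_lo) (le_trans h (ler_wpM2l (vnorm_ge0 _) N_hi)).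
rewrite -ler_pdivrMr ?expR_gt0 // -expRN mulrAC -expRD in h.
apply: le_trans h; rewrite ler_wpM2r // ler_expR.
have a0 : 0 <= `|P0| by []. have a1 : 0 <= `|P1| by [].
have g10 : 0 <= g1%:R :> R by []. have g20 : 0 <= g2%:R :> R by []. have r0 : 0 <= r%:R :> R by [].
have b1 : (K * be + `|P1|) * (g1%:R + g2%:R) <= C * (g1%:R + g2%:R).
  by apply: pr; rewrite ?addr_ge0 // /C; lra.
have b2 : (K * be + `|P0|) * r%:R <= C * r%:R by apply: pr => //; rewrite /C; lra.
lra.
Qed.

End Segments.

(** * Gaps in the spectrum *)

Section Cuts.
Variables (R : realType) (M : pointedType) (dist : M -> M -> R) (f : M -> M).
Variables (mu : {measure set (g_sigma_algebraType (mopen dist)) -> \bar R}).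
Variables (d : nat) (A : M -> 'M[R]_d) (gamma : 'I_d -> \bar R) (be : R).
Hypothesis dist_metric : is_metric dist.
Hypothesis mu1 : mu setT = 1%E.
Hypothesis f_cont : mcontinuous dist f.
Hypothesis f_inv : invariant_measure f mu.
Hypothesis f_erg : ergodic_measure f mu.
Hypothesis A_cont : forall x, mxcvg (mnbhs dist x) A (A x).
Hypothesis be_ge0 : 0 <= be.
Hypothesis A_bound : forall x v, vnorm (A x *m v) <= expR be * vnorm v.
Hypothesis gamma_mono : forall i j : 'I_d, (i <= j)%N -> (gamma j <= gamma i)%E.
Hypothesis ae_basis : {ae mu, forall x, exists P, lyap_basis f A x gamma P}.
Local Notation An := (cocycle f A).
Local Notation MT := (g_sigma_algebraType (mopen dist)).

Lemma slow_frame_mono k s (K K' : R) x (V : 'M[R]_(k, d)) : K <= K' ->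
  slow_frame f A s K x V -> slow_frame f A s K' x V.
Proof.
move=> KK' [VV h]; split => // n v; apply: (le_trans (h n v)).
by rewrite ler_wpM2r ?vnorm_ge0 // ler_wpM2r ?expR_ge0.
Qed.

Lemma expR_nat_ge (K : R) : exists q : nat, K <= expR q%:R.
Proof.
exists (Num.bound (`|K|)); apply: (le_trans (ler_norm K)).
apply: (le_trans (ltW (archi_boundP (normr_ge0 K)))).
by apply: le_trans (expR_ge1Dx _); rewrite lerDr.
Qed.

Lemma slow_frame_proj k s K x (U V : 'M[R]_(k, d)) : is_frame f A s x U ->
  slow_frame f A s K x V -> V^T *m V = U^T *m U.
Proof.
move=> [UU hU] sV; apply/esym/frame_proj_eq => //; first by case: sV.
by move=> v Vv; apply/hU; exact: slow_frame_grows sV Vv.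
Qed.

Lemma slow_frame_kernel k s K x (U V : 'M[R]_(k, d)) v : is_frame f A s x U ->
  slow_frame f A s K x V -> U *m v = 0 :> 'cV[R]_k -> V *m v = 0.
Proof.
move=> hU sV Uv; case: (sV) => VV _.
by rewrite -[V]mul1mx -VV -!mulmxA (mulmxA V^T) (slow_frame_proj hU sV) -mulmxA Uv !mulmx0.
Qed.

Lemma gap_segment (c : nat -> R) k s t eps : exponent_gap gamma k s t -> finite_upto gamma c k -> 0 < eps ->
  exists (G : nat -> set MT) eta, [/\ 0 < eta, forall q, measurable (G q),
    forall q q', (q <= q')%N -> G q `<=` G q', {ae mu, forall x, exists q, G q x} &
    forall q, (forall x, G q x -> exists V : 'M[R]_(k, d), slow_frame f A s (expR q%:R) x V) /\
      exists2 ka, 0 <= ka & forall z n (U : nat -> 'M[R]_(k, d)),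
        (forall j, is_frame f A s (iter j f z) (U j)) -> regular f A gamma z ->
        windows f (G q) eta z n -> orbit_splitting f A n z U ka s t eps].
Proof.
move=> gap fin eps0.
pose S q := [set x : MT | exists V : 'M[R]_(k, d), slow_frame f A s (expR q%:R) x V].
pose D := be + `|s| + 1; have D0 : 0 < D by rewrite ltr_wpDl // addr_ge0.
have step z (U : nat -> 'M[R]_(k, d)) : (forall j, is_frame f A s (iter j f z) (U j)) ->
    forall j, U j.+1 *m A (iter j f z) *m (U j)^T *m U j = U j.+1 *m A (iter j f z).
  by move=> hU j; have := @frame_mul R M f d A k s 1 _ _ _ (hU j) (hU j.+1); rewrite /= mulmx1.
have slow (G : set MT) q eta z n (U : nat -> 'M[R]_(k, d)) ka : G `<=` S q ->
    0 < eta -> (be + `|s|) * (2 * eta) <= eps ->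
    (forall j, is_frame f A s (iter j f z) (U j)) -> windows f G eta z n -> q%:R + eps <= ka ->
    forall j m (b : 'cV[R]_d), (j + m <= n)%N -> U j *m b = 0 ->
    vnorm (An m (iter j f z) *m b) <= expR (ka + s * m%:R + eps * (minn j (n - j))%:R) * vnorm b.
  move=> GS eta0 he hU win hka j m b jmn Ub.
  have jn : (j <= n)%N by exact: leq_trans (leq_addr m j) jmn.
  apply: (le_trans (slow_segment be_ge0 A_bound (ltW eta0) (fun x Gx => GS x Gx) hU _ win m jn Ub)).
    by move=> j' V sV v; exact: slow_frame_kernel (hU j') sV.
  rewrite ler_wpM2r ?vnorm_ge0 // ler_expR.
  have := ler_wpM2r (ler0n R (minn j (n - j))) he; lra.
have mS q : measurable (S q) by exact: measurable_slow_frame.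
have monoS q q' : (q <= q')%N -> S q `<=` S q'.
  by move=> qq' x [V sV]; exists V; apply: slow_frame_mono sV; rewrite ler_expR ler_nat.
have aeS : {ae mu, forall x, exists q, S q x}.
  have reg := ae_regular f_cont f_inv ae_basis.
  near=> x; have rx : regular f A gamma x by near: x.
  have [V [K sV _]] := is_frame_exists gap rx.
  by have [q Kq] := expR_nat_ge K; exists q, V; exact: slow_frame_mono sV.
pose eta1 := eps / (2 * D).
have eta1_gt0 : 0 < eta1 by rewrite divr_gt0 // mulr_gt0.
have he1 : (be + `|s|) * (2 * eta1) <= eps.
  apply: (@le_trans _ _ (D * (2 * eta1))); first by apply: ler_wpM2r; [rewrite mulr_ge0 // ltW | rewrite /D lerDl].
  by rewrite /eta1 [X in X <= _](_ : _ = eps) //; field; rewrite gt_eqF.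
case: k @S gap fin step slow mS monoS aeS => [|k0] S gap fin step slow mS monoS aeS.
  exists S, eta1; split => // q; split; first by [].
  exists (q%:R + eps); first by rewrite addr_ge0 // ltW.
  move=> z n U hU _ win; split.
  - by move=> j; case: (hU j).
  - by move=> j _; exact: step.
  - exact: (slow (S q) q eta1).
  - by move=> j m w _; rewrite (flatmx0 w) vnorm0 mulr0 vnorm_ge0.
have [kd _ _ gt] := gap; have [_ fk] := fin.
pose si := c k0 - t.
have si0 : 0 < si by have := gt (Ordinal kd) (ltnSn k0); rewrite fk // lte_fin subr_gt0.
have si4 : 0 < si / 4 by rewrite divr_gt0.
have [ep0 ep0_gt0 H] := good_frame_det dist f A_bound gap fin si4.
pose ep := Num.min ep0 (si / 4).
have ep_gt0 : 0 < ep by rewrite lt_min ep0_gt0.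
have ep_le : ep <= ep0 by rewrite ge_min lexx.
have ep_si : ep <= si / 4 by rewrite ge_min lexx orbT.
pose P1 := psum c k0.+1 - si / 4; pose P0 := psum c k0 + ep.
pose C := (2 * k0.+1%:R) * be + `|P0| + `|P1|.
have C0 : 0 <= C by rewrite /C !addr_ge0 // !mulr_ge0.
pose eta := Num.min (Num.min eta1 (1 / 2)) (Num.min (si / 2) eps / (6 * (C + 1))).
have C1 : 0 < 6 * (C + 1) by rewrite mulr_gt0 // ltr_wpDl.
have eta0 : 0 < eta by rewrite /eta !lt_min eta1_gt0 !divr_gt0 // ?lt_min ?eps0 ?divr_gt0.
have eta_1 : eta <= eta1 by rewrite /eta !ge_min lexx.
have etaC : 6 * eta * C <= Num.min (si / 2) eps.
  have h : eta <= Num.min (si / 2) eps / (6 * (C + 1)) by rewrite /eta !ge_min lexx !orbT.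
  by rewrite ler_pdivlMr // in h; lra.
have e_si : 6 * eta * C <= si / 2 by apply: (le_trans etaC); rewrite ge_min lexx.
have e_eps : 6 * eta * C <= eps by apply: (le_trans etaC); rewrite ge_min lexx orbT.
have he : (be + `|s|) * (2 * eta) <= eps.
  by apply: le_trans he1; rewrite ler_wpM2l ?addr_ge0 // ler_wpM2l.
have low := Nvol_lower_all dist_metric mu1 f_cont f_inv f_erg A_cont be_ge0 A_bound gamma_mono ae_basis fin.
exists (fun q => good f A c k0 s ep q), eta; split => //.
- by move=> q; apply: (measurable_good _ _ _ _ _ gap).
- by move=> q q' qq'; exact: good_mono.
- exact: (ae_good f_cont f_inv gamma_mono ae_basis gap fin ep_gt0 low).
move=> q; split; first by move=> x [].
have [ka' hka'] := H ep ep_gt0 ep_le q.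
exists (`|ka'| + q%:R + eps); first by rewrite !addr_ge0 // ltW.
move=> z n U hU rz win; split.
- by move=> j; case: (hU j).
- by move=> j _; exact: step.
- apply: (slow (good f A c k0 s ep q) q eta) => //; first by move=> x [].
  by rewrite -addrA lerDr.
- move=> j m w jmn.
  pose Gq : set MT := good f A c k0 s ep q.
  have NG x : Gq x -> forall l, Nvol k0 (An l x) <= expR (q%:R + P0 * l%:R).
    by move=> [_ _ h _] l; exact: h.
  have detG a l : Gq (iter a f z) -> Gq (iter (a + l) f z) ->
      expR (- ka' + P1 * l%:R) <= frame_det f A l (iter a f z) (U a) (U (a + l)%N).
    rewrite addnC iterD => ga gal; apply: hka' => //; first exact: regular_iter.
    by rewrite -iterD; exact: hU.
  have hfs := fast_segment (G := Gq) (P0 := P0) (P1 := P1) (ka := ka') (q := q) be_ge0 A_bound kd (ltW eta0) NG hU detG win w jmn.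
  apply: le_trans hfs.
  rewrite ler_wpM2r ?vnorm_ge0 // ler_expR -/C.
  have psumE : psum c k0.+1 = psum c k0 + c k0 by rewrite /psum big_ord_recr.
  have h1 := ler_wpM2r (ler0n R (minn (j + m) (n - (j + m)))) e_eps.
  have h2 : t * m%:R <= (P1 - P0 - 6 * eta * C) * m%:R.
    by rewrite ler_wpM2r // /P1 /P0 psumE; rewrite /si in e_si ep_si *; lra.
  have := ler_norm ka'; lra.
Unshelve. all: by end_near.
Qed.


Lemma frame_close k s (q : nat) xi x0 (U0 : 'M[R]_(k, d)) : is_frame f A s x0 U0 -> 0 < xi ->
  exists2 rho, 0 < rho & forall y (V : 'M[R]_(k, d)), dist x0 y < rho -> slow_frame f A s (expR q%:R) y V ->
    forall v, vnorm (U0^T *m (U0 *m v) - V^T *m (V *m v)) <= xi * vnorm v.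
Proof.
move=> hU xi0; apply: contrapT => hx.
have hy m : exists yV : M * 'M[R]_(k, d), [/\ dist x0 yV.1 < m.+1%:R^-1,
    slow_frame f A s (expR q%:R) yV.1 yV.2 &
    exists v, xi * vnorm v < vnorm (U0^T *m (U0 *m v) - yV.2^T *m (yV.2 *m v))].
  apply: contrapT => h; apply: hx; exists m.+1%:R^-1 => // y V xy sV v.
  by rewrite leNgt; apply/negP => hv; apply: h; exists (y, V); split => //; exists v.
have /choice[yV hyV] := hy.
have [G [GU sG]] := ultraFilterLemma eventually_filter.
have GP := ultra_proper (UltraFilter := GU).
have [|m|L VL sL] := @slow_frame_limit R M dist dist_metric f d A f_cont A_cont s (expR q%:R) x0 k nat G
    (fun m => (yV m).1) (fun m => (yV m).2) GU.
- move=> S [e e0 hS]; apply: sG; exists (Num.bound e^-1) => // m /= em; apply: hS.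
  have [h _ _] := hyV m; apply: (lt_trans h).
  rewrite invf_plt ?posrE //; apply: (lt_le_trans (archi_boundP _)); first by rewrite invr_ge0 ltW.
  by rewrite ler_nat (leq_trans em).
- by case: (hyV m).
have eL := slow_frame_proj hU sL.
have cv : mxcvg G (fun m => U0^T *m U0 - (yV m).2^T *m (yV m).2) (U0^T *m U0 - L^T *m L).
  by apply: mxcvgB; [exact: mxcvg_cst | apply: mxcvg_mul => //; exact: mxcvg_tr].
have cn : mxn (U0^T *m U0 - (yV m).2^T *m (yV m).2) @[m --> G] --> mxn (U0^T *m U0 - L^T *m L).
  by apply: cvg_bigsum => i; apply: cvg_bigsum => j; apply: cvg_norm; exact: cv.
rewrite eL subrr {2}/mxn big1 in cn; last by move=> i _; rewrite big1 // => j _; rewrite mxE normr0.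
have : \forall m \near G, mxn (U0^T *m U0 - (yV m).2^T *m (yV m).2) < xi by exact: (cvgr_lt _ cn).
move=> /filter_ex[m hm]; have [_ _ [v]] := hyV m; apply/negP; rewrite -leNgt !mulmxA -mulmxBl.
by apply: (le_trans (vnorm_mxn _ _)); rewrite ler_wpM2r ?vnorm_ge0 // ltW.
Qed.

Lemma exponent_le_be i : (gamma i <= be%:E)%E.
Proof.
rewrite leNgt; apply/negP => bg.
have [S [mS S0 hS]] := ae_basis.
have [x Sx] : exists x, ~ S x.
  apply: contrapT => h; have : mu S = 1%E.
    by rewrite -mu1; congr (mu _); apply/seteqP; split => // x _; apply: contrapT => nS; apply: h; exists x.
  by rewrite (S0 : mu S = 0%E) => /eqP; rewrite eqe eq_sym oner_eq0.
have [P [_ _ hP]] : exists P, lyap_basis f A x gamma P by apply: contrapT => h; exact/Sx/hS.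
have g : grows_le f A be x (P *m delta_mx i 0).
  by exists (vnorm (P *m delta_mx i 0)) => n; rewrite mulrC; exact: cocycle_bound.
by have /eqP := hP _ _ g i bg; rewrite mxE !eqxx oner_eq0.
Qed.

Lemma avoid_points (l : seq (\bar R)) (a b : R) : a < b -> exists s t,
  [/\ a < s, s < t, t < b & forall x, x \in l -> (x < s%:E)%E \/ (t%:E < x)%E].
Proof.
move=> ab; elim: l => [|y l [s [t [as' st tb h]]]].
  by exists ((2 * a + b) / 3), ((a + 2 * b) / 3); split => //; lra.
pose de := (t - s) / 5.
have [ym|my] := leP y ((s + t) / 2)%:E.
  exists ((s + t) / 2 + de), ((s + t) / 2 + 2 * de); rewrite /de; split; [lra|lra|lra|].
  move=> x; rewrite inE => /orP[/eqP ->|/h[xs|tx]].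
  - by left; apply: le_lt_trans ym _; rewrite lte_fin; lra.
  - by left; apply: (lt_trans xs); rewrite lte_fin; lra.
  - by right; apply: le_lt_trans tx; rewrite lee_fin; lra.
exists ((s + t) / 2 - 2 * de), ((s + t) / 2 - de); rewrite /de; split; [lra|lra|lra|].
move=> x; rewrite inE => /orP[/eqP ->|/h[xs|tx]].
- by right; apply: lt_trans my; rewrite lte_fin; lra.
- by left; apply: (lt_le_trans xs); rewrite lee_fin; lra.
- by right; apply: lt_trans tx; rewrite lte_fin; lra.
Qed.

Lemma interval_gap (a b : R) : a < b -> exists k s t, exists2 c,
  [/\ a < s, s < t & t < b] & exponent_gap gamma k s t /\ finite_upto gamma c k.
Proof.
move=> ab; have [s [t [as' st tb h]]] := avoid_points [seq gamma i | i <- enum 'I_d] ab.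
have h' i : (gamma i < s%:E)%E \/ (t%:E < gamma i)%E by apply: h; rewrite map_f // mem_enum.
pose p k := `[< (k <= d)%N /\ forall i : 'I_d, (k <= i)%N -> (gamma i < s%:E)%E >].
have pd : p d by apply/asboolP; split => // i; rewrite leqNgt ltn_ord.
have [k /asboolP[kd gs] kmin] := ex_minnP (ex_intro p d pd).
have gt (i : 'I_d) : (i < k)%N -> (t%:E < gamma i)%E.
  move=> ik; have [gi|//] := h' i.
  have : (k <= i)%N.
    apply: kmin; apply/asboolP; split; first exact: ltnW.
    by move=> j ij; apply: le_lt_trans gi; exact: gamma_mono.
  by rewrite leqNgt ik.
exists k, s, t, (fun n => if insub n is Some i then fine (gamma i) else 0); first by split.
split; first by split.
split => // i ik; rewrite valK fineK // fin_numElt.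
by rewrite (lt_trans _ (gt i ik)) ?ltNyr // (le_lt_trans (exponent_le_be i)) // ltry.
Qed.

Definition respects (gk : 'I_d -> \bar R) (ab : R * R) := forall i,
  ((gamma i <= ab.1%:E)%E -> (gk i <= ab.2%:E)%E) /\ ((ab.2%:E <= gamma i)%E -> (ab.1%:E <= gk i)%E).

Definition controls om (G : nat -> set MT) eta (l : seq (R * R)) := forall q x0, regular f A gamma x0 ->
  exists rh rho N, [/\ 0 < rh, 0 < rho & forall n p gk P, (N < n)%N -> iter n f p = p ->
    dist x0 (iter n f x0) < rho -> G q (iter n f x0) -> windows f (G q) eta x0 n ->
    (forall j v, (j < n)%N -> vnorm ((A (iter j f p) - A (iter j f x0)) *m v)
       <= rh * expR (- om * (minn j (n - j))%:R) * vnorm v) ->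
    lyap_basis f A p gk P -> (forall i j : 'I_d, (i <= j)%N -> (gk j <= gk i)%E) ->
    forall ab, ab \in l -> respects gk ab].

Lemma interval_controls om a b : 0 < om -> a < b -> exists (G : nat -> set MT) eta,
  [/\ 0 < eta, forall q, measurable (G q), forall q q', (q <= q')%N -> G q `<=` G q',
    {ae mu, forall x, exists q, G q x} & controls om G eta [:: (a, b)]].
Proof.
move=> om0 ab; have [k [s [t [c [as' st tb] [gap fin]]]]] := interval_gap ab.
pose de := (t - s) / 8; have de0 : 0 < de by rewrite divr_gt0 // subr_gt0.
pose eps := Num.min de (om / 2).
have eps0 : 0 < eps by rewrite lt_min de0 divr_gt0.
have eps_de : eps <= de by rewrite ge_min lexx.
have eps_om : 2 * eps <= om by have : eps <= om / 2; [rewrite ge_min lexx orbT | lra].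
have [G [eta [eta0 mG monoG aeG HG]]] := gap_segment gap fin eps0.
exists G, eta; split => // q x0 rx0.
have [slowG [ka ka0 split_seg]] := HG q.
have [|||rh [xi [N [rh0 xi0 H]]]] := @shadowing_cone R be ka s t eps om de (s + 4 * de) (t - 3 * de) ka0
  (ltW eps0) de0 eps_de eps_om; rewrite ?/de; [lra|lra|lra|].
have /choice[U hU] : forall j, exists V : 'M[R]_(k, d), is_frame f A s (iter j f x0) V.
  by move=> j; have [V [K _ hV]] := is_frame_exists gap (regular_iter j rx0); exists V.
have [rho rho0 close] := frame_close q (hU 0%N) xi0.
exists rh, rho, N; split => // n p gk P Nn per dn Gn win cl hP gk_mono _ /[1!inE] /eqP -> i.
have [V sV] := slowG _ Gn.
have wrap v : vnorm ((U 0)^T *m (U 0 *m v) - (U n)^T *m (U n *m v)) <= xi * vnorm v.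
  by rewrite (mulmxA (U n)^T) -(slow_frame_proj (hU n) sV) -mulmxA; exact: close dn sV v.
have [fast slow] := H M f d A k n x0 U p A_bound (split_seg x0 n U hU rx0 win) Nn per wrap cl.
have n0 : (0 < n)%N by exact: leq_ltn_trans Nn.
have UU : U 0 *m (U 0)^T = 1%:M by case: (hU 0).
have [_ _ gs gt] := gap.
split=> /= h.
  have ki : (k <= i)%N.
    rewrite leqNgt; apply/negP => /gt ti; have := lt_le_trans ti h.
    by rewrite lte_fin; lra.
  apply: (le_trans (periodic_exponent_le A_bound n0 hP gk_mono slow ki)).
  by rewrite lee_fin /de; lra.
have ik : (i < k)%N.
  rewrite ltnNge; apply/negP => /gs si; have := le_lt_trans h si.
  by rewrite lte_fin; lra.
apply: le_trans (periodic_exponent_ge n0 hP gk_mono UU fast ik).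
by rewrite lee_fin /de; lra.
Qed.

Lemma list_controls om (l : seq (R * R)) : 0 < om -> (forall ab, ab \in l -> ab.1 < ab.2) ->
  exists (G : nat -> set MT) eta, [/\ 0 < eta <= 1 / 2, forall q, measurable (G q),
    forall q q', (q <= q')%N -> G q `<=` G q',
    {ae mu, forall x, exists q, G q x} & controls om G eta l].
Proof.
move=> om0; elim: l => [_|[a b] l IH lt_ab].
  exists (fun=> setT), (1 / 2); split => //; first by rewrite lexx divr_gt0.
    by apply: nearW => x; exists 0%N.
  by move=> q x0 _; exists 1, 1, 0%N.
have [|G [eta [/andP[eta0 eta2] mG monoG aeG cG]]] := IH.
  by move=> ab abl; apply: lt_ab; rewrite inE abl orbT.
have [G' [eta' [eta'0 mG' monoG' aeG' cG']]] := interval_controls om0 (lt_ab (a, b) (mem_head _ _)).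
exists (fun q => G q `&` G' q), (Num.min eta eta'); split => //.
- by rewrite lt_min eta0 eta'0 ge_min eta2.
- by move=> q; apply: measurableI; [exact: mG | exact: mG'].
- by move=> q q' qq' x [h h']; split; [exact: monoG h | exact: monoG' h'].
- near=> x; have [q hq] : exists q, G q x by near: x.
  have [q' hq'] : exists q, G' q x by near: x.
  by exists (maxn q q'); split; [apply: monoG hq; rewrite leq_maxl | apply: monoG' hq'; rewrite leq_maxr].
move=> q x0 rx0.
have [rh [rho [N [rh0 rho0 H]]]] := cG q x0 rx0.
have [rh' [rho' [N' [rh'0 rho'0 H']]]] := cG' q x0 rx0.
exists (Num.min rh rh'), (Num.min rho rho'), (maxn N N'); split; rewrite ?lt_min ?rh0 ?rho0 //.
move=> n p gk P; rewrite gtn_max => /andP[Nn N'n] per; rewrite lt_min => /andP[d1 d2] [Gn G'n] win cl hP gm.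
have eta_ge0 : 0 <= Num.min eta eta' by rewrite le_min !ltW.
have R1 := H n p gk P Nn per d1 Gn; have R2 := H' n p gk P N'n per d2 G'n.
have cl1 r : Num.min rh rh' <= r -> forall j v, (j < n)%N ->
    vnorm ((A (iter j f p) - A (iter j f x0)) *m v) <= r * expR (- om * (minn j (n - j))%:R) * vnorm v.
  move=> hr j v jn; apply: (le_trans (cl j v jn)).
  by rewrite ler_wpM2r ?vnorm_ge0 // ler_wpM2r ?expR_ge0.
move=> ab; rewrite inE => /orP[/eqP ->|abl].
  apply: R2 => //; first by apply: (windowsS _ eta_ge0 _ win); [by move=> x [] | by rewrite ge_min lexx orbT].
    by apply: cl1; rewrite ge_min lexx orbT.
  by rewrite inE.
apply: R1 => //; first by apply: (windowsS _ eta_ge0 _ win); [by move=> x [] | by rewrite ge_min lexx].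
by apply: cl1; rewrite ge_min lexx.
Unshelve. all: by end_near.
Qed.

End Cuts.

(** * Recurrent points *)

Section Return.
Variables (R : realType) (M : pointedType) (dist : M -> M -> R) (f g : M -> M).
Variables (mu : {measure set (g_sigma_algebraType (mopen dist)) -> \bar R}).
Hypothesis dist_metric : is_metric dist.
Hypothesis dist_compact : mcompact dist.
Hypothesis mu1 : mu setT = 1%E.
Hypothesis f_cont : mcontinuous dist f.
Hypothesis g_cont : mcontinuous dist g.
Hypothesis fK : cancel f g.
Hypothesis f_inv : invariant_measure f mu.
Local Notation MT := (g_sigma_algebraType (mopen dist)).

Let mf (S : set MT) : measurable S -> measurable (f @^-1` S : set MT).
Proof. exact: measurable_preimage_mcont. Qed.

Let mg (S : set MT) : measurable S -> measurable (g @^-1` S : set MT).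
Proof. exact: measurable_preimage_mcont. Qed.

Lemma inverse_invariant : invariant_measure g mu.
Proof.
move=> S mS; rewrite -(f_inv (mg mS)); congr (mu _).
by apply/seteqP; split => x /=; rewrite fK.
Qed.

Lemma measurable_sparse (h : M -> M) (B : set MT) eta : measurable B ->
  (forall S : set MT, measurable S -> measurable (h @^-1` S : set MT)) ->
  measurable ([set x | sparse h B eta x] : set MT).
Proof.
move=> mB mh.
have -> : [set x | sparse h B eta x] =
    \bigcap_(n in [set n | (0 < n)%N]) ~` [set x | eta * n%:R <= (@visits _ MT h B n x)%:R].
  apply/seteqP; split => x /= hx n n0; first by apply/negP; rewrite -ltNge; exact: hx.
  by rewrite ltNge; apply/negP; exact: hx.
by apply: bigcap_measurableType => n _; apply: measurableC; exact: (measurable_visits mh).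
Qed.

Lemma sparseS (h : M -> M) (B B' : set MT) eta x : B `<=` B' -> sparse h B' eta x -> sparse h B eta x.
Proof.
move=> BB hB n n0; apply: le_lt_trans (hB n n0); rewrite ler_nat; apply: leq_sum => i _.
by have [/set_mem/BB/mem_set ->|//] := boolP (iter i h x \in B).
Qed.

Lemma countable_balls (m : nat) : exists c : nat -> M, forall x, exists j, dist (c j) x < m.+1%:R^-1.
Proof.
have [dd dd0 ds dt] := dist_metric.
have [|x|n [h hh]] := dist_compact (U := fun c : M => [set x | dist c x < m.+1%:R^-1]).
- move=> c x /= cx; exists (m.+1%:R^-1 - dist c x); first by rewrite subr_gt0.
  by move=> y xy; apply: le_lt_trans (dt c x y) _; rewrite -ltrBrDl.
- by exists x => /=; have -> : dist x x = 0 by apply/dd0.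
exists (fun j => if insub j is Some i then h i else point) => x.
by have [j hj] := hh x; exists j; rewrite valK.
Qed.

Lemma return_point (G : nat -> set MT) eta (P : M -> Prop) : 0 < eta -> eta <= 1 / 2 ->
  (forall q, measurable (G q)) -> (forall q q', (q <= q')%N -> G q `<=` G q') ->
  {ae mu, forall x : MT, exists q, G q x} -> {ae mu, forall x : MT, P x} ->
  exists q x, P x /\ forall rho N, 0 < rho -> exists2 n, (N <= n)%N &
    [/\ dist x (iter n f x) < rho, G q (iter n f x) & windows f (G q) eta x n].
Proof.
move=> eta0 eta2 mG monoG aeG aeP; have [dd dd0 ds dt] := dist_metric.
have aeB : {ae mu, forall x : MT, exists q, ~ (~` G q) x}.
  by apply: filterS aeG => x [q Gq]; exists q => /(_ Gq).
have mB q : measurable (~` G q) by exact: measurableC.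
have BS q : ~` G q.+1 `<=` ~` G q by apply: subsetC; exact: monoG.
have rf := ae_rarely mu1 mf f_inv eta0 mB BS aeB.
have rg := ae_rarely mu1 mg inverse_invariant eta0 mB BS aeB.
pose S q : set MT := [set x | sparse f (~` G q) eta x] `&` [set x | sparse g (~` G q) eta x].
have mS q : measurable (S q) by apply: measurableI; apply: measurable_sparse.
have /choice[c hc] := countable_balls.
pose W q m j : set MT := S q `&` [set x | dist (c m j) x < m.+1%:R^-1].
have mW q m j : measurable (W q m j).
  apply: measurableI => //; apply: sub_sigma_algebra => x /= cx.
  exists (m.+1%:R^-1 - dist (c m j) x); first by rewrite subr_gt0.
  by move=> y xy; apply: le_lt_trans (dt (c m j) x y) _; rewrite -ltrBrDl.
have rec : {ae mu, forall x : MT, forall q m j, W q m j x -> forall N, exists2 n, (N <= n)%N & W q m j (iter n f x)}.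
  apply/ae_foralln => q; apply/ae_foralln => m; apply/ae_foralln => j.
  exact: (poincare_recurrence mu1 mf f_inv (mW q m j)).
have [x [Px [q Sq] rx]] : exists x, [/\ P x, exists q, S q x &
    forall q m j, W q m j x -> forall N, exists2 n, (N <= n)%N & W q m j (iter n f x)].
  have ae_all : {ae mu, forall x : MT, [/\ P x, exists q, S q x &
    forall q m j, W q m j x -> forall N, exists2 n, (N <= n)%N & W q m j (iter n f x)]}.
    near=> x; split.
    - by near: x.
    - have [q1 h1] : exists q, sparse f (~` G q) eta x by near: x; exact: rf.
      have [q2 h2] : exists q, sparse g (~` G q) eta x by near: x; exact: rg.
      exists (maxn q1 q2); split.
        by apply: sparseS h1; apply: subsetC; apply: monoG; rewrite leq_maxl.
      by apply: sparseS h2; apply: subsetC; apply: monoG; rewrite leq_maxr.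
    - by near: x; exact: rec.
  have [T [mT T0 hT]] := ae_all; apply: contrapT => h; have : mu T = 1%E.
    rewrite -mu1; congr (mu _); apply/seteqP; split => // x _.
    by apply: contrapT => nT; apply: h; exists x; apply: contrapT => /hT.
  by rewrite (T0 : mu T = 0%E) => /eqP; rewrite eqe eq_sym oner_eq0.
exists q, x; split => // rho N rho0.
pose m := Num.bound (2 / rho).
have [j hj] := hc m x.
have [n Nn [[sf sg] cn]] := rx q m j (conj Sq hj) N.
exists n => //; split.
- apply: le_lt_trans (dt x (c m j) _) _; rewrite (ds x).
  have h2 : m.+1%:R^-1 + m.+1%:R^-1 < rho.
    have hb : 2 / rho < m.+1%:R.
      by apply: lt_trans (archi_boundP _) _; rewrite ?divr_ge0 ?(ltW rho0) // ltr_nat.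
    have m0 : 0 < m.+1%:R :> R by [].
    by rewrite ltr_pdivrMr // mulrC -ltr_pdivrMr // in hb; rewrite -[X in X + _]mul1r -[X in _ + X]mul1r -mulrDl.
  by apply: lt_trans h2; exact: ltrD.
- have := sf 1%N isT; rewrite /visits big_nat1 mulr1 /= => h; apply: contrapT => nG.
  by move: h; rewrite mem_set //=; lra.
- exact: two_sided_windows fK eta0 eta2 Sq.1 sg.
Unshelve. all: by end_near.
Qed.

End Return.

(** * Spectrum of a periodic orbit *)

Section ModulusFactors.
Variable R : realType.
Local Notation C := (complex.complex R).
Local Notation toC := (complex.real_complex_def (Phant R)).

Definition quadratic (b rho : R) : {poly R} := 'X^2 - (2 * b) *: 'X + (rho ^+ 2)%:P.

(* Irreducible monic real polynomials, with the common modulus of their complex roots. *)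
Definition modulus_factor (rho : R) (q : {poly R}) : Prop :=
  (exists2 a, rho = `|a| & q = 'X - a%:P) \/
  [/\ 0 <= rho & exists2 b, b ^+ 2 < rho ^+ 2 & q = quadratic b rho].

Lemma quadratic_monic b rho : quadratic b rho \is monic.
Proof.
rewrite monicE /quadratic -addrA lead_coefDl ?lead_coefXn // size_polyXn ltnS.
apply: (leq_trans (size_polyD _ _)); rewrite geq_max size_polyN size_polyC.
rewrite (leq_trans (size_scale_leq _ _)) ?size_polyX //.
by case: (_ != 0).
Qed.

Lemma horner_quadratic (b rho x y : R) :
  (map_poly toC (quadratic b rho)).[complex.Complex x y]
    = complex.Complex (x ^+ 2 - y ^+ 2 - 2 * b * x + rho ^+ 2) (2 * x * y - 2 * b * y).
Proof.
rewrite /quadratic rmorphD rmorphB /= map_polyZ map_polyXn map_polyX map_polyC /= !hornerE /=.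
apply/eqP; rewrite complex.eq_complex /=; apply/andP; split; apply/eqP; ring.
Qed.

Lemma modulus_factor_root rho q (z : C) : modulus_factor rho q -> root (map_poly toC q) z ->
  rho ^+ 2 = complex.Re z ^+ 2 + complex.Im z ^+ 2.
Proof.
case: z => x y [[a -> ->]|[rho0 [b br ->]]].
  rewrite rmorphB /= map_polyX map_polyC /= root_XsubC => /eqP[-> ->] /=.
  by rewrite real_normK ?num_real // expr0n addr0.
rewrite rootE horner_quadratic complex.eq_complex /= => /andP[/eqP h1 /eqP h2].
have : (x - b) * y = 0 by lra.
move/eqP; rewrite mulf_eq0 subr_eq0 => /orP[/eqP xb|/eqP y0].
  by rewrite xb in h1 *; lra.
by exfalso; rewrite y0 in h1; have := sqr_ge0 (x - b); lra.
Qed.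

Lemma modulus_factor_ge0 rho q : modulus_factor rho q -> 0 <= rho.
Proof. by case=> [[a -> _]|[]]. Qed.

Lemma modulus_factor_monic rho q : modulus_factor rho q -> q \is monic.
Proof. by case=> [[a _ ->]|[_ [b _ ->]]]; [exact: monicXsubC | exact: quadratic_monic]. Qed.

Lemma modulus_factor_coprime rho rho' q q' : modulus_factor rho q -> modulus_factor rho' q' ->
  rho != rho' -> coprimep q q'.
Proof.
move=> hq hq' /eqP ne; rewrite -(coprimep_map (complex.real_complex_def (Phant R))).
rewrite /coprimep; apply/closed_rootP => -[z]; rewrite root_gcd => /andP[z1 z2]; apply: ne.
apply/eqP; rewrite -(eqrXn2 (n := 2)) ?(modulus_factor_ge0 hq) ?(modulus_factor_ge0 hq') //.
by rewrite (modulus_factor_root hq z1) (modulus_factor_root hq' z2).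
Qed.

Lemma real_poly_factor (p : {poly R}) : p \is monic -> exists L : seq (R * {poly R}),
  p = \prod_(x <- L) x.2 /\ forall x, x \in L -> modulus_factor x.1 x.2.
Proof.
have [n] := ubnP (size p); elim: n p => // n IH p; rewrite ltnS => pn mp.
suff [p1|[rho [q [hq qp]]]] : p = 1 \/ exists rho q, modulus_factor rho q /\ q %| p.
- by exists [::]; rewrite big_nil.
- have mq := modulus_factor_monic hq; have pE := divpK qp.
  have mpq : p %/ q \is monic by rewrite -(monicMr _ mq) pE.
  have sq : (1 < size q)%N.
    case: hq => [[a _ ->]|[_ [b _ ->]]]; first by rewrite size_XsubC.
    rewrite /quadratic -addrA size_polyDl size_polyXn // ltnS.
    apply: (leq_trans (size_polyD _ _)); rewrite geq_max size_polyN size_polyC.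
    rewrite (leq_trans (size_scale_leq _ _)) ?size_polyX //.
    by case: (_ != 0).
  have [|L [LE hL]] := IH (p %/ q) _ mpq.
    rewrite size_divp ?monic_neq0 //; apply: leq_trans pn.
    have : (0 < size p)%N by rewrite lt0n size_poly_eq0 monic_neq0.
    by move: (size p) (size q) sq; lia.
  exists ((rho, q) :: L); split; first by rewrite big_cons /= mulrC -LE pE.
  by move=> x; rewrite inE => /orP[/eqP ->|/hL].
have [/eqP sp|sp] := boolP (size (map_poly toC p) == 1%N).
  left; rewrite size_map_poly in sp.
  have /size_poly1P[a _ pa] : size p == 1%N by rewrite sp.
  by move: mp; rewrite pa monicE lead_coefC => /eqP ->.
right; have /closed_rootP[[x y] pz] := sp.
have [y0|y0] := eqVneq y 0.
  exists `|x|, ('X - x%:P); split; first by left; exists x.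
  rewrite dvdp_XsubCl; move: pz; rewrite y0.
  by rewrite -[complex.Complex x 0]/(toC x) fmorph_root.
pose rho := Num.sqrt (x ^+ 2 + y ^+ 2).
have rho2 : rho ^+ 2 = x ^+ 2 + y ^+ 2 by rewrite sqr_sqrtr // addr_ge0 // sqr_ge0.
exists rho, (quadratic x rho); split.
  right; split; first exact: sqrtr_ge0.
  by exists x => //; rewrite rho2 ltrDl lt_neqAle sqr_ge0 andbT eq_sym sqrf_eq0.
pose r := p %% quadratic x rho.
have sr : (size r <= 2)%N.
  have : (size r < size (quadratic x rho))%N by rewrite ltn_modp monic_neq0 // quadratic_monic.
  rewrite /quadratic -addrA size_polyDl size_polyXn // ltnS.
  apply: (leq_trans (size_polyD _ _)); rewrite geq_max size_polyN size_polyC.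
  rewrite (leq_trans (size_scale_leq _ _)) ?size_polyX //.
  by case: (_ != 0).
rewrite /dvdp -/r.
have rz : (map_poly toC r).[complex.Complex x y] = 0.
  move: pz; rewrite rootE {1}(divp_eq p (quadratic x rho)) rmorphD rmorphM /= hornerD hornerM.
  rewrite horner_quadratic rho2.
  have -> : complex.Complex (x ^+ 2 - y ^+ 2 - 2 * x * x + (x ^+ 2 + y ^+ 2)) (2 * x * y - 2 * x * y) = 0.
    by apply/eqP; rewrite complex.eq_complex /=; apply/andP; split; apply/eqP; ring.
  by rewrite mulr0 add0r => /eqP.
have rE : r = r`_1 *: 'X + (r`_0)%:P.
  apply/polyP => -[|[|i]]; rewrite !coefE ?mulr0 ?mulr1 ?add0r ?addr0 //=.
  by rewrite nth_default // (leq_trans sr).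
move: rz; rewrite rE rmorphD /= map_polyZ map_polyX map_polyC /= !hornerE => /eqP.
rewrite complex.eq_complex /= => /andP[/eqP h1 /eqP h2].
have r1 : r`_1 = 0.
  have : r`_1 * y = 0 by move: h2; lra.
  by move/eqP; rewrite mulf_eq0 (negbTE y0) orbF => /eqP.
have r0 : r`_0 = 0 by move: h1; rewrite r1; lra.
by rewrite r1 r0 scale0r add0r polyC0.
Qed.

End ModulusFactors.

Section KernelGrowth.
Variables (R : realType) (d : nat) (B : 'M[R]_d.+1).

Lemma linear_recurrence_bound (rho r K : R) (N : nat -> R) : 0 <= rho -> rho < r -> 0 <= K ->
  (forall m, 0 <= N m) -> (forall m, N m.+1 <= rho * N m + K * r ^+ m) ->
  forall m, N m <= (N 0%N + K / (r - rho)) * r ^+ m.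
Proof.
move=> rho0 rr K0 N0 step; have r0 : 0 <= r by exact: le_trans (ltW rr).
have p0 : 0 < r - rho by rewrite subr_gt0.
have KE : K / (r - rho) * (r - rho) = K by rewrite divfK // gt_eqF.
have K1 : 0 <= K / (r - rho) by rewrite divr_ge0 // ltW.
elim=> [|m IH]; first by rewrite expr0 mulr1 lerDl.
apply: (le_trans (step m)); apply: (le_trans (lerD (ler_wpM2l rho0 IH) (lexx _))).
rewrite exprS mulrA mulrA -mulrDl; apply: ler_wpM2r; first exact: exprn_ge0.
by have := mulr_ge0 (N0 0%N) (ltW p0); lra.
Qed.

Lemma horner_mx_quadratic b rho (v : 'cV[R]_d.+1) :
  horner_mx B (quadratic b rho) *m v = B *m (B *m v) - (2 * b) *: (B *m v) + (rho ^+ 2) *: v.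
Proof.
rewrite /quadratic rmorphD rmorphB /= linearZ /= horner_mx_X horner_mx_C rmorphXn /= horner_mx_X.
by rewrite expr2 mulmxDl mulmxBl -scalemxAl mul_scalar_mx -mulmxA.
Qed.

Lemma vnorm_sum n (v : 'cV[R]_n) : vnorm v ^+ 2 = \sum_i v i 0 ^+ 2.
Proof. by rewrite sqr_sqrtr // sumr_ge0 // => i _; exact: sqr_ge0. Qed.

Lemma vnorm_col_mx (p s : 'cV[R]_d.+1) : vnorm (col_mx p s) ^+ 2 = vnorm p ^+ 2 + vnorm s ^+ 2.
Proof.
by rewrite !vnorm_sum big_split_ord /=; congr (_ + _); apply: eq_bigr => i _; rewrite ?col_mxEu ?col_mxEd.
Qed.

Lemma vnorm_rotation b c (p s : 'cV[R]_d.+1) rho : 0 <= rho -> rho ^+ 2 = b ^+ 2 + c ^+ 2 ->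
  vnorm (col_mx (b *: p - c *: s) (c *: p + b *: s)) = rho * vnorm (col_mx p s).
Proof.
move=> rho0 h; apply/eqP; rewrite -(eqrXn2 (n := 2)) ?mulr_ge0 ?vnorm_ge0 // exprMn !vnorm_col_mx h.
rewrite !vnorm_sum -!big_split /= mulr_sumr; apply/eqP/eq_bigr => i _.
by rewrite !mxE; ring.
Qed.

(* The adapted norm: [vnorm] for a real root, and for a pair [b +- ic] the norm in which [B] acts as
   [rho] times a rotation on the kernel of the factor. *)
Lemma factor_norm rho q : modulus_factor rho q -> exists (N : 'cV[R]_d.+1 -> R) C,
  [/\ 0 < C, forall u, 0 <= N u, forall u, vnorm u <= C * N u, forall u, N u <= C * vnorm u &
    (forall u, N (B *m u) <= rho * N u + vnorm (horner_mx B q *m u)) /\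
    (forall u, horner_mx B q *m u = 0 -> N (B *m u) = rho * N u)].
Proof.
case=> [[a -> ->]|[rho0 [b br ->]]].
  have E (u : 'cV_d.+1) : horner_mx B ('X - a%:P) *m u = B *m u - a *: u.
    by rewrite rmorphB /= horner_mx_X horner_mx_C mulmxBl mul_scalar_mx.
  exists (@vnorm R d.+1), 1; split => // [u|u|u|]; rewrite ?mul1r ?vnorm_ge0 //.
  split=> u; rewrite E; last by move/eqP; rewrite subr_eq0 => /eqP ->; rewrite vnormZ.
  rewrite -vnormZ -{1}(subrK (a *: u) (B *m u)) addrC; exact: ler_vnormD.
pose c := Num.sqrt (rho ^+ 2 - b ^+ 2).
have c0 : 0 < c by rewrite sqrtr_gt0 subr_gt0.
have c2 : rho ^+ 2 = b ^+ 2 + c ^+ 2 by rewrite sqr_sqrtr ?subr_ge0 ?(ltW br) // addrC subrK.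
pose P (u : 'cV[R]_d.+1) := col_mx (B *m u - b *: u) (c *: u).
have PB u : P (B *m u) = col_mx (b *: (B *m u - b *: u) - c *: (c *: u))
    (c *: (B *m u - b *: u) + b *: (c *: u)) + col_mx (horner_mx B (quadratic b rho) *m u) 0.
  rewrite add_col_mx horner_mx_quadratic /P c2; congr col_mx; apply/colP => i.
    by rewrite !mxE; ring.
  by rewrite !mxE; ring.
have c_norm u : c * vnorm u <= vnorm (P u).
  rewrite -(ler_pXn2r (n := 2)) ?nnegrE ?mulr_ge0 ?vnorm_ge0 ?(ltW c0) //.
  by rewrite vnorm_col_mx vnormZ (ger0_norm (ltW c0)) lerDr sqr_ge0.
have N_up u : vnorm (P u) <= (mxn B + `|b| + c) * vnorm u.
  have -> : P u = col_mx (B *m u - b *: u) 0 + col_mx 0 (c *: u) by rewrite add_col_mx addr0 add0r.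
  have n1 (p : 'cV[R]_d.+1) : vnorm (col_mx p (0 : 'cV_d.+1)) = vnorm p.
    by apply/eqP; rewrite -(eqrXn2 (n := 2)) ?vnorm_ge0 // vnorm_col_mx vnorm0 expr0n addr0.
  have n2 (p : 'cV[R]_d.+1) : vnorm (col_mx (0 : 'cV_d.+1) p) = vnorm p.
    by apply/eqP; rewrite -(eqrXn2 (n := 2)) ?vnorm_ge0 // vnorm_col_mx vnorm0 expr0n add0r.
  apply: (le_trans (ler_vnormD _ _)); rewrite n1 n2 !mulrDl; apply: lerD; last first.
    by rewrite vnormZ ger0_norm // ltW.
  apply: (le_trans (ler_vnormB _ _)); apply: lerD; first exact: vnorm_mxn.
  by rewrite vnormZ.
exists (fun u => vnorm (P u)), (c^-1 + (mxn B + `|b| + c)).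
have ci : 0 < c^-1 by rewrite invr_gt0.
have m0 : 0 <= mxn B + `|b| + c by rewrite !addr_ge0 ?mxn_ge0 // ltW.
split => // [||u|u|].
- by rewrite ltr_wpDr.
- by move=> u; exact: vnorm_ge0.
- apply: (@le_trans _ _ (c^-1 * vnorm (P u))); first by rewrite ler_pdivlMl.
  by rewrite ler_wpM2r ?vnorm_ge0 // lerDl.
- apply: (le_trans (N_up u)); rewrite ler_wpM2r ?vnorm_ge0 // lerDr ltW //.
have rot u : vnorm (col_mx (b *: (B *m u - b *: u) - c *: (c *: u))
    (c *: (B *m u - b *: u) + b *: (c *: u))) = rho * vnorm (P u) by exact: vnorm_rotation.
split=> u; last by move=> qu; rewrite PB qu col_mx0 addr0 rot.
rewrite PB; apply: (le_trans (ler_vnormD _ _)); rewrite rot lerD2l.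
rewrite -(ler_pXn2r (n := 2)) ?nnegrE ?vnorm_ge0 //.
by rewrite vnorm_col_mx vnorm0 expr0n addr0.
Qed.

Lemma horner_mxM p q (v : 'cV[R]_d.+1) :
  horner_mx B (p * q) *m v = horner_mx B p *m (horner_mx B q *m v).
Proof. by rewrite rmorphM /= mulmxA. Qed.

Lemma horner_mx_pow p m (v : 'cV[R]_d.+1) : horner_mx B p *m (B ^+ m *m v) = B ^+ m *m (horner_mx B p *m v).
Proof.
have -> : B ^+ m = horner_mx B 'X^m by rewrite rmorphXn /= horner_mx_X.
by rewrite -!horner_mxM mulrC.
Qed.

Lemma mulmx_powS m (v : 'cV[R]_d.+1) : B ^+ m.+1 *m v = B *m (B ^+ m *m v).
Proof. by rewrite exprS -mulmxA. Qed.

Lemma kernel_growth_upper rho r (L : seq {poly R}) v : rho < r ->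
  (forall q, q \in L -> modulus_factor rho q) -> horner_mx B (\prod_(q <- L) q) *m v = 0 ->
  exists K, forall m, vnorm (B ^+ m *m v) <= K * r ^+ m.
Proof.
move=> rr; elim: L v => [|q L IH] v hL.
  rewrite big_nil rmorph1 mul1mx => ->; exists 0 => m.
  by rewrite mulmx0 vnorm0 mul0r.
have hq := hL q (mem_head _ _); have rho0 := modulus_factor_ge0 hq.
rewrite big_cons mulrC horner_mxM => /IH[|K hK].
  by move=> q' q'L; apply: hL; rewrite inE q'L orbT.
have [N [C [C0 N0 N1 N2 [N3 _]]]] := factor_norm hq.
have K0 : 0 <= K by have := hK 0%N; rewrite expr0 mulr1; exact: le_trans (vnorm_ge0 _).
have h := @linear_recurrence_bound rho r K (fun m => N (B ^+ m *m v)) rho0 rr K0 (fun m => N0 _).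
exists (C * (N (B ^+ 0 *m v) + K / (r - rho))) => m.
apply: (le_trans (N1 _)); rewrite -mulrA ler_wpM2l ?(ltW C0) //.
apply: h => l; rewrite mulmx_powS; apply: (le_trans (N3 _)).
by rewrite lerD2l horner_mx_pow.
Qed.

Lemma kernel_growth_lower rho (L : seq {poly R}) v : 0 <= rho ->
  (forall q, q \in L -> modulus_factor rho q) -> horner_mx B (\prod_(q <- L) q) *m v = 0 ->
  v != 0 -> exists2 K, 0 < K & forall m, K * rho ^+ m <= vnorm (B ^+ m *m v).
Proof.
move=> rho0; elim: L v => [|q L IH] v hL.
  by rewrite big_nil rmorph1 mul1mx => ->; rewrite eqxx.
have hq := hL q (mem_head _ _).
rewrite big_cons horner_mxM => qv v0; set D := horner_mx B (\prod_(q <- L) q) in qv.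
have [w0|w0] := eqVneq (D *m v) 0.
  by apply: (IH v _ w0 v0) => q' q'L; apply: hL; rewrite inE q'L orbT.
have [N [C [C0 N0 N1 N2 [_ N4]]]] := factor_norm hq.
pose w := D *m v.
have Nw m : N (B ^+ m *m w) = rho ^+ m * N w.
  elim: m => [|m IHm]; first by rewrite expr0 mul1mx mul1r.
  by rewrite mulmx_powS N4 ?IHm ?exprS ?mulrA // horner_mx_pow qv mulmx0.
have wp : 0 < N w.
  by rewrite -(pmulr_rgt0 _ C0); apply: lt_le_trans (N1 w); exact: vnorm_gt0.
have D0 : 0 < mxn D + 1 by rewrite ltr_wpDl ?mxn_ge0.
exists (N w / (C * (mxn D + 1))); first by rewrite divr_gt0 // mulr_gt0.
move=> m; rewrite mulrAC ler_pdivrMr ?mulr_gt0 // mulrC -Nw.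
apply: (le_trans (N2 _)); rewrite mulrCA ler_wpM2l ?(ltW C0) //.
rewrite /w -horner_mx_pow; apply: (le_trans (vnorm_mxn _ _)); rewrite mulrC ler_wpM2l ?vnorm_ge0 //.
by rewrite lerDl.
Qed.

End KernelGrowth.

Section KernelExponent.
Variable R : realType.

Lemma ereal_cvg_order (u : nat -> \bar R) (l : \bar R) : (l < +oo)%E ->
  (forall b : R, (l < b%:E)%E -> exists N, forall n, (N <= n)%N -> (u n < b%:E)%E) ->
  (forall a : R, (a%:E < l)%E -> exists N, forall n, (N <= n)%N -> (a%:E < u n)%E) ->
  u @ \oo --> l.
Proof.
move=> loo ub lb; case: l loo ub lb => [l _ ub lb|//|_ ub _]; last first.
  by apply/cvgeNyPlt => b; have [N hN] := ub b (ltNyr b); exists N.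
have [|N1 h1] := ub (l + 1); first by rewrite lte_fin ltrDl.
have [|N2 h2] := lb (l - 1); first by rewrite lte_fin ltrBlDr ltrDl.
apply/fine_cvgP; split.
  exists (maxn N1 N2) => // n /=; rewrite geq_max => /andP[n1 n2].
  rewrite fin_numElt (lt_trans (ltNyr _) (h2 n n2)) /=.
  by apply: lt_trans (h1 n n1) _; rewrite ltry.
apply/cvgrPdist_lt => e e0.
have [|N3 h3] := ub (l + e); first by rewrite lte_fin ltrDl.
have [|N4 h4] := lb (l - e); first by rewrite lte_fin ltrBlDr ltrDl.
exists (maxn N3 N4) => // n /=; rewrite geq_max => /andP[/h3 + /h4].
case: (u n) => [x| |] //=; rewrite !lte_fin => h h'.
by rewrite ltr_distlC; apply/andP; split; lra.
Qed.

Lemma elog_ltV (n : nat) (r s : R) : (0 < n)%N -> 0 <= r -> r < expR (s * n%:R) ->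
  ((n%:R^-1)%:E * elog r < s%:E)%E.
Proof.
move=> n0 r0; rewrite /elog; have np : 0 < n%:R :> R by rewrite ltr0n.
case: eqP => [_ _|/eqP rn0 h]; first by rewrite gt0_muleNy ?ltNyr // lte_fin invr_gt0.
have rp : 0 < r by rewrite lt_neqAle eq_sym rn0.
by rewrite -EFinM lte_fin mulrC ltr_pdivrMr // -ltr_expR lnK.
Qed.

Lemma elog_gtV (n : nat) (r s : R) : (0 < n)%N -> expR (s * n%:R) < r ->
  (s%:E < (n%:R^-1)%:E * elog r)%E.
Proof.
move=> n0 h; have rp : 0 < r by apply: lt_trans h; exact: expR_gt0.
have np : 0 < n%:R :> R by rewrite ltr0n.
by rewrite /elog gt_eqF // -EFinM lte_fin mulrC ltr_pdivlMr // -ltr_expR lnK.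
Qed.

Lemma expR_overtakes (K s b : R) : s < b -> exists N, forall m : nat, (N <= m)%N ->
  K * expR (s * m%:R) < expR (b * m%:R).
Proof.
move=> sb; have p0 : 0 < b - s by rewrite subr_gt0.
exists (Num.bound (`|K| / (b - s))) => m hm.
have h : `|K| < (b - s) * m%:R.
  rewrite mulrC -ltr_pdivrMr //; apply: lt_le_trans (archi_boundP _) _; first by rewrite divr_ge0 // ltW.
  by rewrite ler_nat.
have -> : b * m%:R = (b - s) * m%:R + s * m%:R by ring.
rewrite expRD ltr_pM2r ?expR_gt0 //; apply: le_lt_trans (ler_norm K) _; apply: (lt_le_trans h).
by apply: le_trans (expR_ge1Dx _); rewrite lerDr.
Qed.

Variables (M : pointedType) (f : M -> M) (d : nat) (A : M -> 'M[R]_d.+1) (be : R).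
Hypothesis A_bound : forall x v, vnorm (A x *m v) <= expR be * vnorm v.
Local Notation An := (cocycle f A).

Lemma cocycle_power n m x : iter n f x = x -> An (n * m) x = (An n x) ^+ m.
Proof.
move=> per; have it m' : iter (n * m') f x = x.
  by elim: m' => [|m' IH]; rewrite ?muln0 // mulnS iterD IH.
elim: m => [|m IH]; first by rewrite muln0.
by rewrite mulnS addnC cocycleD it IH exprS.
Qed.

Definition modulus_exponent (n : nat) (rho : R) : \bar R :=
  if rho == 0 then -oo%E else (ln rho / n%:R)%:E.

Lemma kernel_exponent n x rho (L : seq {poly R}) v : (0 < n)%N -> iter n f x = x -> 0 <= rho ->
  (forall q, q \in L -> modulus_factor rho q) -> v != 0 ->
  horner_mx (An n x) (\prod_(q <- L) q) *m v = 0 ->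
  (fun m : nat => (m%:R^-1)%:E * elog (vnorm (An m x *m v)))%E @ \oo --> modulus_exponent n rho.
Proof.
move=> n0 per rho0 hL v0 Lv; have np : 0 < n%:R :> R by rewrite ltr0n.
apply: ereal_cvg_order.
- by rewrite /modulus_exponent; case: ifP => _; rewrite ?ltNyr ?ltry.
- move=> b hb.
  have [s [hs sb]] : exists s, rho < expR (s * n%:R) /\ s < b.
    move: hb; rewrite /modulus_exponent; case: eqP => [-> _|/eqP rn0].
      by exists (b - 1); rewrite expR_gt0; split => //; lra.
    rewrite lte_fin => hb; exists ((ln rho / n%:R + b) / 2); split; last lra.
    have rp : 0 < rho by rewrite lt_neqAle eq_sym rn0.
    by rewrite -[X in X < _]lnK // ltr_expR -ltr_pdivrMr //; lra.
  have [K hK] := kernel_growth_upper hs hL Lv.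
  have [|K' hK'] := @grows_le_multiples R M f d.+1 A be A_bound n s x K v n0.
    move=> l; rewrite (cocycle_power _ per); apply: (le_trans (hK l)).
    by rewrite -expRM_natl (_ : l%:R * _ = s * (n * l)%:R) // natrM; ring.
  have [N hN] := expR_overtakes K' sb.
  exists N.+1 => m Nm; apply: elog_ltV; rewrite ?vnorm_ge0 //; first exact: leq_ltn_trans Nm.
  by apply: le_lt_trans (hK' m) _; apply: hN; exact: ltnW.
- move=> a; rewrite /modulus_exponent; case: eqP => [//|/eqP rn0]; rewrite lte_fin => ha.
  have rp : 0 < rho by rewrite lt_neqAle eq_sym rn0.
  have [K K0 hK] := kernel_growth_lower rho0 hL Lv v0.
  pose la := ln rho / n%:R.
  have rhoE l : rho ^+ l = expR (la * (n * l)%:R).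
    rewrite -[in LHS](lnK (x := rho)) // -expRM_natl /la natrM; congr expR.
    by field; rewrite gt_eqF.
  pose K' := K * expR (- (`|be| + `|la|) * n%:R).
  have low m : K' * expR (la * m%:R) <= vnorm (An m x *m v).
    pose l := (m %/ n).+1; pose r := (n * l - m)%N.
    have ml : (m <= n * l)%N by rewrite /l mulnC ltnW // ltn_ceil.
    have rn : (r <= n)%N.
      by rewrite /r leq_subLR {1}(divn_eq m n) /l mulnS mulnC addnC -addnA leq_add2l leq_addl.
    have mE : (n * l)%N = (m + r)%N by rewrite /r subnKC.
    have := hK l; rewrite -(cocycle_power l per) rhoE mE cocycleD -mulmxA => h.
    have Ab y w : vnorm (A y *m w) <= expR `|be| * vnorm w.
      apply: (le_trans (A_bound _ _)); rewrite ler_wpM2r ?vnorm_ge0 // ler_expR; exact: ler_norm.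
    have {}h := le_trans h (cocycle_bound f Ab r _ _).
    rewrite -ler_pdivrMl ?expR_gt0 // -expRN mulrCA -expRD in h.
    apply: le_trans h; rewrite /K' -mulrA -expRD ler_pM2l // ler_expR natrD.
    have rR : r%:R <= n%:R :> R by rewrite ler_nat.
    have h1 := ler_wpM2l (normr_ge0 be) rR; have h2 := ler_wpM2l (normr_ge0 la) rR.
    have h3 : - `|la| * r%:R <= la * r%:R.
      by rewrite ler_wpM2r // lerNl; have := ler_norm (- la); rewrite normrN.
    lra.
  have K'0 : 0 < K' by rewrite mulr_gt0 // expR_gt0.
  have [N hN] := @expR_overtakes K'^-1 a la ha.
  exists N.+1 => m Nm; apply: elog_gtV; first exact: leq_ltn_trans Nm.
  apply: lt_le_trans (low m); rewrite -ltr_pdivrMl //; apply: hN; exact: ltnW.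
Qed.

End KernelExponent.

Section PolynomialKernels.
Variables (F : fieldType) (d : nat).

Lemma trmx_horner_mx (B : 'M[F]_d.+1) p : (horner_mx B p)^T = horner_mx B^T p.
Proof.
elim/poly_ind: p => [|p c IH]; first by rewrite !rmorph0 trmx0.
rewrite !rmorphD !rmorphM /= !horner_mx_X !horner_mx_C linearD /= tr_scalar_mx; congr (_ + _).
rewrite -[_ * B]/(_ *m _) trmx_mul IH -{1}(horner_mx_X B^T) -[_ *m _]/(_ * _) -rmorphM mulrC rmorphM /=.
by rewrite horner_mx_X.
Qed.

Lemma coprimep_prod (I : eqType) (r : seq I) (phi : I -> {poly F}) p :
  (forall i, i \in r -> coprimep p (phi i)) -> coprimep p (\prod_(i <- r) phi i).
Proof.
move=> h; rewrite big_seq; elim/big_ind: _ => [|q q' hq hq'|i ir]; first exact: coprimep1.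
  by rewrite coprimepMr hq hq'.
exact: h.
Qed.

Lemma kermxpoly_prod_seq (I : eqType) (r : seq I) (phi : I -> {poly F}) (g : 'M[F]_d.+1) : uniq r ->
  {in r &, forall i j, i != j -> coprimep (phi i) (phi j)} ->
  (kermxpoly g (\prod_(i <- r) phi i)%R :=: \sum_(i <- r) kermxpoly g (phi i))%MS /\
  \rank (kermxpoly g (\prod_(i <- r) phi i)) = (\sum_(i <- r) \rank (kermxpoly g (phi i)))%N.
Proof.
elim: r => [_ _|i r IH /= /andP[ir ur] cop]; first by rewrite !big_nil kermxpoly1 mxrank0.
have [|E1 E2] := IH ur; first by move=> a b ar br; apply: cop; rewrite inE ?ar ?br orbT.
rewrite !big_cons.
have cp : coprimep (phi i) (\prod_(j <- r) phi j).
  apply: coprimep_prod => j jr; apply: cop; rewrite ?mem_head ?inE ?jr ?orbT //.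
  by apply: contraNneq ir => ->.
split; first by apply: eqmx_trans (kermxpolyM g cp) _; exact: adds_eqmx.
rewrite (kermxpolyM g cp) -E2; apply/eqP.
by rewrite -mxrank_sum_cap mxdirect_kermxpoly // mxrank0 addn0.
Qed.

End PolynomialKernels.

Section PeriodicSplitting.
Variables (R : realType) (M : pointedType) (f : M -> M) (d : nat) (A : M -> 'M[R]_d.+1) (be : R).
Hypothesis A_bound : forall x v, vnorm (A x *m v) <= expR be * vnorm v.
Local Notation An := (cocycle f A).
Variables (p : M) (n : nat).
Hypothesis n0 : (0 < n)%N.
Hypothesis per : iter n f p = p.

Lemma period_shift j : iter n f (iter j f p) = iter j f p.
Proof. by rewrite -iterD addnC iterD per. Qed.

Lemma period_intertwine x (q : {poly R}) : iter n f x = x ->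
  horner_mx (An n (f x)) q *m A x = A x *m horner_mx (An n x) q.
Proof.
move=> px; have h : An n (f x) *m A x = A x *m An n x by rewrite -cocycleS /= px.
elim/poly_ind: q => [|q c IH]; first by rewrite !rmorph0 mul0mx mulmx0.
rewrite !rmorphD !rmorphM /= !horner_mx_X !horner_mx_C mulmxDl mulmxDr scalar_mxC; congr (_ + _).
by rewrite -[_ * An n _]/(_ *m _) -[_ * An n x]/(_ *m _) -mulmxA h !mulmxA IH.
Qed.

Let chi := 'X^n * char_poly (An n p).

Lemma chi_orbit j : (j <= n)%N -> horner_mx (An n (iter j f p)) chi = 0.
Proof.
move=> jn; suff h : horner_mx (An n (iter j f p)) ('X^j * char_poly (An n p)) = 0.
  have -> : chi = 'X^(n - j) * ('X^j * char_poly (An n p)) by rewrite mulrA -exprD subnK.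
  by rewrite rmorphM /= h mulr0.
elim: j {jn} => [|j IH]; first by rewrite mul1r; exact: Cayley_Hamilton.
rewrite exprS -mulrA mulrC rmorphM /= horner_mx_X.
have E : An n (iter j.+1 f p) = A (iter j f p) *m An n.-1 (iter j.+1 f p).
  by rewrite -{1}(prednK n0) /= -iterSr prednK // period_shift.
rewrite [in X in _ * X]E -[_ * _]/(_ *m _) mulmxA period_intertwine ?period_shift //.
by rewrite IH mulmx0 mul0mx.
Qed.

Variable L : seq (R * {poly R}).
Hypothesis chi_L : chi = \prod_(y <- L) y.2.
Hypothesis L_mod : forall y, y \in L -> modulus_factor y.1 y.2.

Definition moduli := undup [seq y.1 | y <- L].
Definition factors r := [seq y.2 | y <- L & y.1 == r].
Definition modulus_space x r : 'M[R]_d.+1 := kermxpoly (An n x)^T (\prod_(q <- factors r) q).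
Local Notation E := modulus_space.

Lemma factorsP r q : q \in factors r -> modulus_factor r q.
Proof. by move=> /mapP[y]; rewrite mem_filter => /andP[/eqP <- yL] ->; exact: L_mod. Qed.

Lemma moduli_ge0 r : r \in moduli -> 0 <= r.
Proof. by rewrite mem_undup => /mapP[y /L_mod/modulus_factor_ge0 + ->]. Qed.

Lemma chi_moduli : chi = \prod_(r <- moduli) \prod_(q <- factors r) q.
Proof.
rewrite chi_L; under [RHS]eq_bigr do rewrite big_map big_filter big_mkcond.
rewrite exchange_big /= big_seq [RHS]big_seq; apply: eq_bigr => y yL.
rewrite -big_mkcond /= (eq_bigl (fun r => r == y.1)) => [|r]; last exact: eq_sym.
by rewrite -big_filter filter_pred1_uniq ?undup_uniq ?mem_undup ?map_f // big_seq1.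
Qed.

Lemma modulus_spaceP x r (v : 'rV[R]_d.+1) :
  (v <= E x r)%MS <-> horner_mx (An n x) (\prod_(q <- factors r) q) *m v^T = 0.
Proof.
rewrite /modulus_space /kermxpoly -trmx_horner_mx; split.
  by move/sub_kermxP => h; apply: trmx_inj; rewrite trmx_mul trmxK h trmx0.
move=> h; apply/sub_kermxP; apply: trmx_inj; by rewrite trmx_mul trmxK h trmx0.
Qed.

Lemma modulus_space_total j : (j <= n)%N ->
  (\sum_(r <- moduli) E (iter j f p) r :=: 1%:M)%MS /\
  (\sum_(r <- moduli) \rank (E (iter j f p) r))%N = d.+1.
Proof.
move=> jn.
have [|h1 h2] := @kermxpoly_prod_seq R d R moduli (fun r => \prod_(q <- factors r) q)
  (An n (iter j f p))^T (undup_uniq _).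
  move=> r r' _ _ rr'; apply: coprimep_prod => q qr'; rewrite coprimep_sym.
  apply: coprimep_prod => q' qr; rewrite coprimep_sym.
  exact: modulus_factor_coprime (factorsP qr) (factorsP qr') rr'.
have hk : (kermxpoly (An n (iter j f p))^T chi :=: 1%:M)%MS.
  by rewrite /kermxpoly -trmx_horner_mx chi_orbit // trmx0; exact: kermx0.
rewrite -chi_moduli in h1 h2; split; first exact: eqmx_trans (eqmx_sym h1) hk.
by rewrite -h2 hk mxrank1.
Qed.

Lemma modulus_space_step x r : iter n f x = x -> (E x r *m (A x)^T <= E (f x) r)%MS.
Proof.
move=> px; apply/row_subP => i; rewrite row_mul; apply/modulus_spaceP.
rewrite trmx_mul trmxK mulmxA period_intertwine // -mulmxA.
by have /modulus_spaceP -> := row_sub i (E x r); rewrite mulmx0.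
Qed.

Lemma modulus_space_rank_step x r : iter n f x = x -> 0 < r ->
  \rank (E x r *m (A x)^T) = \rank (E x r).
Proof.
move=> px r0; rewrite -(mxrank_mul_ker (E x r) (A x)^T).
suff -> : (E x r :&: kermx (A x)^T)%MS = 0 by rewrite mxrank0 addn0.
apply/eqP/rowV0P => v; rewrite sub_capmx => /andP[/modulus_spaceP vE /sub_kermxP vA].
apply/eqP; rewrite -trmx_eq0; apply/negPn/negP => v0.
have [K K0 hK] := kernel_growth_lower (ltW r0) (@factorsP r) vE v0.
have := hK 1%N; rewrite !expr1 leNgt => /negP; apply.
have -> : An n x *m v^T = 0.
  rewrite -(prednK n0) cocycleS -mulmxA.
  have -> : A x *m v^T = 0 by apply: trmx_inj; rewrite trmx_mul trmxK vA trmx0.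
  by rewrite mulmx0.
by rewrite vnorm0 mulr_gt0.
Qed.

Lemma modulus_space_rank j r : (j <= n)%N -> r \in moduli -> \rank (E (iter j f p) r) = \rank (E p r).
Proof.
have step i s : 0 < s -> (\rank (E (iter i f p) s) <= \rank (E (iter i.+1 f p) s))%N.
  move=> s0; rewrite -(modulus_space_rank_step (period_shift i) s0).
  by apply: mxrankS; exact: modulus_space_step (period_shift i).
have mono i i' s : 0 < s -> (i <= i')%N -> (\rank (E (iter i f p) s) <= \rank (E (iter i' f p) s))%N.
  move=> s0 /subnK <-; elim: (i' - i)%N => [//|m IH]; rewrite addSn.
  exact: leq_trans IH (step _ _ s0).
have pos i s : (i <= n)%N -> 0 < s -> \rank (E (iter i f p) s) = \rank (E p s).
  move=> i_n s0; apply/eqP; rewrite eqn_leq; apply/andP; split.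
    by have := mono _ _ s s0 i_n; rewrite per.
  exact: (mono 0%N i s s0 (leq0n i)).
move=> jn rm; have := moduli_ge0 rm; rewrite le_eqVlt => /orP[/eqP r0|r0]; last exact: pos.
have [_ h1] := modulus_space_total jn; have [_ h2] := modulus_space_total (leq0n n).
rewrite /= (bigD1_seq r) ?undup_uniq //= in h1.
rewrite /= (bigD1_seq r) ?undup_uniq //= in h2.
apply/eqP; rewrite -(eqn_add2r (\sum_(i <- moduli | i != r) \rank (E p i))) h2 -[X in _ == X]h1.
rewrite eqn_add2l; apply/eqP; rewrite big_seq_cond [RHS]big_seq_cond; apply: eq_bigr => s /andP[sm sr].
by apply/esym/pos => //; rewrite lt_neqAle moduli_ge0 // andbT r0 eq_sym.
Qed.

End PeriodicSplitting.

Section PeriodicSpectrum.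
Variables (R : realType) (M : pointedType) (dist : M -> M -> R) (f : M -> M).
Hypothesis dist_metric : is_metric dist.
Local Notation MT := (g_sigma_algebraType (mopen dist)).

Lemma block_values (T : Type) (y0 : T) d l (m : 'I_l -> nat) (lam : 'I_l -> T) : exists gk : 'I_d -> T,
  forall (i : 'I_l) (k : 'I_d),
    (\sum_(j < l | (j < i)%N) m j <= k < \sum_(j < l | (j <= i)%N) m j)%N -> gk k = lam i.
Proof.
suff /choice[gk hgk] : forall k : 'I_d, exists y, forall i : 'I_l,
    (\sum_(j < l | (j < i)%N) m j <= k < \sum_(j < l | (j <= i)%N) m j)%N -> y = lam i.
  by exists gk => i k; exact: hgk.
move=> k; have [[i hi]|no] := pselect (exists i : 'I_l,
    (\sum_(j < l | (j < i)%N) m j <= k < \sum_(j < l | (j <= i)%N) m j)%N); last first.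
  by exists y0 => i hi; case: no; exists i.
exists (lam i) => i' hi'; congr lam; apply/val_inj => /=.
have disj (a b : 'I_l) : (a < b)%N -> (k < \sum_(j < l | (j <= a)%N) m j)%N ->
    (\sum_(j < l | (j < b)%N) m j <= k)%N -> False.
  move=> ab h1 h2; have := leq_ltn_trans h2 h1; rewrite ltnNge => /negP; apply.
  rewrite [X in (_ <= X)%N]big_mkcond [X in (X <= _)%N]big_mkcond /=; apply: leq_sum => j _.
  by have [ja|//] := leqP j a; rewrite (leq_ltn_trans ja ab).
move: hi hi' => /andP[a1 a2] /andP[b1 b2].
by have [ii|ii|//] := ltngtP i i'; case: (disj _ _ ii).
Qed.

Lemma ae_orbit (p : M) n (P : M -> Prop) : (forall j, (j < n)%N -> P (iter j f p)) ->
  {ae orbit_measure dist f p n, forall x : MT, P x}.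
Proof.
move=> hP; pose O : set MT := [set x | exists2 j, (j < n)%N & x = iter j f p].
have [dd dd0 ds dt] := dist_metric.
have mO : measurable (~` O).
  apply: measurableC; have -> : O = \bigcup_(j in [set j | (j < n)%N]) [set iter j f p].
    by apply/seteqP; split => x; [move=> [j jn ->]; exists j | move=> [j jn ->]; exists j].
  apply: bigcup_measurable => j _; rewrite -[X in measurable X]setCK; apply: measurableC.
  apply: sub_sigma_algebra => x /= /eqP xp; exists (dist x (iter j f p)).
    by rewrite lt_neqAle dd andbT eq_sym; apply/eqP => /dd0/eqP; exact/negP.
  by move=> y xy yE; move: xy; rewrite yE ltxx.
exists (~` O); split => //; last by move=> x /= nP [j jn xE]; apply: nP; rewrite xE; exact: hP.
have -> : orbit_measure dist f p n (~` O)
  = ((n%:R^-1)%:E * \sum_(j < n) @dirac _ MT (iter j f p) R (~` O))%E by [].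
rewrite big1 ?mule0 // => j _.
by rewrite diracE memNset //=; apply; exists (val j) => //; exact: ltn_ord.
Qed.

Lemma lyap_spectrum_orbit d (A : M -> 'M[R]_d) be (p : M) n :
  (forall x v, vnorm (A x *m v) <= expR be * vnorm v) -> (0 < n)%N -> iter n f p = p ->
  exists gk, lyap_spectrum f A (orbit_measure dist f p n) gk.
Proof.
case: d A => [|d] A A_bound n0 per.
  exists (fun=> 0%E), 0%N, (fun=> 0%E), (fun=> 0%N), (fun _ _ => 0).
  split; [by case | by case | by rewrite big_ord0 | by case |].
  apply: ae_orbit => j _; split.
  + by split; [case|rewrite mxdirectE /= !big_ord0 mxrank0].
  + by rewrite [X in (X == _)%MS]flatmx0 [X in (_ == X)%MS]flatmx0; apply/andP; split; exact: submx_refl.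
  + by case.
  + by case.
  + by case.
have [|L [chi_L L_mod]] := @real_poly_factor R ('X^n * char_poly (cocycle f A n p)).
  by rewrite monicMl ?monicXn // char_poly_monic.
pose E := modulus_space f A n L.
pose rs := sort (>=%R) [seq r <- moduli L | \rank (E p r) != 0%N].
have rs_uniq : uniq rs by rewrite sort_uniq filter_uniq // undup_uniq.
have rs_sorted : sorted (>=%R) rs by apply: sort_sorted => x y; exact: le_total.
pose l := size rs; pose r (i : 'I_l) := rs`_i.
have r_in i : r i \in moduli L /\ \rank (E p (r i)) != 0%N.
  have : r i \in rs by apply: mem_nth.
  by rewrite mem_sort mem_filter => /andP[].
have r_ge0 i : 0 <= r i by exact: (moduli_ge0 L_mod (r_in i).1).
have r_lt (i j : 'I_l) : (i < j)%N -> r j < r i.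
  move=> ij; rewrite lt_neqAle nth_uniq // gtn_eqF //=.
  apply: (sorted_ltn_nth _ 0 rs_sorted) => //; rewrite ?inE //.
  by move=> a b c ba ac; exact: le_trans ac ba.
pose m i := \rank (E p (r i)).
have rankE j i : (j <= n)%N -> \rank (E (iter j f p) (r i)) = m i.
  by move=> jn; apply: (modulus_space_rank n0 per chi_L L_mod) => //; case: (r_in i).
have zero j s : (j <= n)%N -> s \in moduli L -> \rank (E p s) = 0%N -> E (iter j f p) s = 0.
  move=> jn sL e; apply/eqP; rewrite -mxrank_eq0.
  by rewrite (modulus_space_rank n0 per chi_L L_mod) // -/(E p s) e.
have sum_rs j : (j <= n)%N -> (\sum_(i < l) E (iter j f p) (r i) :=: 1%:M)%MS.
  move=> jn; have [h _] := modulus_space_total n0 per chi_L L_mod jn.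
  have -> : (\sum_(i < l) E (iter j f p) (r i))%MS = (\sum_(s <- rs) E (iter j f p) s)%MS.
    by rewrite (big_nth 0) big_mkord.
  rewrite (perm_big _ (permEl (perm_sort _ _))) /= big_filter big_mkcond big_seq /=.
  rewrite (eq_bigr (fun s => E (iter j f p) s)) -?big_seq => [|s sL]; first exact: h.
  by case: eqP => [e|//]; rewrite zero.
have sum_m : (\sum_(i < l) m i)%N = d.+1.
  have [_ h] := modulus_space_total n0 per chi_L L_mod (leq0n n).
  have -> : (\sum_(i < l) m i = \sum_(s <- rs) \rank (E p s))%N by rewrite (big_nth 0) big_mkord.
  rewrite (perm_big _ (permEl (perm_sort _ _))) /= big_filter big_mkcond /= -[RHS]h.
  by apply: eq_bigr => s _; case: eqP => [->|].
pose lam i := modulus_exponent n (r i).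
have [gk hgk] := @block_values (\bar R) 0%E d.+1 l m lam.
exists gk, l, lam, m, (fun x i => E x (r i)); split => //.
- move=> i j ij; have rji := r_lt i j ij.
  have ri : 0 < r i by exact: le_lt_trans (r_ge0 j) rji.
  rewrite /lam /modulus_exponent (gt_eqF ri); case: eqP => [_|/eqP rj0]; first exact: ltNyr.
  rewrite lte_fin ltr_pM2r ?invr_gt0 ?ltr0n // ltr_ln ?posrE // lt_neqAle eq_sym rj0; exact: r_ge0.
- by move=> i; rewrite lt0n; case: (r_in i).
apply: ae_orbit => j jn; have jn' := ltnW jn; have pj := period_shift per j.
have rank_step i : 0 < r i -> \rank (E (iter j f p) (r i) *m (A (iter j f p))^T) = \rank (E (f (iter j f p)) (r i)).
  move=> ri; rewrite (modulus_space_rank_step A n0 L_mod pj ri) -/(E _ _) rankE //.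
  by rewrite -iterS rankE.
split.
- split; first by move=> i; exact: rankE.
  rewrite mxdirectE /=; apply/eqP; rewrite (sum_rs j jn') mxrank1; apply: etrans (esym sum_m) _.
  by apply: eq_bigr => i _; rewrite rankE.
- by apply/eqmxP; exact: sum_rs.
- by move=> i; exact: modulus_space_step.
- move=> i li; have ri : 0 < r i.
    rewrite lt_neqAle r_ge0 andbT eq_sym; apply: contraNneq li => e.
    by rewrite /lam /modulus_exponent e eqxx.
  have le := modulus_space_step A L (r i) pj.
  by rewrite -(mxrank_leqif_eq le) rank_step.
- move=> i v v0 /modulus_spaceP vE.
  apply: (kernel_exponent A_bound n0 pj (r_ge0 i) _ _ vE); last by rewrite trmx_eq0.
  exact: factorsP.
Qed.

End PeriodicSpectrum.

(** * Hoelder cocycles and the conclusion *)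

Section HolderCocycle.
Variables (R : realType) (M : pointedType) (dist : M -> M -> R) (d : nat) (A : M -> 'M[R]_d) (alpha C2 : R).
Hypothesis dist_metric : is_metric dist.
Hypothesis alpha0 : 0 < alpha.
Hypothesis C20 : 0 < C2.
Hypothesis A_holder : forall x y, opnorm (A x - A y) <= C2 * (dist x y) `^ alpha.

Lemma holder_vnorm x y v : vnorm ((A x - A y) *m v) <= C2 * (dist x y) `^ alpha * vnorm v.
Proof. by apply: (le_trans (vnorm_le_opnorm _ _)); rewrite ler_wpM2r ?vnorm_ge0. Qed.

Lemma powR_small (c e : R) : 0 < c -> 0 < e ->
  exists2 rho, 0 < rho & forall x, 0 <= x -> x < rho -> c * x `^ alpha < e.
Proof.
move=> c0 e0; exists ((e / c) `^ alpha^-1); first by apply: powR_gt0; exact: divr_gt0.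
move=> x x0 xr; rewrite mulrC -ltr_pdivlMr //.
have ec : 0 <= e / c by rewrite divr_ge0 // ltW.
have -> : e / c = ((e / c) `^ alpha^-1) `^ alpha by rewrite -powRrM mulVf ?gt_eqF // powRr1.
by apply: gt0_ltr_powR => //; rewrite nnegrE // powR_ge0.
Qed.

Lemma holder_continuous x : mxcvg (mnbhs dist x) A (A x).
Proof.
have [dd dd0 ds dt] := dist_metric.
move=> i j; have FF := mnbhs_filter dist_metric x.
apply/cvgrPdist_lt => e e0; have [rho rho0 hrho] := powR_small C20 e0.
exists rho => // y xy /=; apply: le_lt_trans (hrho _ (dd x y) xy).
have := ler_entry_vnorm (holder_vnorm x y) i j; by rewrite !mxE.
Qed.

Lemma holder_bounded : mcompact dist -> exists2 be, 0 <= be & forall x v, vnorm (A x *m v) <= expR be * vnorm v.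
Proof.
have [dd dd0 ds dt] := dist_metric.
move=> /(mcompact_bounded dist_metric)[D D0 hD]; pose K := mxn (A point) + C2 * D `^ alpha.
have K0 : 0 <= K by rewrite addr_ge0 ?mxn_ge0 // mulr_ge0 ?powR_ge0 // ltW.
exists K => // x v; apply: (@le_trans _ _ (K * vnorm v)); last first.
  rewrite ler_wpM2r ?vnorm_ge0 //; apply: le_trans (expR_ge1Dx _); by rewrite lerDr.
rewrite -(subrK (A point) (A x)) mulmxDl addrC mulrDl; apply: (le_trans (ler_vnormD _ _)).
apply: lerD; first exact: vnorm_mxn.
apply: (le_trans (holder_vnorm _ _ _)); rewrite ler_wpM2r ?vnorm_ge0 // ler_wpM2l ?(ltW C20) //.
by apply: ge0_ler_powR; rewrite ?nnegrE ?(ltW alpha0) ?(ltW D0).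
Qed.

Lemma holder_shadow (C1 theta rho : R) (x y : M) (tau : nat) : 0 <= C1 -> 0 <= rho ->
  dist x y <= C1 * expR (- theta * tau%:R) * rho -> forall v,
  vnorm ((A y - A x) *m v) <= C2 * C1 `^ alpha * rho `^ alpha * expR (- (theta * alpha) * tau%:R) * vnorm v.
Proof.
have [dd dd0 ds dt] := dist_metric.
move=> C10 rho0 hxy v; apply: (le_trans (holder_vnorm _ _ _)); rewrite ler_wpM2r ?vnorm_ge0 // -!mulrA.
rewrite ler_wpM2l ?(ltW C20) //.
have -> : expR (- (theta * alpha) * tau%:R) = expR (- theta * tau%:R) `^ alpha.
  by rewrite -expRM; congr expR; ring.
rewrite [rho `^ _ * _]mulrC -powRM ?expR_ge0 // -powRM ?mulr_ge0 ?expR_ge0 //.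
rewrite ds mulrA; apply: ge0_ler_powR; rewrite ?nnegrE ?(ltW alpha0) //.
by rewrite !mulr_ge0 ?expR_ge0.
Qed.

End HolderCocycle.

Section Approximation.
Variables (R : realType) (M : pointedType) (dist : M -> M -> R) (f : M -> M).
Variables (mu : {measure set (g_sigma_algebraType (mopen dist)) -> \bar R}).
Variables (d : nat) (A : M -> 'M[R]_d) (alpha : R) (gamma : 'I_d -> \bar R).
Hypothesis dist_metric : is_metric dist.
Hypothesis dist_compact : mcompact dist.
Hypothesis f_homeo : homeomorphism dist f.
Hypothesis f_closing : anosov_closing dist f.
Hypothesis mu1 : mu setT = 1%E.
Hypothesis f_inv : invariant_measure f mu.
Hypothesis f_erg : ergodic_measure f mu.
Hypothesis alpha0 : 0 < alpha.
Hypothesis A_holder : holder dist A alpha.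
Hypothesis A_spectrum : lyap_spectrum f A mu gamma.
Local Notation MT := (g_sigma_algebraType (mopen dist)).

Lemma ae_orbit_at (p : M) n (P : M -> Prop) : (0 < n)%N ->
  {ae orbit_measure dist f p n, forall x : MT, P x} -> P p.
Proof.
move=> n0 [S [mS S0 hS]]; apply: contrapT => nP.
have Sp : S p by exact: hS.
have E : orbit_measure dist f p n S
  = ((n%:R^-1)%:E * \sum_(j < n) @dirac _ MT (iter j f p) R S)%E by [].
move: S0; rewrite E => /eqP; apply/negP; rewrite gt_eqF // mule_gt0 ?lte_fin ?invr_gt0 ?ltr0n //.
rewrite (bigD1 (Ordinal n0)) //= diracE mem_set //.
by rewrite (@lt_le_trans _ _ 1%E) ?lte01 // leeDl // sume_ge0.
Qed.

Lemma approximate_spectrum (l : seq (R * R)) : (forall ab, ab \in l -> ab.1 < ab.2) ->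
  exists (p : M) n gk, [/\ (0 < n)%N /\ iter n f p = p,
    lyap_spectrum f A (orbit_measure dist f p n) gk & forall ab, ab \in l -> respects gamma gk ab].
Proof.
move=> l_lt; have [dd dd0 ds dt] := dist_metric.
have [C2 C20 hA] := A_holder; have [g [fK gK f_cont g_cont]] := f_homeo.
have A_cont := holder_continuous dist_metric alpha0 C20 hA.
have [be be0 A_bound] := holder_bounded dist_metric alpha0 C20 hA dist_compact.
have [ae_basis gamma_mono] := lyap_spectrum_basis A_spectrum.
have [C1 [eps0 [theta [C10 eps00 theta0 closing]]]] := f_closing.
have om0 : 0 < theta * alpha by exact: mulr_gt0.
have [G [eta [/andP[eta0 eta2] mG monoG aeG cG]]] := list_controls dist_metric mu1 f_cont f_inv f_erg
  A_cont be0 A_bound gamma_mono ae_basis om0 l_lt.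
have reg := ae_regular f_cont f_inv ae_basis.
have [q [x0 [rx0 ret]]] := return_point dist_metric dist_compact mu1 f_cont g_cont fK f_inv eta0 eta2 mG monoG aeG reg.
have [rh [rho [N [rh0 rho0 H]]]] := cG q x0 rx0.
have c0 : 0 < C2 * C1 `^ alpha by rewrite mulr_gt0 // powR_gt0.
have [rho1 rho10 small] := powR_small alpha0 c0 rh0.
have r0 : 0 < Num.min rho (Num.min eps0 rho1) by rewrite !lt_min rho0 eps00 rho10.
have [n Nn [dn Gn win]] := ret _ N.+1 r0.
move: dn; rewrite !lt_min => /and3P[dn1 dn2 dn3].
have n0 : (0 < n)%N by exact: leq_trans Nn.
have [|p [per hp]] := closing x0 n n0; first by rewrite ds.
have [gk hgk] := lyap_spectrum_orbit dist_metric A_bound n0 per.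
have [ae_p gk_mono] := lyap_spectrum_basis hgk.
have [P hP] := ae_orbit_at n0 ae_p.
exists p, n, gk; split => //.
apply: (H n p gk P Nn per dn1 Gn win _ hP gk_mono) => j v jn.
have := holder_shadow dist_metric alpha0 C20 hA (ltW C10) (dd _ _) (hp j (ltnW jn)) v => /le_trans; apply.
rewrite ler_wpM2r ?vnorm_ge0 // ler_wpM2r ?expR_ge0 // ltW //.
by apply: small => //; rewrite ds.
Qed.

Lemma exponents_lty i : (gamma i < +oo)%E.
Proof.
have [C2 C20 hA] := A_holder; have [g [fK gK f_cont g_cont]] := f_homeo.
have [be be0 A_bound] := holder_bounded dist_metric alpha0 C20 hA dist_compact.
have [ae_basis _] := lyap_spectrum_basis A_spectrum.
by apply: le_lt_trans (exponent_le_be mu1 A_bound ae_basis i) _; rewrite ltry.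
Qed.

Lemma inv_succ_small (e : R) : 0 < e -> exists N, forall n : nat, (N <= n)%N -> n.+1%:R^-1 < e.
Proof.
move=> e0; exists (Num.bound e^-1) => n Nn; rewrite invf_plt ?posrE //.
by apply: lt_le_trans (archi_boundP _) _; rewrite ?invr_ge0 ?(ltW e0) // ler_nat leqW.
Qed.

Lemma periodic_approximation : exists (p : nat -> M) (per : nat -> nat) (gk : nat -> 'I_d -> \bar R),
  [/\ forall k, (0 < per k)%N /\ iter (per k) f (p k) = p k,
      forall k, lyap_spectrum f A (orbit_measure dist f (p k) (per k)) (gk k) &
      forall i : 'I_d, (fun k => gk k i) @ \oo --> gamma i].
Proof.
pose w (k : nat) i := if gamma i is r%:E then r else - k%:R.
pose e (k : nat) : R := k.+1%:R^-1.
have e0 k : 0 < e k by rewrite invr_gt0.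
pose l k := [seq (w k i, w k i + e k) | i <- enum 'I_d] ++ [seq (w k i - e k, w k i) | i <- enum 'I_d].
have l_lt k ab : ab \in l k -> ab.1 < ab.2.
  by rewrite mem_cat => /orP[] /mapP[i _ ->] /=; rewrite ?ltrDl // ltrBlDr ltrDl.
have /choice[F hF] : forall k, exists x : M * nat * ('I_d -> \bar R),
    [/\ (0 < x.1.2)%N /\ iter x.1.2 f x.1.1 = x.1.1,
    lyap_spectrum f A (orbit_measure dist f x.1.1 x.1.2) x.2 &
    forall ab, ab \in l k -> respects gamma x.2 ab].
  by move=> k; have [p [n [gk h]]] := approximate_spectrum (@l_lt k); exists (p, n, gk).
exists (fun k => (F k).1.1), (fun k => (F k).1.2), (fun k => (F k).2); split.
- by move=> k; case: (hF k).
- by move=> k; case: (hF k).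
move=> i; have up k : (gamma i <= (w k i)%:E)%E -> ((F k).2 i <= (w k i + e k)%:E)%E.
  have [_ _ /(_ (w k i, w k i + e k))h] := hF k.
  by apply: (h _ i).1; rewrite mem_cat (map_f (fun i => (w k i, w k i + e k))) // mem_enum.
have lo k : ((w k i)%:E <= gamma i)%E -> ((w k i - e k)%:E <= (F k).2 i)%E.
  have [_ _ /(_ (w k i - e k, w k i))h] := hF k.
  by apply: (h _ i).2; rewrite mem_cat (map_f (fun i => (w k i - e k, w k i))) ?orbT // mem_enum.
have := exponents_lty i; move: up lo; rewrite /w; case: (gamma i) => [r| |] up lo // _.
  apply: ereal_cvg_order; first exact: ltry.
    move=> b; rewrite lte_fin => rb; have [|N hN] := @inv_succ_small (b - r); first by rewrite subr_gt0.
    exists N => k /hN; rewrite -/(e k) => ek; apply: le_lt_trans (up k (lexx _)) _.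
    by rewrite lte_fin; lra.
  move=> a; rewrite lte_fin => ar; have [|N hN] := @inv_succ_small (r - a); first by rewrite subr_gt0.
  exists N => k /hN; rewrite -/(e k) => ek; apply: lt_le_trans (lo k (lexx _)).
  by rewrite lte_fin; lra.
apply: ereal_cvg_order => // b _.
have [N hN] := @inv_succ_small 1 ltr01.
exists (maxn N (Num.bound (`|b| + 1))) => k; rewrite geq_max => /andP[/hN + kb]; rewrite -/(e k) => ek.
apply: le_lt_trans (up k (leNye _)) _; rewrite lte_fin.
have : `|b| + 1 < k%:R.
  by apply: lt_le_trans (archi_boundP _) _; rewrite ?addr_ge0 // ler_nat.
have := ler_norm (- b); rewrite normrN; lra.
Qed.

End Approximation.

Theorem theorem2p1 (R : realType) (M : pointedType) (dist : M -> M -> R) (f : M -> M)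
    (mu : probability (g_sigma_algebraType (mopen dist)) R)
    (d : nat) (A : M -> 'M[R]_d) (alpha : R) :
  is_metric dist -> mcompact dist ->
  homeomorphism dist f -> anosov_closing dist f ->
  invariant_measure f mu -> ergodic_measure f mu ->
  0 < alpha -> holder dist A alpha ->
  forall gamma : 'I_d -> \bar R, lyap_spectrum f A mu gamma ->
  exists (p : nat -> M) (per : nat -> nat) (gk : nat -> 'I_d -> \bar R),
    [/\ (forall k, (0 < per k)%N /\ iter (per k) f (p k) = p k),
        (forall k, lyap_spectrum f A (orbit_measure dist f (p k) (per k)) (gk k)) &
        (forall i : 'I_d, (fun k => gk k i) @ \oo --> gamma i)].
Proof.
move=> dist_metric dist_compact f_homeo f_closing f_inv f_erg alpha0 A_holder gamma A_spectrum.
have mu1 : mu setT = 1%E by exact: probability_setT.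
exact: (periodic_approximation dist_metric dist_compact f_homeo f_closing mu1 f_inv f_erg alpha0 A_holder A_spectrum).
Qed.
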